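(* Let $\mathcal L$: $L[u]=0$ be a differential equation of order $r$ in two independent variables $x=(x_1,x_2)$ and one dependent variable $u$, and let $Q$ be a $k$th co-order weakly singular reduction operator of $\mathcal L$. Suppose additionally that a differential function of minimal order, associated with $L$ on the manifold $\mathcal Q_{(r)}$ up to a nonvanishing multiplier, is of maximal rank in the derivative of $u$ of the highest order $k$ appearing in this differential function. Then $\mathcal L$ possesses a $k$-parametric family of $Q$-invariant solutions, and any $Q$-invariant solution of $\mathcal L$ belongs to this family.
   Context: All considerations are local; functions are smooth. $J^r$ is the jet space with coordinates $x$ and $u_\alpha$, $|\alpha|\le r$; $D_1,D_2$ are the total derivatives. A differential function of order $r$ is a smooth function on (a subset of) $J^r$ involving derivatives of maximal order $r$; the zero function has order $-1$. For a vector field $Q=\xi^1\partial_1+\xi^2\partial_2+\eta\partial_u$ (coefficients functions of $(x,u)$, $(\xi^1,\xi^2)\ne(0,0)$) put $Q[u]=\eta-\xi^1u_1-\xi^2u_2$ and $\mathcal Q_{(r)}=\{D_1^{a}D_2^{b}Q[u]=0,\ a+b<r\}\subset J^r$. A function $u$ is $Q$-invariant if it solves $Q[u]=0$. $Q$ is a reduction operator of $\mathcal L$ if the $r$th prolongation of $Q$ applied to $L$ vanishes on $\{L=0\}\cap\mathcal Q_{(r)}$ (equivalently, the ansatz for $u$ given by the general solution of $Q[u]=0$ reduces $\mathcal L$ to an ordinary differential equation). $Q$ is weakly singular of co-order $k$ for $\mathcal L$ if $k<r$ is the minimal order of differential functions $\tilde L[u]$ for which there is a nonvanishing differential function $\lambda[u]$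 of order not greater than $r$ with $L|_{\mathcal Q_{(r)}}=\lambda\tilde L|_{\mathcal Q_{(r)}}$. Associated function of minimal order: assume, up to permuting $x_1$ and $x_2$, that $\xi^2\neq0$; on $\mathcal Q_{(r)}$ all derivatives of $u$ are expressed via $x$, $u$ and derivatives of $u$ with respect to $x_1$ only. The function meant is a differential function $\tilde L$ of minimal order $k$ satisfying $L|_{\mathcal Q_{(r)}}=\lambda\tilde L|_{\mathcal Q_{(r)}}$ for some nonvanishing differential function $\lambda[u]$ of order not greater than $r$, written in terms of $x$, $u$ and the derivatives $\partial^ju/\partial x_1^j$, $j\le k$, only. Maximal rank in the highest derivative means that its partial derivative with respect to $\partial^ku/\partial x_1^k$ does not vanish on $\tilde L=0$ (so $\tilde L=0$ can be locally solved for that derivative; in the local setting $\tilde L=0$ is taken to be nonempty, and $k\ge0$). A $k$-parametric family of solutions depends on $k$ essential parameters; for $k=0$ it is a single solution.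
   Formalization: The claim is made locally near a jet in the domain of L where Q[u]=0 and the associated function vanish with their differential consequences up to order r; mere nonemptiness of the associated equation is not enough when L is defined only on part of the jet space. *)

(* Defs.v *)
From mathcomp Require Import all_boot all_order all_algebra.
From mathcomp Require Import all_classical all_reals all_analysis.

Set Implicit Arguments.
Unset Strict Implicit.
Unset Printing Implicit Defensive.

Import Order.TTheory GRing.Theory Num.Theory.
Import numFieldNormedType.Exports.

Local Open Scope classical_set_scope.
Local Open Scope ring_scope.

Section Smoothness.
Context {R : realType} {V W : normedModType R}.
Implicit Types (f : V -> W) (A U : set V).

Definition iderive (s : seq V) f : V -> W := foldr (fun v g x => 'D_v g x) f s.

(* C^oo on an open neighbourhood of A: for V finite-dimensional this amounts to
   the existence and continuity of all iterated partial derivatives. *)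
Definition smooth_on A f := exists U, [/\ open U, A `<=` U &
  forall s v x, U x ->
    derivable (iderive s f) x v /\ {for x, continuous (iderive s f)}].

End Smoothness.

(* A multi-index (a, b) stands for a derivatives in x_1 and b in x_2.  The
   independent variables are indexed by 'I_2, where 0 is x_1 and 1 is x_2. *)
Definition mshift (i : 'I_2) (m : nat) (al : nat * nat) : nat * nat :=
  if i == 0 then (al.1 + m, al.2)%N else (al.1, al.2 + m)%N.

Definition midx (r : nat) := {al : 'I_r.+1 * 'I_r.+1 | (al.1 + al.2 <= r)%N}.

Definition mi (r : nat) (p : 'I_#|{: midx r}|) : nat * nat :=
  let al := val (enum_val p) in (nat_of_ord al.1, nat_of_ord al.2).

Definition jet_space (R : realType) (r : nat) : normedModType R :=
  ('rV[R]_2 * 'rV[R]_#|{: midx r}|)%type.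

Section Jets.
Context {R : realType}.
Local Notation J := (jet_space R).

Definition mkjet r (x : 'rV[R]_2) (c : nat * nat -> R) : J r :=
  (x, \row_p c (mi p)).

(* u_al; the sum has one term if |al| <= r, and none otherwise *)
Definition ju r (j : J r) (al : nat * nat) : R := \sum_(p | mi p == al) j.2 0 p.

Definition jproj m n (j : J m) : J n := mkjet n j.1 (ju j).

Definition ex r (i : 'I_2) : J r := (delta_mx 0 i, 0).
Definition eu r (al : nat * nat) : J r := mkjet r 0 (fun be => (be == al)%:R).

Definition pder (al : nat * nat) (u : 'rV[R]_2 -> R) : 'rV[R]_2 -> R :=
  iderive (nseq al.1 (delta_mx 0 0) ++ nseq al.2 (delta_mx 0 1)) u.

Definition jet r (u : 'rV[R]_2 -> R) (x : 'rV[R]_2) : J r :=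
  mkjet r x (fun al => pder al u x).

Definition tder (i : 'I_2) n (F : J n -> R) : J n.+1 -> R := fun j =>
  'D_(ex n i) F (jproj n j) +
  \sum_(p < #|{: midx n}|)
     ju j (mshift i 1 (mi p)) * 'D_(eu n (mi p)) F (jproj n j).

Fixpoint titer (i : 'I_2) m n (F : J n -> R) : J (m + n) -> R :=
  match m return J (m + n) -> R with
  | 0 => F
  | m'.+1 => tder i (@titer i m' n F)
  end.

(* The points of J^r at which all D_1^a D_2^b F of order at most r vanish, i.e.
   the manifold of F = 0 in J^r together with its differential consequences *)
Arguments titer i m {n} F.

Definition consequences n (F : J n -> R) (r : nat) : set (J r) :=
  [set j | forall a b, (a + b + n <= r)%N ->
     titer 0 a (titer 1 b F) (jproj (a + (b + n)) j) = 0].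
Arguments consequences {n} F r _.

Definition has_order r (Om : set (J r)) (L : J r -> R) :=
  smooth_on Om L /\
  exists al, (al.1 + al.2 = r)%N /\ exists2 j, Om j & 'D_(eu r al) L j != 0.

Section VectorField.
Variables (xi : 'I_2 -> J 0 -> R) (eta : J 0 -> R).

Definition vector_field r (Om : set (J r)) :=
  [/\ forall i, smooth_on (jproj 0 @` Om) (xi i),
      smooth_on (jproj 0 @` Om) eta &
      forall j, Om j -> exists i, xi i (jproj 0 j) != 0].

Definition characteristic : J 1 -> R := fun j =>
  eta (jproj 0 j) - \sum_(i < 2) xi i (jproj 0 j) * ju j (mshift i 1 (0, 0)%N).

Definition Qmanifold r : set (J r) := consequences characteristic r.
Arguments Qmanifold r _ : clear implicits.

(* eta^{al + delta_i} =
     D_i eta^al - (D_i xi^1) u_{al + delta_1} - (D_i xi^2) u_{al + delta_2} *)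
Definition eta_step (i : 'I_2) (al : nat * nat) n (F : J n -> R) : J n.+1 -> R :=
  fun j => tder i F j -
    \sum_(l < 2) tder i (xi l) (jproj 1 j) * ju j (mshift l 1 al).

Fixpoint eta2 (b : nat) : J b -> R :=
  match b return J b -> R with
  | 0 => eta
  | b'.+1 => eta_step 1 (0, b')%N (@eta2 b')
  end.

Fixpoint eta_coef (a b : nat) : J (a + b) -> R :=
  match a return J (a + b) -> R with
  | 0 => @eta2 b
  | a'.+1 => eta_step 0 (a', b) (@eta_coef a' b)
  end.

Definition prolong r (F : J r -> R) : J r -> R := fun j =>
  \sum_(i < 2) xi i (jproj 0 j) * 'D_(ex r i) F j +
  \sum_(p < #|{: midx r}|)
     @eta_coef (mi p).1 (mi p).2 (jproj _ j) * 'D_(eu r (mi p)) F j.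

Definition reduction_operator r (Om : set (J r)) (L : J r -> R) :=
  forall j, Om j -> L j = 0 -> Qmanifold r j -> prolong L j = 0.

(* L = lambda * Lt on M for a nonvanishing multiplier lambda, where Lt is a
   function on T evaluated at jets through p *)
Definition associated r (M : set (J r)) (L : J r -> R)
    (T : normedModType R) (p : J r -> T) (Lt : T -> R) :=
  smooth_on (p @` M) Lt /\
  exists lambda : J r -> R, [/\ smooth_on M lambda,
    forall j, M j -> lambda j != 0 &
    forall j, M j -> L j = lambda j * Lt (p j)].

(* The last clause excludes the zero function, whose order is -1. *)
Definition weakly_singular r (Om : set (J r)) (L : J r -> R) (k : nat) :=
  let M := Om `&` Qmanifold r in
  [/\ (k < r)%N,
      exists Lt : J k -> R, associated M L (jproj k) Lt,
      forall m, (m < k)%N ->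
        ~ exists Lt : J m -> R, associated M L (jproj m) Lt &
      ~ forall j, M j -> L j = 0].

Definition Qinvariant_solution r (V : set (J r)) (L : J r -> R)
    (W : set 'rV[R]_2) (u : 'rV[R]_2 -> R) :=
  smooth_on W u /\
  forall x, W x -> [/\ V (jet r u x), characteristic (jet 1 u x) = 0 &
                       L (jet r u x) = 0].

End VectorField.
Arguments Qmanifold xi eta r _ : clear implicits.

(* (x, u, d_i u, ..., d_i^k u) *)
Definition pure_jet (i : 'I_2) (k n : nat) (j : J n) : 'rV[R]_2 * 'rV[R]_k.+1 :=
  (j.1, \row_(a < k.+1) ju j (mshift i a (0, 0)%N)).

Definition maximal_rank (i : 'I_2) (k r : nat) (M : set (J r))
    (G : 'rV[R]_2 * 'rV[R]_k.+1 -> R) :=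
  forall j, M j -> G (pure_jet i k j) = 0 ->
    'D_(0, delta_mx 0 ord_max) G (pure_jet i k j) != 0.

(* The parameters are essential if not even a restriction of the family to
   smaller open sets can be expressed through fewer parameters. *)
Definition essential (k : nat) (U : set 'rV[R]_2) (C : set 'rV[R]_k)
    (f : 'rV[R]_2 * 'rV[R]_k -> R) :=
  forall (m : nat) (U' : set 'rV[R]_2) (C' : set 'rV[R]_k)
    (A : 'rV[R]_k -> 'rV[R]_m) (g : 'rV[R]_2 * 'rV[R]_m -> R),
    (m < k)%N -> open U' -> U' !=set0 -> U' `<=` U ->
    open C' -> C' !=set0 -> C' `<=` C ->
    smooth_on C' A -> smooth_on (U' `*` (A @` C')) g ->
    ~ forall x c, U' x -> C' c -> f (x, c) = g (x, A c).

Definition parametric_family (k : nat) (U : set 'rV[R]_2) (C : set 'rV[R]_k)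
    (f : 'rV[R]_2 * 'rV[R]_k -> R) :=
  [/\ open C, C !=set0, smooth_on (U `*` C) f & essential U C f].

End Jets.
Arguments consequences {R n} F r _.
Arguments Qmanifold {R} xi eta r _.

(* Main.v *)
Require Import Defs.
From mathcomp Require Import all_boot all_order all_algebra.
From mathcomp Require Import all_classical all_reals all_analysis.
From HB Require Import structures.
From mathcomp Require Import ring lra.
Import Order.TTheory GRing.Theory Num.Theory.
Import numFieldNormedType.Exports.
Local Open Scope classical_set_scope.
Local Open Scope ring_scope.

Set Implicit Arguments.
Unset Strict Implicit.
Unset Printing Implicit Defensive.


(** Since [xi i'] does not vanish, Q[u] = 0 is the quasilinear equation u_i' = h - z u_i with z =
    xi^i / xi^i' and h = eta / xi^i'. On Q_(r) the equation L = 0 amounts to G(x, u, u_i, ...,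
    u_i^(k)) = 0, and maximal rank allows this to be solved locally as u_i^(k) = g(x, u, ...,
    u_i^(k-1)) ([solve_top]). With w = (u, ..., u_i^(k-1)), the Q-invariant solutions become the
    solutions of a total differential system d_i w = a(x, w), d_i' w = b(x, w), whose right-hand
    sides are the vertical parts of [Afield] and [Bfield]. Once these two fields commute,
    [frobenius] gives a family Phi(x, c) of integral surfaces together with its inverse Psi. The k
    components of c are the parameters; Psi is a first integral, so its constant value on a given
    solution names the member of the family ([nice_unique]). For k = 0 there is no w, and the
    compatibility relation says directly that u = g solves Q[u] = 0.

    Commutation is where the reduction condition enters. The components below the top one agree by
    construction ([commute_fields]); the top one is the relation B(g) = A^k(b), proved in [compat].
    Through each point t near the base point one solves the Cauchy problem for Q[u] = 0 with data,
    on the line through x in direction i, taken from the integral curve of [Afield]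
    ([cauchy_family], [member_family]). Along a Q-invariant function the prolonged field acts as
    xi^1 D_1 + xi^2 D_2 ([prolong_jet]). As G vanishes on the line, the reduction condition for L =
    lam G leaves D_i' G = 0 at the point ([member_transversal]). Differentiating the identity
    u_i^(k) = gt(x, w, G) in direction i' then gives the relation ([member_compat]).

    The hypotheses on L hold only near the jet j0, so the jets of the auxiliary functions must be
    kept there. An r-jet satisfying the consequences of Q[u] = 0 and G = 0 is determined by its pure
    derivatives up to order k ([rigid_jet]). Hence the auxiliary function at the base point has
    exactly the jet j0, and continuity takes care of its neighbours.

    The analysis rests on ordinary differential equations. Gronwall's inequality and Picard
    iteration produce smooth local flows ([flow]), and flows in turn give the implicit function
    theorem ([ift]), the method of characteristics ([cauchy_family]) and Frobenius' theorem. *)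

(** * Finite dimension as a chosen bicontinuous linear chart onto row vectors *)

Class fdim (R : realType) (V : normedModType R) := Fdim {
  fd_n : nat;
  fd_f : {linear V -> 'rV[R]_fd_n};
  fd_g : {linear 'rV[R]_fd_n -> V};
  fd_fK : cancel fd_f fd_g;
  fd_gK : cancel fd_g fd_f;
  fd_fc : continuous fd_f;
  fd_gc : continuous fd_g }.

Lemma linear_continuous_le (R : realType) (V W : normedModType R)
    (f : {linear V -> W}) (k : R) :
  (forall x, `|f x| <= k * `|x|) -> continuous f.
Proof.
move=> H; apply/linear_bounded_continuous/linear_boundedP.
exists k; split; first exact: num_real.
by move=> M kM x; rewrite (le_trans (H x))// ler_wpM2r// ltW.
Qed.

Section Instances.
Variable R : realType.

(** The identity chart, kept transparent by [Defined]: the coordinates [fd_c] of a row vector then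
    compute to its entries, on which [derive_row_decomp] and [vanishv_rV] rely. *)
Instance fdim_rV n : fdim 'rV[R]_n.
Proof.
by apply: (@Fdim _ 'rV[R]_n n idfun idfun) => // x; exact: cvg_id.
Defined.

Lemma mx_norm_coord m n (x : 'M[R]_(m, n)) i j : `|x i j| <= `|x|.
Proof.
rewrite [leRHS]/Num.Def.normr/= mx_normrE.
exact: (le_bigmax _ (fun p : 'I_m * 'I_n => `|x p.1 p.2|) (i, j)).
Qed.

Lemma mx_norm_le m n (x : 'M[R]_(m, n)) (e : R) : 0 <= e ->
  (forall i j, `|x i j| <= e) -> `|x| <= e.
Proof.
move=> e0 xe; rewrite [leLHS]/Num.Def.normr/= mx_normrE bigmax_le// => -[i j] _; exact: xe.
Qed.

Definition rv1 (x : R) : 'rV[R]_1 := \row_(_ < 1) x.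
Definition vr1 (x : 'rV[R]_1) : R := x 0 0.
Lemma rv1_lin : linear rv1.
Proof. by move=> a x y; apply/rowP => j; rewrite !mxE. Qed.
Lemma vr1_lin : linear_for *%R vr1.
Proof. by move=> a x y; rewrite /vr1 !mxE. Qed.
HB.instance Definition _ := GRing.isLinear.Build R R 'rV[R]_1 *:%R rv1 rv1_lin.
HB.instance Definition _ := GRing.isLinear.Build R 'rV[R]_1 R *%R vr1 vr1_lin.

Instance fdim_R : fdim R.
Proof.
apply: (@Fdim _ R 1 rv1 vr1).
- by move=> x /=; rewrite /vr1 /rv1 mxE.
- by move=> x /=; apply/rowP => j; rewrite /rv1 mxE ord1.
- apply: (@linear_continuous_le _ _ _ _ 1) => x; rewrite mul1r.
  by apply: mx_norm_le => // i j; rewrite /rv1 /= mxE.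
- apply: (@linear_continuous_le _ _ _ _ 1) => x; rewrite mul1r.
  exact: mx_norm_coord.
Defined.

Section prod.
Variables (V W : normedModType R) (fV : fdim V) (fW : fdim W).
Let NV := fd_n (V := V). Let NW := fd_n (V := W).
Definition fd_pf (x : V * W) : 'rV[R]_(NV + NW) := row_mx (fd_f x.1) (fd_f x.2).
Definition fd_pg (y : 'rV[R]_(NV + NW)) : V * W := (fd_g (lsubmx y), fd_g (rsubmx y)).
Lemma fd_pf_lin : linear fd_pf.
Proof.
by move=> a x y; rewrite /fd_pf /= !linearP scale_row_mx add_row_mx.
Qed.
Lemma fd_pg_lin : linear fd_pg.
Proof. by move=> a x y; rewrite /fd_pg !linearP. Qed.
Lemma fd_pfK : cancel fd_pf fd_pg.
Proof.
by move=> [x y]; rewrite /fd_pg /fd_pf /= row_mxKl row_mxKr !fd_fK.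
Qed.
Lemma fd_pgK : cancel fd_pg fd_pf.
Proof. by move=> x; rewrite /fd_pg /fd_pf /= !fd_gK hsubmxK. Qed.
Lemma fd_pf_le : exists k, forall x, `|fd_pf x| <= k * `|x|.
Proof.
have [k1 k10 H1] := linear_lipschitz (@fd_fc _ _ fV).
have [k2 k20 H2] := linear_lipschitz (@fd_fc _ _ fW).
exists (k1 + k2) => -[x y].
have k10' := ltW k10; have k20' := ltW k20.
have hx : `|x| <= `|(x, y)| by rewrite prod_normE /= le_max lexx.
have hy : `|y| <= `|(x, y)| by rewrite prod_normE /= le_max lexx orbT.
apply: mx_norm_le; first by rewrite mulr_ge0// addr_ge0.
move=> i j; rewrite /fd_pf mxE; case: fintype.split => l /=.
  rewrite (le_trans (mx_norm_coord _ _ _))// (le_trans (H1 x))//.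
  by rewrite mulrDl -[leLHS]addr0 lerD ?ler_pM// mulr_ge0.
rewrite (le_trans (mx_norm_coord _ _ _))// (le_trans (H2 y))//.
by rewrite mulrDl -[leLHS]add0r lerD ?ler_pM// mulr_ge0.
Qed.
Lemma fd_pg_le : exists k, forall x, `|fd_pg x| <= k * `|x|.
Proof.
have [k1 k10 H1] := linear_lipschitz (@fd_gc _ _ fV).
have [k2 k20 H2] := linear_lipschitz (@fd_gc _ _ fW).
exists (k1 + k2) => y.
have k10' := ltW k10; have k20' := ltW k20.
rewrite prod_normE /= ge_max; apply/andP; split.
  rewrite (le_trans (H1 _))// mulrDl -[leLHS]addr0 lerD// ?mulr_ge0//.
  by rewrite ler_wpM2l//; apply: mx_norm_le => // i j; rewrite mxE mx_norm_coord.
rewrite (le_trans (H2 _))// mulrDl -[leLHS]add0r lerD// ?mulr_ge0//.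
by rewrite ler_wpM2l//; apply: mx_norm_le => // i j; rewrite mxE mx_norm_coord.
Qed.
HB.instance Definition _ := GRing.isLinear.Build R (V * W)%type 'rV[R]_(NV + NW) *:%R fd_pf fd_pf_lin.
HB.instance Definition _ := GRing.isLinear.Build R 'rV[R]_(NV + NW) (V * W)%type *:%R fd_pg fd_pg_lin.

Instance fdim_prod : fdim (V * W)%type.
Proof.
apply: (@Fdim _ (V * W)%type (NV + NW)%N fd_pf fd_pg).
- exact: fd_pfK.
- exact: fd_pgK.
- by have [k H] := fd_pf_le; exact: linear_continuous_le H.
- by have [k H] := fd_pg_le; exact: linear_continuous_le H.
Defined.
End prod.
End Instances.
#[export] Existing Instances fdim_rV fdim_R fdim_prod.

(** * Differentiability as an inequality near the point *)

Section DiffChar.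
Context {R : realType} {V W : normedModType R}.

Lemma differentiable_near_le (f : V -> W) (x : V) (D : {linear V -> W}) :
  continuous D ->
  (forall e : R, 0 < e -> \forall y \near x, `|f y - f x - D (y - x)| <= e * `|y - x|) ->
  differentiable f x /\ 'd f x = D :> (V -> W).
Proof.
move=> Dc H.
have E : f \o shift x = cst (f x) + D +o_ 0 id.
  apply/eqaddoP => _/posnumP[e].
  have /= := H e%:num ltac:(by []); rewrite (near_shift 0)/= => {}H.
  apply: filterS H => y /=.
  by rewrite subr0 addrK !fctE opprD addrA.
have ED := diff_unique Dc E.
by split=> //; apply/diff_locallyP; rewrite ED.
Qed.

Lemma differentiable_le_near (f : V -> W) (x : V) : differentiable f x ->
  forall e : R, 0 < e -> \forall y \near x, `|f y - f x - 'd f x (y - x)| <= e * `|y - x|.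
Proof.
move=> /diff_locally /eqaddoP H e e0.
have {}H := H e e0; rewrite (near_shift 0)/=; apply: filterS H => y /=.
by rewrite subr0 addrK !fctE opprD addrA.
Qed.

Lemma near_eq_differentiable (f g : V -> W) (x : V) :
  (\forall y \near x, f y = g y) -> differentiable f x -> differentiable g x.
Proof.
move=> fg df; suff : differentiable g x /\ 'd g x = 'd f x :> (V -> W) by case.
apply: differentiable_near_le; first exact: diff_continuous.
move=> e e0; have H := differentiable_le_near df e0.
have fgx := nbhs_singleton fg.
by apply: filterS2 fg H => y <-; rewrite fgx.
Qed.

Lemma near_eq_continuous (T U : topologicalType) (f g : T -> U) (x : T) :
  (\forall y \near x, f y = g y) -> {for x, continuous f} -> {for x, continuous g}.
Proof.
move=> fg; rewrite /prop_for /continuous_at (nbhs_singleton fg) => cf.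
by apply: cvg_trans cf; apply: near_eq_cvg; apply: filterS fg => y ->.
Qed.

End DiffChar.

(** * Functions of class C^n *)

Section Cn.
Context {R : realType}.

(** Class C^n by recursion on derivatives along fixed vectors: every derivative remains a map from
    [V] to [W], so no spaces of multilinear maps appear. *)
Fixpoint Cn (V W : normedModType R) (n : nat) (U : set V) (f : V -> W) : Prop :=
  match n with
  | 0 => forall x, U x -> {for x, continuous f}
  | n'.+1 => (forall x, U x -> differentiable f x) /\
             forall v, Cn n' U (fun x => 'D_v f x)
  end.

Lemma Cn_ext (V W : normedModType R) n U (f g : V -> W) :
  open U -> (forall x, U x -> f x = g x) -> Cn n U f -> Cn n U g.
Proof.
move=> Uo; elim: n f g => [|n IH] f g fg /=.
  move=> H x Ux; apply: near_eq_continuous (H x Ux).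
  by apply: filterS fg _; exact: open_nbhs_nbhs.
move=> [H1 H2]; split.
  move=> x Ux; apply: near_eq_differentiable (H1 x Ux).
  by apply: filterS fg _; exact: open_nbhs_nbhs.
move=> v; apply: IH (H2 v) => x Ux; apply: near_eq_derive.
by apply: filterS fg _; exact: open_nbhs_nbhs.
Qed.

Lemma Cn_sub (V W : normedModType R) n (U U' : set V) (f : V -> W) :
  U' `<=` U -> Cn n U f -> Cn n U' f.
Proof.
move=> sU; elim: n f => [|n IH] f /= H; first by move=> x /sU; exact: H.
by case: H => H1 H2; split=> [x /sU|v]; [exact: H1|exact: IH].
Qed.

Lemma CnW (V W : normedModType R) n (U : set V) (f : V -> W) :
  Cn n.+1 U f -> Cn n U f.
Proof.
elim: n f => [|n IH] f.
  by move=> [H _] x Ux; apply: differentiable_continuous; exact: H.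
by move=> [H1 H2]; split=> // v; apply: IH; exact: H2.
Qed.

Lemma Cn_cont (V W : normedModType R) n (U : set V) (f : V -> W) :
  Cn n U f -> forall x, U x -> {for x, continuous f}.
Proof. by elim: n f => // n IH f /CnW; exact: IH. Qed.

Lemma Cn_cst (V W : normedModType R) n (U : set V) (c : W) :
  Cn n U (fun _ : V => c).
Proof.
elim: n c => [|n IH] c /=; first by move=> x _; exact: cvg_cst.
split=> [x _|v]; first exact: differentiable_cst.
have -> : (fun x => 'D_v (fun _ : V => c) x) = (fun=> 0).
  by apply/funext => x; rewrite derive_cst.
exact: IH.
Qed.

Lemma derive_lin (V W : normedModType R) (f : {linear V -> W}) x v :
  continuous f -> 'D_v f x = f v.
Proof.
by move=> fc; rewrite deriveE ?diff_lin//; exact: linear_differentiable.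
Qed.

Lemma Cn_lin (V W : normedModType R) n (U : set V) (f : {linear V -> W}) :
  continuous f -> Cn n U f.
Proof.
case: n => [|n] fc /=; first by move=> x _; exact: fc.
split=> [x _|v]; first exact: linear_differentiable.
have -> : (fun x => 'D_v f x) = (fun=> f v).
  by apply/funext => x; rewrite derive_lin.
exact: Cn_cst.
Qed.

Lemma CnD (V W : normedModType R) n (U : set V) (f g : V -> W) : open U ->
  Cn n U f -> Cn n U g -> Cn n U (fun x => f x + g x).
Proof.
move=> Uo; elim: n f g => [|n IH] f g /=.
  by move=> Hf Hg x Ux; apply: cvgD; [exact: Hf|exact: Hg].
move=> [f1 f2] [g1 g2]; split.
  by move=> x Ux; apply: differentiableD; [exact: f1|exact: g1].
move=> v; apply: Cn_ext (IH _ _ (f2 v) (g2 v)) => // x Ux.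
by rewrite deriveD//; apply: diff_derivable; [exact: f1|exact: g1].
Qed.

Lemma Cn_comp_lin (V W X : normedModType R) n (U : set V) (f : V -> W)
    (l : {linear W -> X}) : open U -> continuous l ->
  Cn n U f -> Cn n U (fun x => l (f x)).
Proof.
move=> Uo lc; elim: n f => [|n IH] f /=.
  by move=> Hf x Ux; apply: continuous_comp; [exact: Hf|exact: lc].
move=> [f1 f2]; split.
  by move=> x Ux; apply: differentiable_comp; [exact: f1|exact: linear_differentiable].
move=> v; apply: Cn_ext (IH _ (f2 v)) => // x Ux.
rewrite [in RHS]deriveE; last first.
  by apply: differentiable_comp; [exact: f1|exact: linear_differentiable].
rewrite diff_comp ?diff_lin//=; last 2 first.
- exact: f1.
- exact: linear_differentiable.
by rewrite deriveE//; exact: f1.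
Qed.

Lemma CnM (V : normedModType R) n (U : set V) (f g : V -> R) : open U ->
  Cn n U f -> Cn n U g -> Cn n U (fun x => f x * g x).
Proof.
move=> Uo; elim: n f g => [|n IH] f g /=.
  by move=> Hf Hg x Ux; apply: cvgM; [exact: Hf|exact: Hg].
move=> [f1 f2] [g1 g2]; split.
  by move=> x Ux; apply: differentiableM; [exact: f1|exact: g1].
have cf : Cn n U f by apply: CnW.
have cg : Cn n U g by apply: CnW.
move=> v; apply: Cn_ext (CnD Uo (IH _ _ cf (g2 v)) (IH _ _ cg (f2 v))) => // x Ux.
by rewrite deriveM//; apply: diff_derivable; [exact: f1|exact: g1].
Qed.

Lemma CnZl (V W : normedModType R) n (U : set V) (f : V -> R) (w : W) : open U ->
  Cn n U f -> Cn n U (fun x => f x *: w).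
Proof.
move=> Uo.
pose l : R -> W := fun a => a *: w.
have ll : linear l by move=> a x y; rewrite /l scalerDl scalerA.
pose lM := GRing.isLinear.Build _ _ _ _ l ll.
pose L : {linear R -> W} := HB.pack l lM.
by apply: (@Cn_comp_lin V _ _ n U f L) => //; exact: scalel_continuous.
Qed.

Lemma CnV (V : normedModType R) n (U : set V) (f : V -> R) : open U ->
  (forall x, U x -> f x != 0) -> Cn n U f -> Cn n U (fun x => (f x)^-1).
Proof.
move=> Uo f0; elim: n f f0 => [|n IH] f f0 /=.
  by move=> Hf x Ux; apply: cvgV; [exact: f0|exact: Hf].
move=> [f1 f2]; split.
  by move=> x Ux; apply: differentiableV; [exact: f1|exact: f0].
have cf : Cn n U f by apply: CnW.
have cV := IH _ f0 cf.
move=> v; apply: (@Cn_ext _ _ n U (fun x => (-1 * ((f x)^-1 * (f x)^-1)) * 'D_v f x)) => //; last first.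
  by apply: CnM => //; apply: CnM => //; [exact: Cn_cst|exact: CnM].
move=> x Ux; rewrite (@deriveV _ _ f); last 2 first.
- exact: f0.
- by apply: diff_derivable; exact: f1.
by rewrite mulN1r -invfM -expr2 -exprVn exprVn /GRing.scale /=.
Qed.

Lemma Cn_pair (V W X : normedModType R) n (U : set V) (f : V -> W) (g : V -> X) :
  open U -> Cn n U f -> Cn n U g -> Cn n U (fun x => (f x, g x)).
Proof.
move=> Uo; elim: n f g => [|n IH] f g /=.
  by move=> Hf Hg x Ux; apply: cvg_pair; [exact: Hf|exact: Hg].
move=> [f1 f2] [g1 g2]; split.
  by move=> x Ux; apply: (differentiable_pair (f1 x Ux) (g1 x Ux)).
move=> v; apply: Cn_ext (IH _ _ (f2 v) (g2 v)) => // x Ux.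
have d1 := f1 _ Ux; have d2 := g1 _ Ux.
rewrite [RHS]deriveE; last exact: differentiable_pair.
by rewrite diff_pair//= !deriveE.
Qed.

Lemma Cn_sum (V W : normedModType R) n (U : set V) (I : Type) (r : seq I)
    (P : pred I) (F : I -> V -> W) : open U ->
  (forall i, P i -> Cn n U (F i)) -> Cn n U (fun x => \sum_(i <- r | P i) F i x).
Proof.
move=> Uo H; elim: r => [|a r IH].
  by under eq_fun do rewrite big_nil; exact: Cn_cst.
under eq_fun do rewrite big_cons.
by case: (boolP (P a)) => // Pa; apply: CnD => //; exact: H.
Qed.

Definition fd_e (W : normedModType R) {fW : fdim W} (l : 'I_(@fd_n _ W fW)) : W :=
  fd_g (delta_mx 0 l).
Definition fd_c (W : normedModType R) {fW : fdim W} (w : W) (l : 'I_(@fd_n _ W fW)) : R :=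
  (fd_f w : 'rV_(@fd_n _ W fW)) 0 l.

Lemma fd_decomp (W : normedModType R) {fW : fdim W} (w : W) :
  w = \sum_l fd_c w l *: fd_e l.
Proof.
rewrite -[LHS](@fd_fK _ _ fW) {1}(row_sum_delta (fd_f w)) linear_sum.
by apply: eq_bigr => l _; rewrite linearZ.
Qed.

Definition fd_co (W : normedModType R) {fW : fdim W} l : W -> R := fun w => fd_c w l.
Lemma fd_co_lin (W : normedModType R) {fW : fdim W} l : linear_for *%R (@fd_co W fW l).
Proof. by move=> a x y; rewrite /fd_co /fd_c linearP !mxE. Qed.
HB.instance Definition _ (W : normedModType R) {fW : fdim W} l :=
  GRing.isLinear.Build R W R *%R (@fd_co W fW l) (fd_co_lin l).
Lemma fd_co_continuous (W : normedModType R) {fW : fdim W} l : continuous (@fd_co W fW l).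
Proof.
move=> x; apply: (@continuous_comp _ _ _ (@fd_f _ _ fW) (fun M => M 0 l)).
  exact: fd_fc.
exact: coord_continuous.
Qed.

Lemma Cn_coord (V W : normedModType R) {fW : fdim W} n (U : set V) (f : V -> W) :
  open U -> (forall l, Cn n U (fun x => fd_c (f x) l)) -> Cn n U f.
Proof.
move=> Uo H; rewrite (_ : f = fun x => \sum_l fd_c (f x) l *: fd_e l); last first.
  by apply/funext => x; rewrite -fd_decomp.
by apply: Cn_sum => // l _; exact: CnZl.
Qed.

Lemma CnZ (V X : normedModType R) {fX : fdim X} n (U : set V) (f : V -> R) (g : V -> X) :
  open U -> Cn n U f -> Cn n U g -> Cn n U (fun x => f x *: g x).
Proof.
move=> Uo Hf Hg; apply: Cn_coord => // l.
apply: (@Cn_ext _ _ n U (fun x => f x * fd_c (g x) l)) => //.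
  by move=> x Ux; rewrite /fd_c linearZ mxE.
by apply: CnM => //; exact: (Cn_comp_lin Uo (@fd_co_continuous _ _ l) Hg).
Qed.

(** The chain rule differentiates [g] in the varying direction ['D_v f x]. Expanding this direction
    in a basis of [W] turns the derivative into a sum of products of coordinates of ['D_v f] with
    fixed partial derivatives of [g] at [f x], to which the induction hypothesis applies. *)
Lemma Cn_comp (V W X : normedModType R) {fW : fdim W} {fX : fdim X} n
    (U : set V) (U' : set W) (f : V -> W) (g : W -> X) : open U -> open U' ->
  (forall x, U x -> U' (f x)) ->
  Cn n U f -> Cn n U' g -> Cn n U (fun x => g (f x)).
Proof.
move=> Uo Uo' fU; elim: n X fX g => [|n IH] X fX g /=.
  move=> Hf Hg x Ux; apply: continuous_comp; first exact: Hf.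
  by apply: Hg; exact: fU.
move=> Hf' [g1 g2]; have Hf := CnW Hf'; move: Hf' => [f1 f2].
split.
  move=> x Ux; apply: differentiable_comp; first exact: f1.
  by apply: g1; exact: fU.
move=> v.
apply: (@Cn_ext _ _ n U (fun x => \sum_l fd_c ('D_v f x) l *: 'D_(fd_e l) g (f x))) => //.
  move=> x Ux; have gd := g1 _ (fU _ Ux); have fd := f1 _ Ux.
  rewrite [RHS]deriveE; last exact: differentiable_comp.
  rewrite diff_comp//= -(deriveE v fd).
  rewrite [in RHS](fd_decomp ('D_v f x)) linear_sum.
  by apply: eq_bigr => l _; rewrite linearZ -deriveE.
apply: Cn_sum => // l _; apply: CnZ => //.
  exact: (Cn_comp_lin Uo (@fd_co_continuous _ _ l) (f2 v)).
exact: IH (g2 _).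
Qed.

End Cn.

(** * Continuous partial derivatives imply differentiability *)

Section Partials.
Context {R : realType}.

Lemma is_derive_line (V W : normedModType R) (f : V -> W) (x v : V) (t : R) :
  derivable f (x + t *: v) v ->
  is_derive t 1 (fun s : R => f (x + s *: v)) ('D_v f (x + t *: v)).
Proof.
have E : (fun h : R => h^-1 *: (((fun s : R => f (x + s *: v)) \o shift t) (h *: (1 : R)) -
    f (x + t *: v))) =
  (fun h : R => h^-1 *: ((f \o shift (x + t *: v)) (h *: v) - f (x + t *: v))).
  apply/funext => h /=; congr (_ *: (f _ - _)).
  by rewrite [h *: 1]mulr1 scalerDl addrCA.
move=> df; apply: DeriveDef; first by rewrite /derivable E.
by rewrite /derive E.
Qed.

Lemma mvt_line (V : normedModType R) (f : V -> R) (x v : V) (a : R) :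
  (forall t : R, `|t| <= `|a| -> derivable f (x + t *: v) v) ->
  exists2 t : R, `|t| <= `|a| & f (x + a *: v) - f x = a * 'D_v f (x + t *: v).
Proof.
move=> H.
have dg (t : R) : `|t| <= `|a| ->
  is_derive t 1 (fun s : R => f (x + s *: v)) ('D_v f (x + t *: v)).
  by move=> ta; apply: is_derive_line; exact: H.
have cg b c : - `|a| <= b -> c <= `|a| ->
    {within `[b, c], continuous (fun s : R => f (x + s *: v))}.
  move=> ab ca; apply: derivable_within_continuous => t; rewrite in_itv /= => /andP[bt tc].
  have ta : `|t| <= `|a| by rewrite ler_norml (le_trans ab bt) (le_trans tc ca).
  by have [] := dg t ta.
have [a0|a0|->] := ltgtP a 0.
- have na : `|a| = - a by rewrite ltr0_norm.
  have Hd (t : R) : t \in `]a, 0[ -> is_derive t 1 (fun s : R => f (x + s *: v)) ('D_v f (x + t *: v)).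
    rewrite in_itv /= => /andP[at0 t0]; apply: dg.
    by rewrite na ltr0_norm// lerN2 ltW.
  have [|t] := MVT a0 Hd; first by apply: cg; rewrite na ?opprK// oppr_ge0 ltW.
  rewrite in_itv /= => /andP[at0 t0] E.
  exists t; first by rewrite na ltr0_norm// lerN2 ltW.
  move: E; rewrite scale0r addr0 sub0r mulrN => E.
  by rewrite -opprB E opprK mulrC.
- have na : `|a| = a by rewrite gtr0_norm.
  have Hd (t : R) : t \in `]0, a[ -> is_derive t 1 (fun s : R => f (x + s *: v)) ('D_v f (x + t *: v)).
    rewrite in_itv /= => /andP[at0 t0]; apply: dg.
    by rewrite na gtr0_norm// ltW.
  have [|t] := MVT a0 Hd; first by apply: cg; rewrite na// oppr_le0 ltW.
  rewrite in_itv /= => /andP[at0 t0] E.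
  exists t; first by rewrite na gtr0_norm// ltW.
  by move: E; rewrite scale0r addr0 subr0 mulrC.
- by exists 0; rewrite ?normr0// scale0r addr0 subrr mul0r.
Qed.

Definition trunc N (h : 'rV[R]_N) (m : nat) : 'rV[R]_N :=
  \row_j (if (j < m)%N then h 0 j else 0).

Lemma truncS N (h : 'rV[R]_N) (l : 'I_N) :
  trunc h l.+1 = trunc h l + h 0 l *: delta_mx 0 l.
Proof.
apply/rowP => j; rewrite !mxE /= ltnS leq_eqVlt.
have [jl|jl] := eqVneq j l.
  by rewrite jl eqxx ltnn /= mulr1 add0r.
by rewrite (inj_eq val_inj) (negbTE jl) /= mulr0 addr0.
Qed.

(** Go from [x] to [y] one coordinate at a time. On each leg the mean value theorem yields a partial
    derivative at a point near [x], which continuity compares with the one at [x]. *)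
Lemma partial_differentiable_rV N (f : 'rV[R]_N -> R) (x : 'rV[R]_N) :
  (\forall y \near x, forall l, derivable f y (delta_mx 0 l)) ->
  (forall l, {for x, continuous (fun y => 'D_(delta_mx 0 l) f y)}) ->
  differentiable f x.
Proof.
move=> Hd Hc.
pose d (l : 'I_N) := 'D_(delta_mx 0 l) f x.
pose D (h : 'rV[R]_N) : R := \sum_l h 0 l * d l.
have Dlin : linear_for *%R D.
  move=> a u v; rewrite /D mulr_sumr -big_split /=; apply: eq_bigr => l _.
  by rewrite !mxE mulrDl mulrA.
pose DM := GRing.isLinear.Build _ _ _ _ D Dlin.
pose DL : {linear 'rV[R]_N -> R} := HB.pack D DM.
have Dc : continuous DL.
  apply: (@linear_continuous_le _ _ _ _ (\sum_l `|d l|)) => h.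
  rewrite (le_trans (ler_norm_sum _ _ _))// mulr_suml; apply: ler_sum => l _.
  by rewrite normrM mulrC ler_wpM2l// mx_norm_coord.
suff : differentiable f x /\ 'd f x = DL :> ('rV[R]_N -> R) by case.
apply: differentiable_near_le => // e e0.
(* Each of the [N] legs may cost [e'] times [|h|]; the successor also covers [N = 0]. *)
pose e' := e / N.+1%:R.
have e'0 : 0 < e' by rewrite divr_gt0.
have Hc' : \forall y \near x, forall l, `|'D_(delta_mx 0 l) f y - d l| <= e'.
  have H l : \forall y \near x, `|'D_(delta_mx 0 l) f y - d l| <= e'.
    by have /cvgr_dist_le /(_ e' e'0) := Hc l; apply: filterS => y; rewrite distrC.
  exact: filter_forall H.
have /nbhs_normP[r /= r0 Hr] : nbhs x [set y | (forall l, derivable f y (delta_mx 0 l)) /\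
   forall l, `|'D_(delta_mx 0 l) f y - d l| <= e'].
  exact: filterI.
apply/nbhs_normP; exists r => //= y /= yr.
pose h := y - x; rewrite -/h.
have hr : `|h| < r by rewrite /h -normrN opprB.
pose p m := x + trunc h m.
have pN : p N = y.
  have tN : trunc h N = h by apply/rowP => j; rewrite mxE ltn_ord.
  by rewrite /p tN /h addrC subrK.
have p0 : p 0%N = x.
  have t0 : trunc h 0 = 0 by apply/rowP => j; rewrite !mxE.
  by rewrite /p t0 addr0.
have yxh : y - x = h by [].
clearbody h.
have key (l : 'I_N) : `|f (p l.+1) - f (p l) - h 0 l * d l| <= e' * `|h|.
  have bnd (t : R) : `|t| <= `|h 0 l| -> ball_ Num.norm x r (p l + t *: delta_mx 0 l).
    move=> th; rewrite /ball_ /= /p -addrA opprD addrA subrr sub0r normrN.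
    apply: le_lt_trans hr; apply: mx_norm_le => // i j.
    rewrite !mxE ord1 eqxx /=; case: ifPn => jl.
      have -> : (j == l) = false by apply/negbTE; apply: contraTneq jl => ->; rewrite ltnn.
      by rewrite mulr0 addr0 mx_norm_coord.
    rewrite add0r; case: eqP => _; last by rewrite mulr0 normr0.
    by rewrite mulr1 (le_trans th)// mx_norm_coord.
  have [t /bnd tb] := mvt_line (x := p l) (v := delta_mx 0 l) (a := h 0 l)
    (f := f) (fun t th => (Hr _ (bnd t th)).1 l).
  rewrite {1}/p -addrA -truncS -/(p l.+1) => ->.
  rewrite -mulrBr normrM mulrC ler_pM// ?mx_norm_coord//.
  exact: (Hr _ tb).2.
have -> : f y - f x = \sum_(l < N) (f (p l.+1) - f (p l)).
  rewrite -(big_mkord xpredT (fun l => f (p l.+1) - f (p l))).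
  by rewrite telescope_sumr// pN p0.
rewrite /= /D -sumrB (le_trans (ler_norm_sum _ _ _))//.
apply: (@le_trans _ _ (\sum_(l < N) e' * `|h|)); first exact: ler_sum.
rewrite sumr_const card_ord -mulr_natr mulrAC ler_wpM2r//.
rewrite /e' -mulrA; apply: ler_piMr; first exact: ltW.
by rewrite ler_pdivrMl ?ltr0n// mulr1 ler_nat.
Qed.

Lemma partial_differentiable (V W : normedModType R) {fV : fdim V} {fW : fdim W}
   (f : V -> W) (x : V) :
  (\forall y \near x, forall l, derivable f y (fd_e l)) ->
  (forall l, {for x, continuous (fun y => 'D_(fd_e l) f y)}) ->
  differentiable f x.
Proof.
move=> Hd Hc.
have derco y v (m : 'I_(@fd_n _ W fW)) : derivable f y v -> is_derive y v (fun z => fd_co m (f z)) (fd_co m ('D_v f y)).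
  move=> df.
  have H : (fun h : R => h^-1 *: (((fun z => fd_co m (f z)) \o shift y) (h *: v) - fd_co m (f y))) @ 0^' --> fd_co m ('D_v f y).
    have -> : (fun h : R => h^-1 *: (((fun z => fd_co m (f z)) \o shift y) (h *: v) - fd_co m (f y))) =
      fd_co m \o (fun h : R => h^-1 *: ((f \o shift y) (h *: v) - f y)).
      apply/funext => h; by rewrite [RHS]linearZ [in RHS]linearB.
    by apply: cvg_comp; [exact: df|exact: fd_co_continuous].
  apply: DeriveDef; first by apply/cvg_ex; eexists; exact: H.
  exact/cvg_lim.
have gE : fd_g (fd_f x) = x by exact: fd_fK.
have line y (l : 'I_(@fd_n _ V fV)) (g : V -> R) : derivable g (fd_g y) (fd_e l) ->
  is_derive y (delta_mx 0 l) (g \o fd_g) ('D_(fd_e l) g (fd_g y)).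
  have E : (fun h : R => h^-1 *: (((g \o fd_g) \o shift y) (h *: delta_mx 0 l) - (g \o fd_g) y)) =
    (fun h : R => h^-1 *: ((g \o shift (fd_g y)) (h *: fd_e l) - g (fd_g y))).
    apply/funext => h /=.
    have -> : fd_g (h *: delta_mx 0 l + y) = h *: fd_e l + fd_g y by rewrite linearP.
    by [].
  by move=> dg; apply: DeriveDef; rewrite /derivable /derive ?E.
have Hm (m : 'I_(@fd_n _ W fW)) : differentiable (fun z => fd_co m (f z)) x.
  rewrite (_ : (fun z => fd_co m (f z)) = ((fun z => fd_co m (f z)) \o fd_g) \o fd_f); last first.
    by apply/funext => z /=; rewrite fd_fK.
  apply: differentiable_comp; first by apply: linear_differentiable; exact: fd_fc.
  have Hd' : \forall y \near fd_f x, forall l, derivable f (fd_g y) (fd_e l).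
    have c := @fd_gc _ _ fV (fd_f x); rewrite /continuous_at gE in c.
    exact: (c _ Hd).
  apply: partial_differentiable_rV.
    apply: filterS Hd' => y + l => /(_ l) /(derco _ _ m) H.
    by have [] := line y l _ (@ex_derive _ _ _ _ _ _ _ H).
  move=> l; apply: near_eq_continuous (_ : {for _, continuous (fun y => fd_co m ('D_(fd_e l) f (fd_g y)))}).
    apply: filterS Hd' => y /(_ l) /(derco _ _ m) H.
    by have [_ ->] := line y l _ (@ex_derive _ _ _ _ _ _ _ H); have [_ ->] := H.
  apply: (@continuous_comp _ _ _ fd_g (fun z => fd_co m ('D_(fd_e l) f z))); first exact: fd_gc.
  apply: (@continuous_comp _ _ _ (fun z => 'D_(fd_e l) f z)); last exact: fd_co_continuous.
  by rewrite gE; exact: Hc.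
rewrite (_ : f = \sum_(l < fd_n) (fun z => fd_co l (f z) *: fd_e l)).
  by apply: differentiable_sum => l; exact: differentiableZl.
apply/funext => z; rewrite [LHS]fd_decomp fct_sumE; by [].
Qed.

End Partials.

(** * Germs of smooth functions, symmetry of second derivatives, locally constant functions *)

Section Smooth.
Context {R : realType}.

(** Smoothness of a germ: one neighbourhood serves all orders at once, so that the property holds at
    nearby points too. *)
Definition sm (V W : normedModType R) (f : V -> W) (x : V) :=
  exists U, [/\ open U, U x & forall n, Cn n U f].

Section Basic.
Context {V W : normedModType R}.
Implicit Types f g : V -> W.

Lemma sm_near f x : sm f x -> \forall y \near x, sm f y.
Proof.
move=> [U [Uo Ux H]]; apply: filterS (open_nbhs_nbhs (conj Uo Ux)) => y Uy.
by exists U.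
Qed.

Lemma sm_ext f g x : (\forall y \near x, f y = g y) -> sm f x -> sm g x.
Proof.
rewrite /prop_near1 nbhsE => -[U' [U'o U'x] fg] [U [Uo Ux H]].
exists (U `&` U'); split; [exact: openI|by []|] => n.
apply: (@Cn_ext _ _ _ n (U `&` U') f g); first exact: openI.
  by move=> y [_ /fg].
by apply: Cn_sub (H n); exact: subIsetl.
Qed.

Lemma sm_cont f x : sm f x -> {for x, continuous f}.
Proof. by move=> [U [Uo Ux /(_ 0%N)]]; apply. Qed.

Lemma sm_diff f x : sm f x -> differentiable f x.
Proof. by move=> [U [Uo Ux /(_ 1%N) []]] H _; exact: H. Qed.

Lemma sm_derivable f x v : sm f x -> derivable f x v.
Proof. by move/sm_diff/diff_derivable. Qed.

Arguments sm_derivable [f x] v _.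

Lemma sm_derive f x v : sm f x -> sm (fun y => 'D_v f y) x.
Proof. by move=> [U [Uo Ux H]]; exists U; split=> // n; exact: (H n.+1).2. Qed.

(** The neighbourhoods witnessing the germs may differ from point to point, because [Cn] is a
    pointwise condition on [U]. *)
Lemma sm_open (U : set V) f : (forall x, U x -> sm f x) -> forall n, Cn n U f.
Proof.
move=> H n; elim: n f H => [|n IH] f H /=; first by move=> x /H /sm_cont.
split=> [x /H /sm_diff//|v]; apply: IH => x /H; exact: sm_derive.
Qed.

Lemma sm_cst (c : W) (x : V) : sm (fun=> c) x.
Proof. exists setT; split. exact: openT. by []. move=> n; exact: Cn_cst. Qed.

Lemma sm_lin (f : {linear V -> W}) x : continuous f -> sm f x.
Proof. by move=> fc; exists setT; split; [exact: openT|by []|move=> n; exact: Cn_lin]. Qed.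

Lemma sm_lift2 f g (h : V -> W) x :
  (forall n U, open U -> Cn n U f -> Cn n U g -> Cn n U h) ->
  sm f x -> sm g x -> sm h x.
Proof.
move=> H [U [Uo Ux Hf]] [U' [Uo' Ux' Hg]].
exists (U `&` U'); split; [exact: openI|by []|] => n; apply: H.
- exact: openI.
- by apply: Cn_sub (Hf n); exact: subIsetl.
- by apply: Cn_sub (Hg n); exact: subIsetr.
Qed.

Lemma smD f g x : sm f x -> sm g x -> sm (fun y => f y + g y) x.
Proof. by apply: sm_lift2 => n U Uo; exact: CnD. Qed.

Lemma sm_sum (I : Type) (r : seq I) (P : pred I) (F : I -> V -> W) x :
  (forall i, P i -> sm (F i) x) -> sm (fun y => \sum_(i <- r | P i) F i y) x.
Proof.
move=> H; elim: r => [|a r IH].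
  by under eq_fun do rewrite big_nil; exact: sm_cst.
under eq_fun do rewrite big_cons.
by case: (boolP (P a)) => // Pa; apply: smD => //; exact: H.
Qed.

End Basic.
Arguments sm_derivable {V W f x} v _.

Lemma sm_id (V : normedModType R) (x : V) : sm id x.
Proof. by apply: (@sm_lin _ _ idfun) => y; exact: cvg_id. Qed.

Lemma sm_comp_lin (V W X : normedModType R) (l : {linear W -> X}) (f : V -> W) x :
  continuous l -> sm f x -> sm (fun y => l (f y)) x.
Proof.
move=> lc [U [Uo Ux H]]; exists U; split=> // n; exact: (Cn_comp_lin Uo lc (H n)).
Qed.

Lemma sm_fst (V W : normedModType R) (x : V * W) : sm fst x.
Proof.
have lf : linear (@fst V W) by [].
pose lM := GRing.isLinear.Build _ _ _ _ (@fst V W) lf.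
pose L : {linear (V * W)%type -> V} := HB.pack (@fst V W) lM.
by apply: (@sm_lin _ _ L) => y; exact: cvg_fst.
Qed.

Lemma sm_snd (V W : normedModType R) (x : V * W) : sm snd x.
Proof.
have lf : linear (@snd V W) by [].
pose lM := GRing.isLinear.Build _ _ _ _ (@snd V W) lf.
pose L : {linear (V * W)%type -> W} := HB.pack (@snd V W) lM.
by apply: (@sm_lin _ _ L) => y; exact: cvg_snd.
Qed.

Lemma coord_linear n (l : 'I_n) : linear_for *%R (fun v : 'rV[R]_n => v 0 l).
Proof. by move=> a x y; rewrite !mxE. Qed.

Lemma sm_coord n (l : 'I_n) (x : 'rV[R]_n) : sm (fun v : 'rV[R]_n => v 0 l) x.
Proof.
pose lM := GRing.isLinear.Build _ _ _ _ _ (@coord_linear n l).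
pose L : {linear 'rV[R]_n -> R} := HB.pack (fun v : 'rV[R]_n => v 0 l) lM.
by apply: (@sm_lin _ _ L); exact: coord_continuous.
Qed.

Section Comp.
Context {V : normedModType R}.

Lemma smM (f g : V -> R) x : sm f x -> sm g x -> sm (fun y => f y * g y) x.
Proof. by apply: sm_lift2 => n U Uo; exact: CnM. Qed.

Lemma sm_scale (W : normedModType R) (a : R) (f : V -> W) x :
  sm f x -> sm (fun y => a *: f y) x.
Proof.
move=> fx; apply: (@sm_comp_lin _ _ _ ( *:%R a) f) => //.
exact: scaler_continuous.
Qed.

Lemma smN (W : normedModType R) (f : V -> W) x : sm f x -> sm (fun y => - f y) x.
Proof. by move=> /(sm_scale (-1)); under eq_fun do rewrite scaleN1r. Qed.

Lemma smB (W : normedModType R) (f g : V -> W) x :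
  sm f x -> sm g x -> sm (fun y => f y - g y) x.
Proof. by move=> fx gx; apply: smD => //; exact: smN. Qed.

Lemma smV (f : V -> R) x : sm f x -> f x != 0 -> sm (fun y => (f y)^-1) x.
Proof.
move=> fx f0; have [U [Uo Ux H]] := fx.
have : \forall y \near x, f y != 0.
  have := sm_cont fx; rewrite /prop_for /continuous_at => /cvgr_neq0; exact.
rewrite /prop_near1 nbhsE => -[U' [U'o U'x] f0'].
exists (U `&` U'); split; [exact: openI|by []|] => n.
apply: CnV; first exact: openI.
  by move=> y [_ /f0'].
by apply: Cn_sub (H n); exact: subIsetl.
Qed.

Lemma sm_pair (W X : normedModType R) (f : V -> W) (g : V -> X) x :
  sm f x -> sm g x -> sm (fun y => (f y, g y)) x.
Proof.
move=> [U [Uo Ux Hf]] [U' [Uo' Ux' Hg]].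
exists (U `&` U'); split; [exact: openI|by []|] => n; apply: Cn_pair.
- exact: openI.
- by apply: Cn_sub (Hf n); exact: subIsetl.
- by apply: Cn_sub (Hg n); exact: subIsetr.
Qed.

Lemma sm_comp (W X : normedModType R) {fW : fdim W} {fX : fdim X}
   (f : V -> W) (g : W -> X) x :
  sm f x -> sm g (f x) -> sm (fun y => g (f y)) x.
Proof.
move=> fx [U' [Uo' Ux' Hg]].
have nU' : \forall y \near x, U' (f y).
  by apply: (sm_cont fx); exact: open_nbhs_nbhs.
have [U [Uo Ux Hf]] := fx.
move: nU'; rewrite /prop_near1 nbhsE => -[U2 [U2o U2x] fU'].
exists (U `&` U2); split; [exact: openI|by []|] => n.
apply: (@Cn_comp _ V W X _ _ n (U `&` U2) U' f g) => //.
- exact: openI.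
- by move=> y [_ /fU'].
- by apply: Cn_sub (Hf n); exact: subIsetl.
Qed.

Lemma sm_row n (F : 'I_n -> V -> R) x :
  (forall l, sm (F l) x) -> sm (fun y => \row_l F l y : 'rV[R]_n) x.
Proof.
move=> H.
have -> : (fun y => \row_l F l y : 'rV[R]_n) = (fun y => \sum_l F l y *: delta_mx 0 l).
  apply/funext => y; rewrite [LHS]row_sum_delta; apply: eq_bigr => l _.
  by rewrite mxE.
apply: sm_sum => l _; have [U [Uo Ux Hf]] := H l.
by exists U; split=> // n'; exact: CnZl.
Qed.

Lemma sm_rowP n (F : V -> 'rV[R]_n) x :
  (forall l, sm (fun y => F y 0 l) x) -> sm F x.
Proof.
by move/sm_row; congr sm; apply/funext => y; apply/rowP => l; rewrite mxE.
Qed.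

Lemma sm_coordF n (F : V -> 'rV[R]_n) x l : sm F x -> sm (fun y => F y 0 l) x.
Proof.
move=> HF; apply: (@sm_comp _ _ _ _ F (fun v => v 0 l)) => //.
exact: sm_coord.
Qed.

End Comp.

Lemma derive_comp (V W X : normedModType R) (f : V -> W) (g : W -> X) x v :
  differentiable f x -> differentiable g (f x) ->
  'D_v (fun y => g (f y)) x = 'D_('D_v f x) g (f x).
Proof.
move=> fd gd; rewrite [LHS]deriveE; last exact: differentiable_comp.
by rewrite diff_comp//= -(deriveE v fd) -deriveE.
Qed.

Lemma deriveDv (V W : normedModType R) (f : V -> W) x u v :
  differentiable f x -> 'D_(u + v) f x = 'D_u f x + 'D_v f x.
Proof. by move=> fd; rewrite !deriveE// linearD. Qed.

Lemma deriveZv (V W : normedModType R) (f : V -> W) x a v :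
  differentiable f x -> 'D_(a *: v) f x = a *: 'D_v f x.
Proof. by move=> fd; rewrite !deriveE// linearZ. Qed.

Lemma derive_sumv (V W : normedModType R) (f : V -> W) x (I : Type) (r : seq I)
  (P : pred I) (F : I -> V) :
  differentiable f x -> 'D_(\sum_(i <- r | P i) F i) f x = \sum_(i <- r | P i) 'D_(F i) f x.
Proof.
move=> fd; rewrite !deriveE// linear_sum; apply: eq_bigr => i _.
by rewrite deriveE.
Qed.

Lemma derive_decomp (V W : normedModType R) {fV : fdim V} (f : V -> W) x v :
  differentiable f x -> 'D_v f x = \sum_l fd_c v l *: 'D_(fd_e l) f x.
Proof.
move=> fd; rewrite {1}(fd_decomp v) derive_sumv//; apply: eq_bigr => l _.
exact: deriveZv.
Qed.

Lemma derive_pair (V W X : normedModType R) (f : V -> W) (g : V -> X) x v :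
  differentiable f x -> differentiable g x ->
  'D_v (fun y => (f y, g y)) x = ('D_v f x, 'D_v g x).
Proof.
move=> df dg; rewrite [LHS]deriveE; last exact: differentiable_pair.
by rewrite diff_pair//= !deriveE.
Qed.

Lemma derive_rowE (V : normedModType R) n (F : V -> 'rV[R]_n) x v l :
  derivable F x v -> ('D_v F x) 0 l = 'D_v (fun y => F y 0 l) x.
Proof. by move=> dF; rewrite derive_mx// mxE. Qed.

(** [Cn] speaks of fixed directions only; the field [X] is therefore expanded in a basis with smooth
    coefficients. *)
Lemma sm_dirD (V W : normedModType R) {fV : fdim V} {fW : fdim W}
    (f : V -> W) (X : V -> V) x :
  sm f x -> sm X x -> sm (fun y => 'D_(X y) f y) x.
Proof.
move=> fx Xx.
apply: (@sm_ext _ _ (fun y => \sum_l fd_c (X y) l *: 'D_(fd_e l) f y)).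
  by apply: filterS (sm_near fx) => y fy; rewrite [RHS]derive_decomp//; exact: sm_diff.
apply: sm_sum => l _.
have [U [Uo Ux H]] := sm_derive (fd_e l) fx.
have [U' [Uo' Ux' H']] := sm_comp_lin (@fd_co_continuous _ _ _ l) Xx.
exists (U `&` U'); split; [exact: openI|by []|] => n; apply: CnZ.
- exact: openI.
- by apply: Cn_sub (H' n); exact: subIsetr.
- by apply: Cn_sub (H n); exact: subIsetl.
Qed.

Lemma sm_iderive (V W : normedModType R) (f : V -> W) s x :
  sm f x -> sm (iderive s f) x.
Proof. by move=> fx; elim: s => //= v s IH; exact: sm_derive. Qed.

(** [smooth_on] asks for existence and continuity of all iterated directional derivatives. Applied
    to each iterate, continuity of its partial derivatives gives differentiability, and an induction
    over [n] gives [Cn]. *)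
Lemma smooth_onP (V W : normedModType R) {fV : fdim V} {fW : fdim W}
    (A : set V) (f : V -> W) : smooth_on A f <-> forall x, A x -> sm f x.
Proof.
split=> [[U [Uo AU H]] x /AU Ux|H].
  exists U; split=> // n; have : forall s, Cn n U (iderive s f).
    elim: n => [|n IH] s /=; first by move=> y Uy; have [_] := H s 0 y Uy.
    split=> [y Uy|v]; last exact: IH (v :: s).
    apply: partial_differentiable.
      have := open_nbhs_nbhs (conj Uo Uy); apply: filterS => z Uz l.
      by have [] := H s (fd_e l) z Uz.
    by move=> l; have [_] := H (fd_e l :: s) 0 y Uy.
  by move=> /(_ [::]).
exists [set x | sm f x]; split=> //.
  by rewrite openE => x /= /sm_near.
by move=> s v x /(sm_iderive s) fx; split; [exact: sm_derivable|exact: sm_cont].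
Qed.

(** Two applications of the mean value theorem: first in direction [v] to the increment of [f] over
    [b *: w], then in direction [w] to ['D_v f]. *)
Lemma schwarz_ball (V : normedModType R) (f : V -> R) (x v w : V) (r a b : R) :
  (forall y, ball_ Num.norm x r y -> sm f y) ->
  `|a| * `|v| + `|b| * `|w| < r ->
  exists2 y, `|y - x| <= `|a| * `|v| + `|b| * `|w| &
   f (x + a *: v + b *: w) - f (x + a *: v) - (f (x + b *: w) - f x)
     = a * b * 'D_w (fun z => 'D_v f z) y.
Proof.
move=> H abr.
have inb (s t : R) : `|s| <= `|a| -> `|t| <= `|b| ->
    `|x + s *: v + t *: w - x| <= `|a| * `|v| + `|b| * `|w|.
  move=> sa tb; rewrite -(addrA x) [_ - x]addrC addKr.
  by rewrite (le_trans (ler_normD _ _))// lerD// normrZ ler_wpM2r.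
have inb' (s t : R) : `|s| <= `|a| -> `|t| <= `|b| -> sm f (x + s *: v + t *: w).
  move=> sa tb; apply: H; rewrite /ball_ /= -normrN opprB.
  by rewrite (le_lt_trans (inb _ _ sa tb)).
pose g y := f (y + b *: w) - f y.
have sg (s : R) : `|s| <= `|a| -> is_derive (x + s *: v) v g
    ('D_v f (x + s *: v + b *: w) - 'D_v f (x + s *: v)).
  move=> sa.
  have s1 := inb' s b sa (lexx _).
  have := inb' s 0 sa; rewrite normr0 normr_ge0 => /(_ isT); rewrite scale0r addr0 => s2.
  apply: is_deriveB; last by apply: DeriveDef => //; exact: sm_derivable.
  have E : (fun h : R => h^-1 *: (((fun y => f (y + b *: w)) \o shift (x + s *: v)) (h *: v) -
      f (x + s *: v + b *: w))) =
    (fun h : R => h^-1 *: ((f \o shift (x + s *: v + b *: w)) (h *: v) - f (x + s *: v + b *: w))).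
    by apply/funext => h /=; congr (_ *: (f _ - _)); rewrite !addrA.
  have s1d := sm_derivable v s1; rewrite /derivable -E in s1d.
  by split=> //; rewrite /derive E.
have [s sa] := mvt_line (f := g) (x := x) (v := v) (a := a)
   (fun t ta => @ex_derive _ _ _ _ _ _ _ (sg t ta)).
have [_ ->] := sg s sa; rewrite /g => ->.
have [t tb ->] := mvt_line (f := 'D_v f) (x := x + s *: v) (v := w) (a := b)
   (fun t tb => sm_derivable w (sm_derive v (inb' s t sa tb))).
by exists (x + s *: v + t *: w); [exact: inb|rewrite mulrA].
Qed.

Lemma second_differenceC (a b c d : R) : a - b - (c - d) = a - c - (b - d).
Proof. by ring. Qed.

Lemma dist_le_half (a b c e : R) :
  `|a - c| <= e / 2 -> `|b - c| <= e / 2 -> `|a - b| <= e.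
Proof.
move=> ac; rewrite distrC => bc; rewrite -(subrKA c) (splitr e).
by rewrite (le_trans (ler_normD _ _))// lerD.
Qed.

(** The second difference is symmetric in [v] and [w], so [schwarz_ball] in both orders equates the
    two mixed derivatives at two points near [x]; continuity at [x] finishes. *)
Lemma schwarz (V : normedModType R) (f : V -> R) (x v w : V) : sm f x ->
  'D_w (fun z => 'D_v f z) x = 'D_v (fun z => 'D_w f z) x.
Proof.
move=> fx; apply/eqP; rewrite -subr_eq0 -normr_le0; apply/ler_addgt0Pr => e e0.
rewrite add0r.
have c1 := sm_cont (sm_derive w (sm_derive v fx)).
have c2 := sm_cont (sm_derive v (sm_derive w fx)).
have e20 : 0 < e / 2 by rewrite divr_gt0.
have /cvgrPdist_le /(_ _ e20) n1 := c1.
have /cvgrPdist_le /(_ _ e20) n2 := c2.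
have /nbhs_normP[r /= r0 Hr] : nbhs x [set y | sm f y /\
    (`|'D_w ('D_v f) x - 'D_w ('D_v f) y| <= e / 2 /\
     `|'D_v ('D_w f) x - 'D_v ('D_w f) y| <= e / 2)].
  exact: filterI (sm_near fx) (filterI n1 n2).
(* Chosen so that the parallelogram with sides [h *: v] and [h *: w] stays in the ball of radius
   [r]; the summand 1 covers [v = w = 0]. *)
pose h := r / (`|v| + `|w| + 1) / 2.
have vw0 : 0 < `|v| + `|w| + 1 by rewrite ltr_wpDl// addr_ge0.
have h0 : 0 < h by rewrite !divr_gt0.
have hr : `|h| * `|v| + `|h| * `|w| < r.
  rewrite gtr0_norm// -mulrDr /h.
  have : r / (`|v| + `|w| + 1) * (`|v| + `|w|) <= r.
    rewrite mulrAC ler_pdivrMr//; apply: ler_wpM2l; first exact: ltW.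
    by rewrite lerDl.
  move=> H; rewrite mulrAC ltr_pdivrMr// (le_lt_trans H)//.
  by rewrite mulr_natr mulr2n ltrDl.
have Hs y : ball_ Num.norm x r y -> sm f y by move=> /Hr [].
have [y1 y1r E1] := @schwarz_ball V f x v w r h h Hs hr.
have hr' : `|h| * `|w| + `|h| * `|v| < r by rewrite addrC.
have [y2 y2r E2] := @schwarz_ball V f x w v r h h Hs hr'.
have E : 'D_w (fun z => 'D_v f z) y1 = 'D_v (fun z => 'D_w f z) y2.
  apply: (@mulfI _ (h * h)); first by rewrite mulf_neq0// gt_eqF.
  apply: (etrans (esym E1)); apply: etrans E2; rewrite (addrAC x (h *: v)).
  exact: second_differenceC.
have b1 : ball_ Num.norm x r y1 by rewrite /ball_ /= -normrN opprB (le_lt_trans y1r).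
have b2 : ball_ Num.norm x r y2.
  by rewrite /ball_ /= -normrN opprB (le_lt_trans y2r).
have [_ [k1 _]] := Hr _ b1; have [_ [_ k2]] := Hr _ b2.
by rewrite -E in k2; exact: dist_le_half k1 k2.
Qed.

(** On a ball inside [W] the mean value theorem along radii makes [f] constant, so the level set of
    [f x] is open and closed in [W]. *)
Lemma zero_derive_connected (V : normedModType R) (f : V -> R) (W : set V) :
  open W -> connected W -> (forall x v, W x -> is_derive x v f 0) ->
  forall x y, W x -> W y -> f x = f y.
Proof.
move=> Wo Wc H x y Wx Wy.
have loc z : W z -> \forall t \near z, W t /\ f t = f z.
  move=> Wz; have /nbhs_normP[r /= r0 Hr] := open_nbhs_nbhs (conj Wo Wz).
  apply/nbhs_normP; exists r => //= t zt; split; first exact: Hr.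
  have inW (s : R) : `|s| <= `|1 : R| -> W (z + s *: (t - z)).
    rewrite normr1 => s1; apply: Hr; rewrite /ball_ /= opprD addrA subrr sub0r.
    by rewrite normrN normrZ (le_lt_trans _ zt)// distrC ler_piMl.
  have Hd (s : R) : `|s| <= `|1 : R| -> derivable f (z + s *: (t - z)) (t - z).
    by move=> /inW /(H _ (t - z)) [].
  have [s /inW sW] := mvt_line Hd.
  have [_ ->] := H (z + s *: (t - z)) (t - z) sW.
  have -> : z + 1 *: (t - z) = t by rewrite scale1r addrC subrK.
  by rewrite mulr0 => /eqP; rewrite subr_eq0 => /eqP.
pose B := W `&` [set z | f z = f x].
suff BW : B = W by move: Wy; rewrite -BW => -[].
apply: Wc; first by exists x.
- exists B; last by rewrite /B setIA setIid.
  rewrite openE => z [Wz fz]; apply: filterS (loc z Wz) => t [Wt ft].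
  by split=> //=; rewrite ft.
- exists (~` (W `&` [set z | f z <> f x])).
    rewrite closedC openE => z [Wz fz]; apply: filterS (loc z Wz) => t [Wt ft].
    by split=> //=; rewrite ft.
  apply/seteqP; split=> z [Wz fz]; split=> //.
    by move=> [_]; apply.
  by apply: contrapT => fz'; apply: fz.
Qed.

End Smooth.
Arguments sm_derivable {R V W f x} v _.

(** * Gronwall's inequality, Lipschitz and Taylor bounds, derivatives of limits *)

Section Estimates.
Context {R : realType}.

Lemma is_derive_mulfun (V : normedModType R) (f g : V -> R) (x v : V) (df dg : R) :
  is_derive x v f df -> is_derive x v g dg ->
  is_derive x v (fun u => f u * g u) (f x * dg + g x * df).
Proof. by move=> d1 d2; have := @is_deriveM R V f g x v df dg d1 d2. Qed.

(** For t >= 0 the product of [f] with exp(-C t) does not exceed its value at 0, by the mean value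
    theorem; for t < 0 the factor exp(C t) plays the same part. *)
Lemma gronwall_scalar (f df : R -> R) (C T : R) :
  (forall t : R, `|t| < T -> is_derive t 1 f (df t) /\ `|df t| <= C * f t) ->
  forall t, `|t| < T -> f t <= f 0 * expR (C * `|t|).
Proof.
move=> H t tT.
have dE (c s : R) : is_derive s 1 (fun u => expR (c * u)) (c * expR (c * s)).
  have -> : (fun u => expR (c * u)) = expR \o ( *%R c) by [].
  have d1 : is_derive s 1 ( *%R c) c.
    have := @is_deriveZ _ _ _ id c s 1 1 (is_derive_id _ _).
    by rewrite [c *: 1]mulr1.
  by rewrite mulrC; exact: is_derive1_comp.
have dh (c s : R) : `|s| < T -> is_derive s 1 (fun u => f u * expR (c * u))
    ((df s + c * f s) * expR (c * s)).
  move=> /H [d1 _].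
  have -> : (df s + c * f s) * expR (c * s) = f s * (c * expR (c * s)) + expR (c * s) * df s by ring.
  exact: is_derive_mulfun.
have mv (c : R) : exists2 s, `|s| < T & f t * expR (c * t) - f 0 =
    t * ((df s + c * f s) * expR (c * s)).
  have Hd (s : R) : `|s| <= `|t| -> derivable (fun u => f u * expR (c * u)) (0 + s *: 1) 1.
    move=> st; rewrite add0r [s *: 1]mulr1.
    by have [] := dh c s (le_lt_trans st tT).
  have [s st] := mvt_line Hd; rewrite !add0r ![_ *: 1]mulr1 => E; exists s.
    exact: le_lt_trans tT.
  have [_ <-] := dh c s (le_lt_trans st tT).
  by rewrite -E mulr0 expR0 mulr1.
have inv (c : R) : expR (c * t) * expR (- c * t) = 1.
  by rewrite -expRD mulNr subrr expR0.
have [t0|t0] := leP 0 t.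
  rewrite ger0_norm//; have [s sT E] := mv (- C).
  have : f t * expR (- C * t) - f 0 <= 0.
    rewrite E mulr_ge0_le0// mulr_le0_ge0 ?expR_ge0//.
    have [_] := H s sT; rewrite ler_norml => /andP[_].
    by rewrite mulNr subr_le0.
  rewrite subr_le0 -(ler_pM2r (expR_gt0 (C * t))) -mulrA [X in f t * X]mulrC inv mulr1; exact.
rewrite ltr0_norm// mulrN -mulNr; have [s sT E] := mv C.
have : f t * expR (C * t) - f 0 <= 0.
  rewrite E mulr_le0_ge0 ?(ltW t0)// mulr_ge0 ?expR_ge0//.
  have [_] := H s sT; rewrite ler_norml => /andP[+ _].
  by rewrite lerNl -subr_ge0 opprK addrC.
rewrite subr_le0 -(ler_pM2r (expR_gt0 (- C * t))) -mulrA inv mulr1; exact.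
Qed.

Lemma is_derive_coord N (z : R -> 'rV[R]_N) (t : R) (dz : 'rV[R]_N) l :
  is_derive t 1 z dz -> is_derive t 1 (fun s => z s 0 l) (dz 0 l).
Proof.
move=> [d1 d2]; have := (derivable_mxP z t 1).1 d1 0 l => d3.
by split=> //; rewrite -d2 derive_mx// mxE.
Qed.

Lemma is_derive_coordP N (z : R -> 'rV[R]_N) (t : R) (dz : 'rV[R]_N) :
  (forall l, is_derive t 1 (fun s => z s 0 l) (dz 0 l)) -> is_derive t 1 z dz.
Proof.
move=> H; have d1 : derivable z t 1.
  by apply/derivable_mxP => i l; rewrite ord1; have [] := H l.
by split=> //; rewrite derive_mx//; apply/rowP => l; rewrite mxE; have [_ ->] := H l.
Qed.

(** The maximum norm is not differentiable, so the scalar inequality is applied to a sum of squares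
    of coordinates. This accounts for the squares and for the factor [N] in the bound. *)
Lemma gronwall N (z dz : R -> 'rV[R]_N) (T K e : R) : 0 <= K -> 0 <= e ->
  (forall t : R, `|t| < T -> is_derive t 1 z (dz t) /\ `|dz t| <= K * `|z t| + e) ->
  forall t : R, `|t| < T ->
    `|z t| ^+ 2 <= (N%:R * `|z 0| ^+ 2 + e ^+ 2) * expR (N%:R * (2 * K + 1) * T).
Proof.
move=> K0 e0 H t tT.
(* Adding [e ^+ 2] absorbs the inhomogeneous term: each coordinate contributes at most 2 |z| (K |z|
   + e) <= (2 K + 1)(|z|^2 + e^2) to the derivative. *)
pose f s := \sum_l (z s 0 l) ^+ 2 + e ^+ 2.
pose df s := \sum_l 2 * (z s 0 l * dz s 0 l).
have zf s l : (z s 0 l) ^+ 2 <= f s.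
  rewrite /f (bigD1 l)//= -addrA lerDl addr_ge0 ?sqr_ge0// sumr_ge0// => m _.
  exact: sqr_ge0.
have f0 s : 0 <= f s by rewrite /f addr_ge0 ?sqr_ge0// sumr_ge0// => m _; exact: sqr_ge0.
have nzf s : (0 < N)%N -> `|z s| ^+ 2 + e ^+ 2 <= f s.
  move=> N0; rewrite lerD2r.
  have [z0|z0] := eqVneq (z s) 0.
    rewrite z0 normr0 expr0n /= sumr_ge0// => m _; exact: sqr_ge0.
  have [|[i l] /= E] := @mx_norm_neq0 _ _ _ (z s).
    by rewrite -[mx_norm _]/(`|z s|) normr_eq0.
  rewrite -[`|z s|]/(mx_norm (z s)) E ord1 real_normK ?num_real//.
  rewrite (bigD1 l)//= lerDl sumr_ge0// => m _; exact: sqr_ge0.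
have Hf (s : R) : `|s| < T -> is_derive s 1 f (df s) /\ `|df s| <= (N%:R * (2 * K + 1)) * f s.
  move=> /H [d1 d2]; split.
    have dl l : is_derive s 1 (fun u => (z u 0 l) ^+ 2) (2 * (z s 0 l * dz s 0 l)).
      have dzl := is_derive_coord l d1.
      have -> : 2 * (z s 0 l * dz s 0 l) = z s 0 l * dz s 0 l + z s 0 l * dz s 0 l by ring.
      by under eq_fun do rewrite expr2; exact: is_derive_mulfun.
    have ds := @is_derive_sum _ _ _ _ (fun l u => (z u 0 l) ^+ 2) s 1 _ dl.
    have := @is_deriveD _ _ _ _ (cst (e ^+ 2)) s 1 _ _ ds (is_derive_cst _ _ _).
    rewrite addr0; congr is_derive; apply/funext => u.
    by rewrite /f fctE fct_sumE.
  have [N0|N0] := posnP N.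
    have -> : df s = 0 by rewrite /df big1// => -[l lN]; exfalso; rewrite N0 in lN.
    by rewrite normr0 mulr_ge0// N0 mul0r.
  rewrite (le_trans (ler_norm_sum _ _ _))//.
  apply: (@le_trans _ _ (\sum_(l < N) (2 * K + 1) * f s)); last first.
    by rewrite sumr_const card_ord -[leLHS]mulr_natl mulrA.
  apply: ler_sum => l _; rewrite !normrM ger0_norm//.
  apply: le_trans (_ : (2 * K + 1) * (`|z s| ^+ 2 + e ^+ 2) <= _); last first.
    by rewrite ler_wpM2l ?nzf// addr_ge0// mulr_ge0.
  have h1 : `|z s 0 l| * `|dz s 0 l| <= `|z s| * (K * `|z s| + e).
    rewrite ler_pM// ?mx_norm_coord// (le_trans _ d2)//; exact: mx_norm_coord.
  have h2 : 2 * (`|z s| * e) <= `|z s| ^+ 2 + e ^+ 2.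
    by rewrite -subr_ge0; apply: le_trans (sqr_ge0 (`|z s| - e)) _; rewrite le_eqVlt; apply/orP; left; apply/eqP; ring.
  have h3 : 0 <= 2 * K * e ^+ 2 by rewrite !mulr_ge0// sqr_ge0.
  move: h1 h2 h3; set a := `|z s|; set b := `|z s 0 l| * _; rewrite !expr2; nra.
have := gronwall_scalar Hf tT.
move=> h; have [N0|N0] := posnP N.
  have -> : z t = 0 by apply/rowP => -[l lN]; exfalso; rewrite N0 in lN.
  rewrite normr0 expr0n /=; apply: mulr_ge0; last exact: expR_ge0.
  by rewrite addr_ge0 ?sqr_ge0// mulr_ge0 ?sqr_ge0.
apply: le_trans (le_trans _ (nzf t N0)) _; first by rewrite lerDl sqr_ge0.
apply: (le_trans h); apply: ler_pM; [exact: f0|exact: expR_ge0| |].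
  rewrite /f lerD2r mulr_natl -[X in _ *+ X](card_ord N) -sumr_const; apply: ler_sum => l _.
  by rewrite -[leLHS]real_normK ?num_real// ler_pXn2r ?nnegrE// mx_norm_coord.
rewrite ler_expR; apply: ler_wpM2l; last exact: ltW.
by rewrite mulr_ge0// addr_ge0// mulr_ge0.
Qed.

Lemma mvt01 (V : normedModType R) (f : V -> R) (x v : V) :
  (forall t : R, 0 <= t <= 1 -> derivable f (x + t *: v) v) ->
  exists2 t : R, 0 <= t <= 1 & f (x + v) - f x = 'D_v f (x + t *: v).
Proof.
move=> H.
have Hd (t : R) : 0 <= t <= 1 ->
    is_derive t 1 (fun s : R => f (x + s *: v)) ('D_v f (x + t *: v)).
  by move=> /H; exact: is_derive_line.
have [||t] := @MVT R (fun s : R => f (x + s *: v)) (fun t => 'D_v f (x + t *: v)) 0 1 ltr01.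
- move=> t; rewrite in_itv /= => /andP[t0 t1].
  by apply: Hd; rewrite !ltW.
- apply: derivable_within_continuous => t; rewrite in_itv /= => t01.
  by have [] := Hd t t01.
rewrite in_itv /= => /andP[t0 t1].
rewrite scale1r scale0r addr0 subr0 mulr1 => E.
by exists t => //; rewrite !ltW.
Qed.

Definition cvx (V : normedModType R) (K : set V) :=
  forall y y' (t : R), K y -> K y' -> 0 <= t <= 1 -> K (y + t *: (y' - y)).

Lemma compact_cont_bounded (V : normedModType R) (K : set V) (f : V -> R) :
  compact K -> (forall y, K y -> {for y, continuous f}) ->
  exists2 M, 0 <= M & forall y, K y -> `|f y| <= M.
Proof.
move=> Kc fc.
have cK : compact (f @` K).
  apply: continuous_compact => //; apply: continuous_in_subspaceT => y /set_mem Ky.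
  exact: fc.
have [M [Mr HM]] := compact_bounded cK.
exists (`|M| + 1); first by rewrite addr_ge0.
move=> y Ky; apply: HM; last by exists y.
by rewrite (le_lt_trans (ler_norm M))// ltrDl.
Qed.

Lemma fin_choice (I T : Type) (P : I -> T -> Prop) :
  (forall i, exists x, P i x) -> exists f, forall i, P i (f i).
Proof. by move=> H; exists (fun i => projT1 (cid (H i))) => i; exact: projT2 (cid (H i)). Qed.

Lemma derive_row_decomp N (W : normedModType R) (f : 'rV[R]_N -> W) x v :
  differentiable f x -> 'D_v f x = \sum_m v 0 m *: 'D_(delta_mx 0 m) f x.
Proof. by move=> fx; rewrite (@derive_decomp R _ _ (fdim_rV R N) f x v fx). Qed.

Lemma C1_lip N (K : set 'rV[R]_N) (f : 'rV[R]_N -> R) :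
  compact K -> cvx K -> (forall y, K y -> sm f y) ->
  exists2 L, 0 <= L & forall y y', K y -> K y' -> `|f y' - f y| <= L * `|y' - y|.
Proof.
move=> Kc Kv fs.
have [M HM] : exists M : 'I_N -> R, forall m, 0 <= M m /\
    forall y, K y -> `|'D_(delta_mx 0 m) f y| <= M m.
  apply: (@fin_choice _ _ (fun m M => 0 <= M /\ forall y, K y -> `|'D_(delta_mx 0 m) f y| <= M)) => m.
  have [M M0 H] := compact_cont_bounded Kc (fun y Ky => sm_cont (sm_derive (delta_mx 0 m) (fs y Ky))).
  by exists M.
exists (\sum_m M m); first by apply: sumr_ge0 => m _; have [] := HM m.
move=> y y' Ky Ky'.
have [t t01] := mvt01 (f := f) (x := y) (v := y' - y)
   (fun t t01 => sm_derivable _ (fs _ (Kv _ _ _ Ky Ky' t01))).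
rewrite (addrC y) subrK => ->.
have Kt := Kv _ _ _ Ky Ky' t01.
rewrite derive_row_decomp; last exact: sm_diff (fs _ Kt).
rewrite (le_trans (ler_norm_sum _ _ _))// mulr_suml; apply: ler_sum => m _.
rewrite normrZ mulrC ler_pM//; first by have [_ ->] := HM m.
exact: mx_norm_coord.
Qed.

Lemma C2_taylor N (K : set 'rV[R]_N) (f : 'rV[R]_N -> R) :
  compact K -> cvx K -> (forall y, K y -> sm f y) ->
  exists2 L, 0 <= L & forall y y', K y -> K y' ->
    `|f y' - f y - 'D_(y' - y) f y| <= L * `|y' - y| ^+ 2.
Proof.
move=> Kc Kv fs.
have [M HM] : exists M : 'I_N -> R, forall m, 0 <= M m /\
    forall y y', K y -> K y' -> `|'D_(delta_mx 0 m) f y' - 'D_(delta_mx 0 m) f y| <= M m * `|y' - y|.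
  apply: (@fin_choice _ _ (fun m M => 0 <= M /\ forall y y', K y -> K y' ->
     `|'D_(delta_mx 0 m) f y' - 'D_(delta_mx 0 m) f y| <= M * `|y' - y|)) => m.
  have [M M0 H] := C1_lip Kc Kv (fun y Ky => (sm_derive (delta_mx 0 m) (fs y Ky))).
  by exists M.
exists (\sum_m M m); first by apply: sumr_ge0 => m _; have [] := HM m.
move=> y y' Ky Ky'.
have [t t01] := mvt01 (f := f) (x := y) (v := y' - y)
   (fun t t01 => sm_derivable _ (fs _ (Kv _ _ _ Ky Ky' t01))).
rewrite (addrC y) subrK => ->.
have Kt := Kv _ _ _ Ky Ky' t01.
rewrite derive_row_decomp; last exact: sm_diff (fs _ Kt).
rewrite [X in _ - X]derive_row_decomp; last exact: sm_diff (fs _ Ky).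
rewrite -sumrB (le_trans (ler_norm_sum _ _ _))// mulr_suml; apply: ler_sum => m _.
have [M0 /(_ y _ Ky Kt)] := HM m.
have -> : y + t *: (y' - y) - y = t *: (y' - y) by rewrite (addrC y) addrK.
move=> HMt.
rewrite -scalerBr normrZ mulrC expr2 mulrA ler_pM//; last exact: mx_norm_coord.
apply: (le_trans HMt); rewrite ler_wpM2l// normrZ ler_piMl//.
by case/andP: t01 => t0 t1; rewrite ger0_norm.
Qed.

(** The mean value theorem is applied to an approximant [F] rather than to [f], whose
    differentiability is the claim. The approximation error is arbitrarily small for fixed [h] and
    disappears before [h] tends to 0. *)
Lemma lim_derive_scalar (f g : R -> R) (t0 T : R) : `|t0| < T ->
  {for t0, continuous g} ->
  (forall e, 0 < e -> exists F G : R -> R, forall t : R, `|t| < T ->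
     [/\ is_derive t 1 F (G t), `|F t - f t| <= e & `|G t - g t| <= e]) ->
  is_derive t0 1 f (g t0).
Proof.
move=> t0T gc H.
suff L : (fun h : R => h^-1 *: ((f \o shift t0) (h *: 1) - f t0)) @ 0^' --> g t0.
  split; last exact/cvg_lim.
  by apply/cvg_ex; exists (g t0).
apply/cvgrPdist_le => e e0.
have /cvgrPdist_le /(_ e e0) n1 := gc.
have n2 : \forall t \near t0, `|t| < T.
  have : {for t0, continuous (fun t : R => `|t|)} by exact: norm_continuous.
  by move=> /cvgr_lt; apply.
have /nbhs_normP[r /= r0 Hr] : nbhs t0 [set t : R | `|t| < T /\ `|g t0 - g t| <= e].
  exact: filterI.
near=> h.
have h0 : h != 0 by near: h; exact: nbhs_dnbhs_neq.
have hr : `|h| < r by near: h; exact: dnbhs0_lt.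
have inb (s : R) : `|s| <= `|h| -> ball_ Num.norm t0 r (t0 + s *: 1).
  move=> sh; rewrite /ball_ /= opprD addrA subrr sub0r normrN [s *: 1]mulr1.
  exact: le_lt_trans hr.
rewrite /= [h *: 1]mulr1 -(ler_pM2l (_ : 0 < `|h|)) ?normr_gt0//.
rewrite -normrM mulrBr /GRing.scale /= mulVKf//.
apply/ler_addgt0Pr => d d0.
(* The approximation is used at the two ends of the step and, weighted by |h|, for the derivative:
   (2 + |h|) e' = d in all. *)
pose e' := d / (2 + `|h|).
have h20 : 0 < 2 + `|h| by rewrite ltr_pwDl.
have e'0 : 0 < e' by rewrite divr_gt0.
have [F [G HFG]] := H e' e'0.
have Hd (s : R) : `|s| <= `|h| -> derivable F (t0 + s *: 1) 1.
  by move=> /inb /Hr [/HFG [[]]].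
have [s sh E] := mvt_line Hd.
have [sT gs] := Hr _ (inb _ sh).
have [[_ E2] _ Gs] := HFG _ sT; rewrite E2 in E.
have [_ Ft0 _] := HFG _ t0T.
have [hT _] := Hr _ (inb _ (lexx _)).
have th : t0 + h *: 1 = h + t0 by rewrite [h *: 1]mulr1 addrC.
rewrite th in hT E; have [_ Fth _] := HFG _ hT.
have -> : h * g t0 - (f (h + t0) - f t0) = h * (g t0 - g (t0 + s *: 1)) -
   h * (G (t0 + s *: 1) - g (t0 + s *: 1)) + (F (h + t0) - f (h + t0)) - (F t0 - f t0).
  have -> : F (h + t0) = F t0 + h * G (t0 + s *: 1) by rewrite -E (addrC (F t0)) subrK.
  by ring.
rewrite (le_trans (ler_normB _ _))//.
have -> : `|h| * e + d = `|h| * e + `|h| * e' + e' + e'.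
  by rewrite -!addrA; congr (_ + _); rewrite /e'; field; rewrite gt_eqF.
rewrite lerD// (le_trans (ler_normD _ _))// lerD// (le_trans (ler_normB _ _))//.
by rewrite !normrM lerD// ler_wpM2l.
Unshelve. all: by end_near. Qed.

Lemma lim_derive N (f g : R -> 'rV[R]_N) (t0 T : R) : `|t0| < T ->
  {for t0, continuous g} ->
  (forall e, 0 < e -> exists F G : R -> 'rV[R]_N, forall t : R, `|t| < T ->
     [/\ is_derive t 1 F (G t), `|F t - f t| <= e & `|G t - g t| <= e]) ->
  is_derive t0 1 f (g t0).
Proof.
move=> t0T gc H; apply: is_derive_coordP => l.
apply: (@lim_derive_scalar _ (fun t => g t 0 l) _ T) => //.
  apply: (@continuous_comp _ _ _ g (fun M : 'rV[R]_N => M 0 l)) => //.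
  exact: coord_continuous.
move=> e /H [F [G HFG]]; exists (fun t => F t 0 l), (fun t => G t 0 l) => t /HFG [h1 h2 h3].
split; first exact: is_derive_coord.
  by rewrite (le_trans _ h2)// (le_trans _ (mx_norm_coord _ 0 l))// !mxE.
by rewrite (le_trans _ h3)// (le_trans _ (mx_norm_coord _ 0 l))// !mxE.
Qed.

End Estimates.

(** * Dependence of solutions on parameters: difference quotients *)

Section Regularity.
Context {R : realType}.

(** Replaces a square root in the outcome of [gronwall], using A <= (A + 1)^2. *)
Lemma sqr_le_bound (A z d : R) : 0 <= A -> 0 <= d -> 0 <= z ->
  z ^+ 2 <= A * d ^+ 2 -> z <= (A + 1) * d.
Proof.
move=> A0 d0 z0 H; rewrite -(@ler_pXn2r _ 2)// ?nnegrE//; last by rewrite mulr_ge0// addr_ge0.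
apply: (le_trans H); rewrite exprMn ler_wpM2r ?sqr_ge0//.
by rewrite expr2; nra.
Qed.

Lemma deriveBv (V W : normedModType R) (f : V -> W) x u v :
  differentiable f x -> 'D_(u - v) f x = 'D_u f x - 'D_v f x.
Proof. by move=> fd; rewrite !deriveE// linearB. Qed.

Lemma C1_lipv N M (K : set 'rV[R]_N) (X : 'rV[R]_N -> 'rV[R]_M) :
  compact K -> cvx K -> (forall y, K y -> sm X y) ->
  exists2 L, 0 <= L & forall y y', K y -> K y' -> `|X y' - X y| <= L * `|y' - y|.
Proof.
move=> Kc Kv Xs.
have [L HL] : exists L : 'I_M -> R, forall l, 0 <= L l /\
   forall y y', K y -> K y' -> `|X y' 0 l - X y 0 l| <= L l * `|y' - y|.
  apply: (@fin_choice _ _ (fun l L => 0 <= L /\ forall y y', K y -> K y' ->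
     `|X y' 0 l - X y 0 l| <= L * `|y' - y|)) => l.
  by have [L L0 H] := C1_lip Kc Kv (fun y Ky => sm_coordF l (Xs y Ky)); exists L.
exists (\sum_l L l); first by apply: sumr_ge0 => l _; have [] := HL l.
move=> y y' Ky Ky'; apply: mx_norm_le.
  by rewrite mulr_ge0// sumr_ge0// => l _; have [] := HL l.
move=> i l; rewrite ord1 !mxE (le_trans ((HL l).2 _ _ Ky Ky'))// ler_wpM2r//.
by rewrite (bigD1 l)//= lerDl sumr_ge0// => m _; have [] := HL m.
Qed.

Lemma C2_taylorv N M (K : set 'rV[R]_N) (X : 'rV[R]_N -> 'rV[R]_M) :
  compact K -> cvx K -> (forall y, K y -> sm X y) ->
  exists2 L, 0 <= L & forall y y', K y -> K y' ->
    `|X y' - X y - 'D_(y' - y) X y| <= L * `|y' - y| ^+ 2.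
Proof.
move=> Kc Kv Xs.
have [L HL] : exists L : 'I_M -> R, forall l, 0 <= L l /\
   forall y y', K y -> K y' -> `|X y' 0 l - X y 0 l - 'D_(y' - y) (fun z => X z 0 l) y|
      <= L l * `|y' - y| ^+ 2.
  apply: (@fin_choice _ _ (fun l L => 0 <= L /\ forall y y', K y -> K y' ->
     `|X y' 0 l - X y 0 l - 'D_(y' - y) (fun z => X z 0 l) y| <= L * `|y' - y| ^+ 2)) => l.
  by have [L L0 H] := C2_taylor Kc Kv (fun y Ky => sm_coordF l (Xs y Ky)); exists L.
exists (\sum_l L l); first by apply: sumr_ge0 => l _; have [] := HL l.
move=> y y' Ky Ky'; apply: mx_norm_le.
  by rewrite mulr_ge0 ?sqr_ge0// sumr_ge0// => l _; have [] := HL l.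
move=> i l; rewrite ord1.
have -> : (X y' - X y - 'D_(y' - y) X y) 0 l = X y' 0 l - X y 0 l - ('D_(y' - y) X y) 0 l.
  by rewrite !mxE.
rewrite derive_rowE; last exact: sm_derivable (Xs _ Ky).
rewrite (le_trans ((HL l).2 _ _ Ky Ky'))// ler_wpM2r ?sqr_ge0//.
by rewrite (bigD1 l)//= lerDl sumr_ge0// => m _; have [] := HL m.
Qed.

Lemma derive_bound N M (K : set 'rV[R]_N) (X : 'rV[R]_N -> 'rV[R]_M) :
  compact K -> (forall y, K y -> sm X y) ->
  exists2 L, 0 <= L & forall y w, K y -> `|'D_w X y| <= L * `|w|.
Proof.
move=> Kc Xs.
have [L HL] : exists L : 'I_N -> R, forall m, 0 <= L m /\
    forall y, K y -> `|'D_(delta_mx 0 m) X y| <= L m.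
  apply: (@fin_choice _ _ (fun m L => 0 <= L /\ forall y, K y -> `|'D_(delta_mx 0 m) X y| <= L)) => m.
  have nc y : K y -> {for y, continuous (fun y => `|'D_(delta_mx 0 m) X y|)}.
    move=> Ky; apply: (@continuous_comp _ _ _ (fun y => 'D_(delta_mx 0 m) X y)).
      exact: sm_cont (sm_derive _ (Xs y Ky)).
    exact: norm_continuous.
  have [M0 M00 H] := compact_cont_bounded Kc nc.
  by exists M0; split=> // y /H; rewrite normr_id.
exists (\sum_l L l); first by apply: sumr_ge0 => l _; have [] := HL l.
move=> y w Ky; rewrite derive_row_decomp; last exact: sm_diff (Xs _ Ky).
rewrite (le_trans (ler_norm_sum _ _ _))// mulr_suml; apply: ler_sum => m _.
by rewrite normrZ mulrC ler_pM//; [have [_ ->] := HL m|exact: mx_norm_coord].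
Qed.

Lemma sm_lsubmx n1 n2 (z : 'rV[R]_(n1 + n2)) : sm (fun z : 'rV[R]_(n1 + n2) => lsubmx z) z.
Proof.
apply: sm_rowP => l; under eq_fun do rewrite mxE; exact: sm_coord.
Qed.

Lemma sm_rsubmx n1 n2 (z : 'rV[R]_(n1 + n2)) : sm (fun z : 'rV[R]_(n1 + n2) => rsubmx z) z.
Proof.
apply: sm_rowP => l; under eq_fun do rewrite mxE; exact: sm_coord.
Qed.

Lemma sm_row_mx (V : normedModType R) n1 n2 (F : V -> 'rV[R]_n1) (G : V -> 'rV[R]_n2) x :
  sm F x -> sm G x -> sm (fun y => row_mx (F y) (G y)) x.
Proof.
move=> Fx Gx; apply: sm_rowP => l; under eq_fun do rewrite mxE.
by case: fintype.split => m; exact: sm_coordF.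
Qed.

(** The lift of [X] to the tangent bundle: its integral curves are a solution of y' = X(y) together
    with a solution of the equation linearised along it. *)
Definition tangent_field N (X : 'rV[R]_N -> 'rV[R]_N) : 'rV[R]_(N + N) -> 'rV[R]_(N + N) :=
  fun z => row_mx (X (lsubmx z)) ('D_(rsubmx z) X (lsubmx z)).

Lemma sm_tangent_field N (X : 'rV[R]_N -> 'rV[R]_N) z :
  sm X (lsubmx z) -> sm (tangent_field X) z.
Proof.
move=> Xz.
have sl : sm (fun z : 'rV[R]_(N + N) => lsubmx z) z by exact: sm_lsubmx.
have Xl : sm (fun z : 'rV[R]_(N + N) => X (lsubmx z)) z by exact: sm_comp Xz.
apply: sm_row_mx => //.
(* The derivative of [X] at [y] along [w] equals the derivative of (y, w) |-> X(y) along the field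
   (w, 0), a form to which [sm_dirD] applies. *)
have Hd : sm (fun z => 'D_(row_mx (rsubmx z) 0) (fun z : 'rV[R]_(N + N) => X (lsubmx z)) z) z.
  apply: sm_dirD => //; apply: sm_row_mx; [exact: sm_rsubmx|exact: sm_cst].
apply: sm_ext Hd.
have nX : \forall y \near z, sm X (lsubmx y) by exact: ((sm_cont sl) _ (sm_near Xz)).
apply: filterS nX => y Xy.
rewrite (@derive_comp _ _ _ _ (fun z : 'rV[R]_(N + N) => lsubmx z) X y); last 2 first.
- exact: sm_diff (sm_lsubmx _).
- exact: sm_diff Xy.
congr ('D__ X _).
have lc : continuous (@lsubmx R 1 N N) by move=> u; exact: sm_cont (sm_lsubmx u).
exact: etrans (derive_lin y _ lc) (row_mxKl _ _).
Qed.

Section Family.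
Variables (N : nat) (P : normedModType R).

(** Initial values are affine in the parameter so that the class is stable under differentiation:
    the variation in direction [v] starts at the constant [l v]. The trajectories share a compact
    convex set, on which Lipschitz and Taylor constants are uniform. *)
Record ode_family (K : set 'rV[R]_N) (X : 'rV[R]_N -> 'rV[R]_N) (T : R)
  (C : set P) (l : P -> 'rV[R]_N) (y0 : 'rV[R]_N) (phi : R -> P -> 'rV[R]_N) : Prop :=
 OdeFamily {
   of_T : 0 < T;
   of_K : compact K;
   of_cvx : cvx K;
   of_X : forall y, K y -> sm X y;
   of_C : open C;
   of_l : linear l;
   of_lb : exists2 k : R, 0 <= k & forall c, `|l c| <= k * `|c|;
   of_0 : forall c, C c -> phi 0 c = l c + y0;
   of_in : forall c (t : R), C c -> `|t| < T -> K (phi t c);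
   of_d : forall c (t : R), C c -> `|t| < T -> is_derive t 1 (fun s => phi s c) (X (phi t c)) }.

Variables (K : set 'rV[R]_N) (X : 'rV[R]_N -> 'rV[R]_N) (T : R)
  (C : set P) (l : P -> 'rV[R]_N) (y0 : 'rV[R]_N) (phi : R -> P -> 'rV[R]_N).
Hypothesis H : ode_family K X T C l y0 phi.

Let lB c c' : l c - l c' = l (c - c').
Proof. by rewrite -scaleN1r addrC -(of_l H) scaleN1r addrC. Qed.

Lemma family_lip : exists2 L, 0 <= L & forall c c' (t : R), C c -> C c' -> `|t| < T ->
  `|phi t c' - phi t c| <= L * `|c' - c|.
Proof.
have [Lx Lx0 HX] := C1_lipv (of_K H) (of_cvx H) (of_X H).
have [k k0 Hk] := of_lb H.
pose E := expR (N%:R * (2 * Lx + 1) * T).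
exists (N%:R * k ^+ 2 * E + 1).
  by rewrite addr_ge0// mulr_ge0 ?expR_ge0// mulr_ge0 ?sqr_ge0.
move=> c c' t Cc Cc' tT.
have := @gronwall _ N (fun t => phi t c' - phi t c)
  (fun t => X (phi t c') - X (phi t c)) T Lx 0 Lx0 (lexx _) _ t tT.
have Hd (s : R) : `|s| < T -> is_derive s 1 (fun t : R => phi t c' - phi t c)
    (X (phi s c') - X (phi s c)) /\
   `|X (phi s c') - X (phi s c)| <= Lx * `|phi s c' - phi s c| + 0.
  move=> sT; split; last by rewrite addr0; apply: HX; exact: (of_in H).
  by apply: is_deriveB; exact: (of_d H).
have e0 : phi 0 c' - phi 0 c = l (c' - c).
  by rewrite !(of_0 H)// opprD addrACA subrr addr0 lB.
move=> /(_ Hd); rewrite e0 expr0n /= addr0 => G.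
apply: sqr_le_bound => //.
  by rewrite mulr_ge0 ?expR_ge0// mulr_ge0 ?sqr_ge0.
apply: (le_trans G).
rewrite [leRHS]mulrAC ler_wpM2r ?expR_ge0// -mulrA ler_wpM2l//.
by rewrite -exprMn ler_pXn2r// ?nnegrE// mulr_ge0.
Qed.

Lemma family_time : exists2 L, 0 <= L & forall c (s t : R), C c -> `|s| < T -> `|t| < T ->
  `|phi t c - phi s c| <= L * `|t - s|.
Proof.
have nc y : K y -> {for y, continuous (fun y => `|X y|)}.
  move=> Ky; apply: (@continuous_comp _ _ _ X); first exact: sm_cont (of_X H Ky).
  exact: norm_continuous.
have [M M0 HM] := compact_cont_bounded (of_K H) nc.
exists M => // c s t Cc sT tT.
apply: mx_norm_le; first by rewrite mulr_ge0.
move=> i m; rewrite ord1 !mxE.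
have inT (u : R) : 0 <= u <= 1 -> `|s + u *: (t - s)| < T.
  move=> /andP[u0 u1]; have -> : s + u *: (t - s) = (1 - u) * s + u * t.
    by rewrite /GRing.scale /=; ring.
  apply: (@le_lt_trans _ _ (Num.max `|s| `|t|)); last by rewrite gt_max sT.
  set b := Num.max _ _.
  have /ler_normlP[s1 s2] : `|s| <= b by rewrite le_max lexx.
  have /ler_normlP[t1 t2] : `|t| <= b by rewrite le_max lexx orbT.
  by apply/ler_normlP; split; nra.
have dm (u : R) : `|u| < T -> is_derive u 1 (fun s => phi s c 0 m) (X (phi u c) 0 m).
  by move=> uT; apply: is_derive_coord; exact: (of_d H).
have df (u : R) : `|u| < T -> differentiable (fun s => phi s c 0 m) u.
  by move=> /dm [d _]; exact/derivable1_diffP.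
have [u u01] := mvt01 (f := fun s => phi s c 0 m) (x := s) (v := t - s)
   (fun u u01 => diff_derivable (df _ (inT _ u01))).
rewrite (addrC s) subrK => ->.
have := @deriveZv _ _ _ _ _ (t - s) (1 : R) (df _ (inT _ u01)).
rewrite [(t - s) *: 1]mulr1 => ->.
have [_ ->] := dm _ (inT _ u01).
rewrite normrZ mulrC ler_wpM2r// (le_trans (mx_norm_coord _ _ _))//.
by rewrite -[leLHS]normr_id; apply: HM; apply: (of_in H) => //; exact: inT.
Qed.

Lemma family_cont c (t : R) : C c -> `|t| < T ->
  {for (t, c), continuous (fun p : R * P => phi p.1 p.2)}.
Proof.
move=> Cc tT.
have [L1 L10 H1] := family_lip; have [L2 L20 H2] := family_time.
apply/cvgrPdist_le => e e0.
pose d := e / (L1 + L2 + 1).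
have L0 : 0 < L1 + L2 + 1 by rewrite ltr_wpDl// addr_ge0.
have d0 : 0 < d by rewrite divr_gt0.
have nT : \forall p \near (t, c), `|p.1| < T /\ C p.2.
  have n1 : \forall s \near t, `|s| < T.
    have : {for t, continuous (fun t : R => `|t|)} by exact: norm_continuous.
    by move=> /cvgr_lt; apply.
  have n2 : \forall b \near c, C b by apply: open_nbhs_nbhs; split=> //; exact: (of_C H).
  apply: filterI; first exact: (@cvg_fst _ _ _ _ _ _ n1).
  exact: (@cvg_snd _ _ _ _ _ _ n2).
have nd : \forall p \near (t, c), `|(t, c) - p| <= d.
  by apply/nbhs_normP; exists d => //= p /ltW.
apply: filterS2 nT nd => -[s b] /= [sT Cb] sb.
have hs : `|t - s| <= d.
  by apply: le_trans sb; rewrite prod_normE /= le_max lexx.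
have hb : `|c - b| <= d.
  by apply: le_trans sb; rewrite prod_normE /= le_max lexx orbT.
rewrite -(subrKA (phi s c)) (le_trans (ler_normD _ _))//.
apply: (@le_trans _ _ (L2 * d + L1 * d)).
  rewrite lerD//.
    by rewrite (le_trans (H2 _ _ _ _ _ _))// ler_wpM2l.
  by rewrite (le_trans (H1 _ _ _ _ _ _))// ler_wpM2l.
rewrite -mulrDl /d mulrA ler_pdivrMr// mulrC ler_pM2l//; lra.
Qed.


Definition quot (v c : P) (h t : R) : 'rV[R]_N := h^-1 *: (phi t (h *: v + c) - phi t c).

Lemma near_shiftC (v c : P) : C c -> exists2 d : R, 0 < d & forall h, `|h| < d -> C (h *: v + c).
Proof.
move=> Cc; have /nbhs_normP[r /= r0 Hr] := open_nbhs_nbhs (conj (of_C H) Cc).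
exists (r / (`|v| + 1)); first by rewrite divr_gt0// ltr_wpDl.
move=> h; rewrite ltr_pdivlMr ?ltr_wpDl// => hr; apply: Hr.
rewrite /ball_ /= opprD addrCA subrr addr0 normrN normrZ.
by rewrite (le_lt_trans _ hr)// ler_wpM2l// lerDl.
Qed.

(** By second-order Taylor expansion a difference quotient solves the linearised equation up to
    O(|h|). Two quotients start at the same value [l v], so by Gronwall they differ by O(|h| +
    |h'|). Only the range [d] of steps depends on [c], not the constant [B]. *)
Lemma quot_cauchy (v : P) : exists2 B : R, 0 <= B & forall c, C c -> exists2 d : R, 0 < d &
  forall h h' t : R, h != 0 -> h' != 0 -> `|h| < d -> `|h'| < d -> `|t| < T ->
    [/\ `|quot v c h t - quot v c h' t| <= B * (`|h| + `|h'|),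
        quot v c h 0 = l v,
        `|quot v c h t| <= B,
        is_derive t 1 (quot v c h) (h^-1 *: (X (phi t (h *: v + c)) - X (phi t c))) &
        `|h^-1 *: (X (phi t (h *: v + c)) - X (phi t c)) - 'D_(quot v c h t) X (phi t c)|
          <= B * `|h| ].
Proof.
have [L L0 HL] := family_lip.
have [L2 L20 HL2] := C2_taylorv (of_K H) (of_cvx H) (of_X H).
have [Kd Kd0 HKd] := derive_bound (of_K H) (of_X H).
pose B1 := L2 * (L * `|v|) ^+ 2.
have B10 : 0 <= B1 by rewrite mulr_ge0// sqr_ge0.
pose E := expR (N%:R * (2 * Kd + 1) * T).
have E0 : 0 <= E by exact: expR_ge0.
have LB : 0 <= L * `|v| by rewrite mulr_ge0.
(* One summand for each estimate: the Cauchy property, the linearisation remainder and the size of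
   the quotient. *)
pose B := (E + 1) * B1 + B1 + L * `|v|.
have B1B : (E + 1) * B1 <= B.
  by rewrite /B -addrA lerDl addr_ge0.
have B1B' : B1 <= B by rewrite /B addrAC lerDr addr_ge0// mulr_ge0// addr_ge0.
have LvB : L * `|v| <= B by rewrite /B lerDr addr_ge0// mulr_ge0// addr_ge0.
exists B; first exact: le_trans B1B'.
move=> c Cc; have [d d0 Hd] := near_shiftC v Cc.
have quot_bound h (t : R) : h != 0 -> `|h| < d -> `|t| < T -> `|quot v c h t| <= L * `|v|.
  move=> h0 hd tT; rewrite /quot normrZ normfV ler_pdivrMl ?normr_gt0//.
  rewrite (le_trans (HL _ _ _ Cc (Hd _ hd) tT))//.
  by rewrite addrK normrZ mulrCA.
have quot_0 h : h != 0 -> `|h| < d -> quot v c h 0 = l v.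
  move=> h0 hd; rewrite /quot !(of_0 H)//; last exact: Hd.
  by rewrite opprD addrACA subrr addr0 (of_l H) addrK scalerA mulVf// scale1r.
have quot_d h (t : R) : `|h| < d -> `|t| < T ->
  is_derive t 1 (quot v c h) (h^-1 *: (X (phi t (h *: v + c)) - X (phi t c))).
  move=> hd tT; apply: is_deriveZ; apply: is_deriveB; first by apply: (of_d H) => //; exact: Hd.
  exact: (of_d H).
have quot_rem h (t : R) : h != 0 -> `|h| < d -> `|t| < T ->
  `|h^-1 *: (X (phi t (h *: v + c)) - X (phi t c)) - 'D_(quot v c h t) X (phi t c)|
          <= B1 * `|h|.
  move=> h0 hd tT; have Kt := of_in H Cc tT; have Kt' := of_in H (Hd _ hd) tT.
  rewrite /quot deriveZv; last exact: sm_diff (of_X H Kt).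
  rewrite -scalerBr normrZ normfV ler_pdivrMl ?normr_gt0//.
  rewrite (le_trans (HL2 _ _ Kt Kt'))//.
  have hl : `|phi t (h *: v + c) - phi t c| <= L * `|v| * `|h|.
    rewrite (le_trans (HL _ _ _ Cc (Hd _ hd) tT))//.
    by rewrite addrK normrZ mulrCA mulrC -!mulrA; rewrite (mulrC `|v|).
  have -> : `|h| * (B1 * `|h|) = L2 * (L * `|v| * `|h|) ^+ 2 by rewrite /B1; ring.
  by rewrite ler_wpM2l// ler_pXn2r// ?nnegrE// mulr_ge0.
exists d => // h h' t h0 h'0 hd h'd tT; split.
- have Hz (s : R) : `|s| < T -> is_derive s 1 (fun t => quot v c h t - quot v c h' t)
     (h^-1 *: (X (phi s (h *: v + c)) - X (phi s c)) - h'^-1 *: (X (phi s (h' *: v + c)) - X (phi s c)))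
     /\ `|h^-1 *: (X (phi s (h *: v + c)) - X (phi s c)) - h'^-1 *: (X (phi s (h' *: v + c)) - X (phi s c))|
     <= Kd * `|quot v c h s - quot v c h' s| + B1 * (`|h| + `|h'|).
    move=> sT; split; first by apply: is_deriveB; exact: quot_d.
    have Ks := of_in H Cc sT.
    have r1 := quot_rem _ _ h0 hd sT; have r2 := quot_rem _ _ h'0 h'd sT.
    have r3 := HKd _ (quot v c h s - quot v c h' s) Ks.
    have E3 : 'D_(quot v c h s - quot v c h' s) X (phi s c) =
      'D_(quot v c h s) X (phi s c) - 'D_(quot v c h' s) X (phi s c).
      by rewrite deriveBv//; exact: sm_diff (of_X H Ks).
    rewrite E3 in r3; move: r1 r2 r3.
    move: (h^-1 *: _) (h'^-1 *: _) ('D_(quot v c h s) X _) ('D_(quot v c h' s) X _) => a b a' b' r1 r2 r3.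
    have -> : a - b = (a' - b') + ((a - a') - (b - b')).
      by rewrite opprB addrACA (addrC a') subrK addKr.
    rewrite (le_trans (ler_normD _ _))// lerD// mulrDr (le_trans (ler_normB _ _))// lerD//.
  have e0 : 0 <= B1 * (`|h| + `|h'|) by rewrite mulr_ge0// addr_ge0.
  have := gronwall Kd0 e0 Hz tT.
  rewrite !quot_0// subrr normr0 expr0n /= mulr0 add0r => G.
  apply: (@le_trans _ _ ((E + 1) * (B1 * (`|h| + `|h'|)))).
    by apply: sqr_le_bound => //; rewrite mulrC.
  by rewrite mulrA ler_wpM2r// addr_ge0.
- exact: quot_0.
- exact: le_trans (quot_bound _ _ h0 hd tT) LvB.
- exact: quot_d.
- by rewrite (le_trans (quot_rem _ _ h0 hd tT))// ler_wpM2r.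
Qed.

(** The Cauchy estimate gives the derivative in the parameter, and letting h' tend to 0 in it gives
    a rate of convergence uniform in time. *)
Lemma quot_lim (v : P) : exists2 B : R, 0 <= B & forall c, C c -> exists2 d : R, 0 < d &
  forall (t : R), `|t| < T -> [/\ derivable (phi t) c v, `|'D_v (phi t) c| <= B &
   forall h, h != 0 -> `|h| < d -> `|quot v c h t - 'D_v (phi t) c| <= B * `|h|].
Proof.
have [B B0 HB'] := quot_cauchy v; exists B => // c Cc.
have [d d0 HB] := HB' c Cc; exists d => // t tT.
have der : derivable (phi t) c v.
  apply: cauchy_cvg; apply/cauchyP => e e0.
  have B10 : 0 < B + 1 by rewrite ltr_wpDl.
  pose h0 := Num.min (d / 2) (e / 4 / (B + 1)).
  have h00 : 0 < h0 by rewrite lt_min !divr_gt0.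
  have h0d : h0 < d by rewrite (@le_lt_trans _ _ (d / 2))// ?ge_min ?lexx// ltr_pdivrMr// ltr_pMr// ltr1n.
  have h0e : (B + 1) * h0 <= e / 4.
    by rewrite mulrC -ler_pdivlMr// ge_min lexx orbT.
  exists (quot v c h0 t).
  change (\forall h \near 0^', ball (quot v c h0 t) e (quot v c h t)).
  near=> h; rewrite -ball_normE /ball_ /=.
  have hn : h != 0 by near: h; exact: nbhs_dnbhs_neq.
  have hh : `|h| < h0 by near: h; exact: dnbhs0_lt.
  have h0n : h0 != 0 by rewrite gt_eqF.
  have [+ _ _ _ _] := HB h0 h t h0n hn ltac:(by rewrite gtr0_norm) (lt_trans hh h0d) tT.
  rewrite (gtr0_norm h00) => K1; apply: (le_lt_trans K1).
  apply: (@le_lt_trans _ _ ((B + 1) * h0 + (B + 1) * h0)).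
    by nra.
  apply: (@le_lt_trans _ _ (e / 4 + e / 4)); first by rewrite lerD.
  lra.
have lim h : h != 0 -> `|h| < d -> `|quot v c h t - 'D_v (phi t) c| <= B * `|h|.
  move=> hn hd; apply/ler_addgt0Pr => e e0.
  have B10 : 0 < B + 1 by rewrite ltr_wpDl.
  have e20 : 0 < e / 2 by rewrite divr_gt0.
  have n1 : \forall h' \near (0 : R)^', `|'D_v (phi t) c - quot v c h' t| <= e / 2.
    by have /cvgrPdist_le /(_ _ e20) := der.
  suff : \forall h' \near (0 : R)^', `|quot v c h t - 'D_v (phi t) c| <= B * `|h| + e.
    by move=> /filter_ex[].
  near=> h'.
  have hn' : h' != 0 by near: h'; exact: nbhs_dnbhs_neq.
  have hd' : `|h'| < d by near: h'; exact: dnbhs0_lt.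
  have he' : `|h'| < e / 2 / (B + 1) by near: h'; apply: dnbhs0_lt; rewrite divr_gt0.
  have n1h : `|'D_v (phi t) c - quot v c h' t| <= e / 2 by near: h'.
  have [K1 _ _ _ _] := HB h h' t hn hn' hd hd' tT.
  rewrite -(subrKA (quot v c h' t)) (le_trans (ler_normD _ _))//.
  rewrite [`|quot v c h' t - _|]distrC (splitr e) addrA lerD//.
  rewrite (le_trans K1)// mulrDr lerD2l.
  rewrite (@le_trans _ _ ((B + 1) * `|h'|))// ?ler_wpM2r// ?lerDl//.
  by rewrite mulrC -ler_pdivlMr// ltW.
split=> //.
apply/ler_addgt0Pr => e e0.
pose h := Num.min (d / 2) (e / (B + 1)).
have B10 : 0 < B + 1 by rewrite ltr_wpDl.
have h0 : 0 < h by rewrite lt_min !divr_gt0.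
have hd : `|h| < d.
  by rewrite gtr0_norm// (@le_lt_trans _ _ (d / 2))// ?ge_min ?lexx// ltr_pdivrMr// ltr_pMr// ltr1n.
have hn : h != 0 by rewrite gt_eqF.
have [_ _ K1 _ _] := HB h h t hn hn hd hd tT.
have K2 := lim h hn hd.
rewrite -[X in `|X|](subKr (quot v c h t)) (le_trans (ler_normB _ _))// lerD//.
rewrite (le_trans K2)// gtr0_norm// (@le_trans _ _ ((B + 1) * h))//.
  by rewrite ler_wpM2r ?ltW// ltrDl.
by rewrite mulrC -ler_pdivlMr// ge_min lexx orbT.
Unshelve. all: by end_near. Qed.

End Family.
End Regularity.

(** * The derivative in a parameter solves the linearised equation *)

Section RegularityTheorem.
Context {R : realType}.

Lemma compact_tangent N (K : set 'rV[R]_N) (B : R) : compact K ->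
  compact [set z : 'rV[R]_(N + N) | K (lsubmx z) /\ `|rsubmx z| <= B].
Proof.
move=> Kc.
have -> : [set z : 'rV[R]_(N + N) | K (lsubmx z) /\ `|rsubmx z| <= B] =
    (fun p : 'rV[R]_N * 'rV[R]_N => row_mx p.1 p.2) @` (K `*` [set w | `|w| <= B]).
  apply/seteqP; split=> [z [/= Kz zB]|z [[y w] [/= Ky wB] <-]].
    by exists (lsubmx z, rsubmx z) => //=; rewrite hsubmxK.
  by rewrite row_mxKl row_mxKr.
apply: continuous_compact.
  apply: continuous_subspaceT => p.
  by apply: sm_cont; apply: sm_row_mx; [exact: sm_fst|exact: sm_snd].
apply: compact_setX => //; apply: bounded_closed_compact.
  exists B; split; first exact: num_real.
  by move=> M BM w /= wB; rewrite (le_trans wB)// ltW.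
rewrite (_ : [set w | _] = (fun w : 'rV[R]_N => `|w|) @^-1` [set x | x <= B])//.
apply: closed_comp => [w _|]; last exact: closed_le.
exact: norm_continuous.
Qed.

Lemma sum_le_aux (k b b' h x y e : R) : 0 <= k -> 0 <= b -> 0 <= b' -> 0 <= h ->
  x <= b' * h -> y <= k * (b * h) -> (k + 1) * ((b + b') * h) <= e -> x + y <= e.
Proof.
move=> k0 b0 b'0 h0 hx hy; apply: le_trans; apply: (le_trans (lerD hx hy)).
have -> : (k + 1) * ((b + b') * h) = b' * h + k * (b * h) + (k * (b' * h) + b * h) by ring.
by rewrite lerDl addr_ge0// !mulr_ge0.
Qed.

Lemma dist_le_quarter (V : normedModType R) (a b x y : V) (e : R) :
  `|a - x| <= e / 4 -> `|a - b| <= e / 4 -> `|b - y| <= e / 4 -> `|x - y| <= e.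
Proof.
move=> ax ab bY.
have -> : x - y = (a - b) - (a - x) + (b - y).
  by rewrite opprB [a - b + _]addrC subrKA subrKA.
apply: (@le_trans _ _ (`|a - b| + `|a - x| + `|b - y|)).
  by rewrite (le_trans (ler_normD _ _))// lerD// ler_normB.
apply: (@le_trans _ _ (e / 4 + e / 4 + e / 4)); first by rewrite !lerD.
have : 0 <= e / 4 by exact: le_trans ax.
lra.
Qed.

(** Solution and variation together form a family of the same kind, for [tangent_field X]. This
    closure property is what lets smoothness in the parameter be proved by induction on the
    order. *)
Lemma tangent_family N (P : normedModType R) (K : set 'rV[R]_N) X (T : R) (C : set P) l y0 phi
    (v : P) : ode_family K X T C l y0 phi ->
  (forall c (t : R), C c -> `|t| < T -> derivable (phi t) c v) /\
  exists K', ode_family K' (tangent_field X) T C (fun c => row_mx (l c) 0)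
    (row_mx y0 (l v)) (fun t c => row_mx (phi t c) ('D_v (phi t) c)).
Proof.
move=> H; have [B B0 HB] := quot_lim H v; have [B' B'0 HB'] := quot_cauchy H v.
split=> [c t /HB[d d0 /(_ t)] Hd /Hd[]//|].
exists [set z : 'rV[R]_(N + N) | K (lsubmx z) /\ `|rsubmx z| <= B].
have [k k0 Hk] := of_lb H.
split.
- exact: of_T H.
- exact: compact_tangent (of_K H).
- move=> y y' t [Ky yB] [Ky' y'B] t01; split=> /=.
    have -> : lsubmx (y + t *: (y' - y)) = lsubmx y + t *: (lsubmx y' - lsubmx y).
      by rewrite linearD linearZ linearB.
    exact: (of_cvx H).
  have -> : rsubmx (y + t *: (y' - y)) = (1 - t) *: rsubmx y + t *: rsubmx y'.
    by apply/rowP => j; rewrite !mxE; ring.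
  case/andP: t01 => t0 t1; have t1' : 0 <= 1 - t by rewrite subr_ge0.
  rewrite (le_trans (ler_normD _ _))// !normrZ (ger0_norm t0) (ger0_norm t1').
  by move: yB y'B; nra.
- by move=> y [/(of_X H) Xy _]; exact: sm_tangent_field.
- exact: of_C H.
- by move=> a x y; rewrite (of_l H) scale_row_mx add_row_mx scaler0 addr0.
- exists k => // c; apply: le_trans (Hk c); apply: mx_norm_le => // i j.
  rewrite mxE; case: fintype.split => m; first exact: mx_norm_coord.
  by rewrite mxE normr0.
- move=> c Cc; rewrite (of_0 H Cc) add_row_mx add0r; congr row_mx.
  have [d d0 Hd] := HB c Cc; have [d' d'0 Hd'] := HB' c Cc.
  have T0 : `|0 : R| < T by rewrite normr0 (of_T H).
  have [der _ _] := Hd 0 T0.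
  apply/cvg_lim => //=; apply: cvg_near_cst.
  near=> h.
  have hn : h != 0 by near: h; exact: nbhs_dnbhs_neq.
  have hd : `|h| < d' by near: h; exact: dnbhs0_lt.
  by have [_ + _ _ _] := Hd' h h 0 hn hn hd hd T0.
- move=> c t Cc tT; have [d d0 Hd] := HB c Cc; have [_ ? _] := Hd t tT.
  by rewrite /= row_mxKl row_mxKr; split=> //; exact: (of_in H).
move=> c t Cc tT; have [d d0 Hd] := HB c Cc; have [d' d'0 Hd'] := HB' c Cc.
pose psi s := 'D_v (phi s) c.
have approx (e : R) : 0 < e -> exists h : R, [/\ h != 0, `|h| < d, `|h| < d' & (B + B') * `|h| <= e].
  move=> e0; have BB : 0 < B + B' + 1 by rewrite ltr_wpDl// addr_ge0.
  pose h := Num.min (Num.min (d / 2) (d' / 2)) (e / (B + B' + 1)).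
  have h0 : 0 < h by rewrite !lt_min !divr_gt0.
  exists h; rewrite gtr0_norm//; split.
  - by rewrite gt_eqF.
  - rewrite (@le_lt_trans _ _ (d / 2))// ?ge_min ?ge_min ?lexx//.
    by rewrite ltr_pdivrMr// ltr_pMr// ltr1n.
  - rewrite (@le_lt_trans _ _ (d' / 2))// ?ge_min ?ge_min ?lexx ?orbT//.
    by rewrite ltr_pdivrMr// ltr_pMr// ltr1n.
  - rewrite (@le_trans _ _ ((B + B' + 1) * h))//.
      by rewrite ler_wpM2r ?ltW// ltrDl.
    by rewrite mulrC -ler_pdivlMr// ge_min lexx orbT.
have phic (s : R) : `|s| < T -> {for s, continuous (fun s => phi s c)}.
  by move=> sT; have [ds _] := of_d H Cc sT; apply: differentiable_continuous; exact/derivable1_diffP.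
have nT (s : R) : `|s| < T -> \forall u \near s, `|u| < T.
  have : {for s, continuous (fun t : R => `|t|)} by exact: norm_continuous.
  by move=> /cvgr_lt; apply.
(* [psi] is the limit, uniform in time, of continuous difference quotients. *)
have psic (s : R) : `|s| < T -> {for s, continuous psi}.
  move=> sT; apply/cvgrPdist_le => e e0.
  have e40 : 0 < e / 4 by rewrite divr_gt0.
  have [h [hn hd hd' he]] := approx _ e40.
  have [_ _ _ [dq _] _] := Hd' h h s hn hn hd' hd' sT.
  have qc : {for s, continuous (quot phi v c h)}.
    by apply: differentiable_continuous; exact/derivable1_diffP.
  have he' : B * `|h| <= e / 4 by rewrite (le_trans _ he)// ler_wpM2r// lerDl.
  have /cvgrPdist_le /(_ _ e40) nq := qc.
  apply: filterS2 nq (nT s sT) => u qu uT.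
  have [_ _ /(_ h hn hd) k1] := Hd s sT; have [_ _ /(_ h hn hd) k2] := Hd u uT.
  apply: (dist_le_quarter (a := quot phi v c h s) (b := quot phi v c h u)) => //.
  - exact: le_trans k1 he'.
  - exact: le_trans k2 he'.
have phid := of_d H Cc tT.
have Kt := of_in H Cc tT.
pose g s := 'D_(psi s) X (phi s c).
have gc : {for t, continuous g}.
  pose f1 s := (phi s c, psi s).
  pose g1 (p : 'rV[R]_N * 'rV[R]_N) := rsubmx (tangent_field X (row_mx p.1 p.2)).
  have -> : g = g1 \o f1.
    by apply/funext => s /=; rewrite /g1 /tangent_field row_mxKr row_mxKl row_mxKr.
  apply: (@continuous_comp _ _ _ f1 g1).
    exact: (cvg_pair (phic t tT) (psic t tT)).
  apply: sm_cont.
  have s1 : sm (fun p : 'rV[R]_N * 'rV[R]_N => row_mx p.1 p.2) (f1 t).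
    by apply: sm_row_mx; [exact: sm_fst|exact: sm_snd].
  have s2 : sm (fun p : 'rV[R]_N * 'rV[R]_N => tangent_field X (row_mx p.1 p.2)) (f1 t).
    apply: (@sm_comp _ _ _ _ _ _ _ (tangent_field X) _ s1); apply: sm_tangent_field; rewrite row_mxKl; exact: (of_X H).
  by apply: (@sm_comp _ _ _ _ _ _ _ (fun z => rsubmx z) _ s2); exact: sm_rsubmx.
have [Kd Kd0 HKd] := derive_bound (of_K H) (of_X H).
have psid : is_derive t 1 psi (g t).
  (* The approximants are the difference quotients. Their derivatives miss [g] by the linearisation
     remainder plus [Kd] times the error in [psi], whence the tolerance [e / (Kd + 1)]. *)
  apply: (lim_derive tT gc) => e e0.
  have e10 : 0 < e / (Kd + 1) by rewrite divr_gt0// ltr_wpDl.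
  have e1e : e / (Kd + 1) * (Kd + 1) = e by rewrite divfK// gt_eqF// ltr_wpDl.
  have [h [hn hd hd' he]] := approx _ e10.
  exists (quot phi v c h), (fun s => h^-1 *: (X (phi s (h *: v + c)) - X (phi s c))) => s sT.
  have [_ _ _ dq rq] := Hd' h h s hn hn hd' hd' sT.
  have [_ _ /(_ h hn hd) k1] := Hd s sT.
  have Ks := of_in H Cc sT.
  rewrite -/(psi s) in k1.
  have h0 : 0 <= `|h| by [].
  split=> //.
    apply: (le_trans k1); apply: (@le_trans _ _ ((B + B') * `|h|)).
      by apply: ler_wpM2r => //; rewrite lerDl.
    apply: (le_trans he); rewrite -[leRHS]e1e; apply: ler_peMr; first exact: ltW.
    by rewrite lerDr.
  have k2 := HKd (phi s c) (quot phi v c h s - psi s) Ks.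
  rewrite deriveBv in k2; last exact: sm_diff (of_X H Ks).
  rewrite -/(g s) in k2.
  have k3 := le_trans k2 (ler_wpM2l Kd0 k1).
  have k4 : (Kd + 1) * ((B + B') * `|h|) <= e.
    by rewrite -[leRHS]e1e mulrC; apply: ler_wpM2r => //; rewrite addr_ge0.
  rewrite -(subrKA ('D_(quot phi v c h s) X (phi s c))).
  exact: le_trans (ler_normD _ _) (sum_le_aux Kd0 B0 B'0 h0 rq k3 k4).
apply: is_derive_coordP => m.
have dl := fun j => is_derive_coord j phid; have dr := fun j => is_derive_coord j psid.
rewrite /tangent_field row_mxKl row_mxKr.
under eq_fun do rewrite mxE.
by rewrite mxE; case: fintype.split => j; [exact: dl|exact: dr].
Unshelve. all: by end_near. Qed.

End RegularityTheorem.

(** * Joint smoothness in time and parameter *)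

Section FamilySmooth.
Context {R : realType}.

Lemma prod_basis (V W : normedModType R) (fV : fdim V) (fW : fdim W)
   (l : 'I_(@fd_n _ _ (fdim_prod fV fW))) :
  (exists a : V, fd_e l = (a, 0)) \/ (exists b : W, fd_e l = (0, b)).
Proof.
rewrite /fd_e /= /fd_pg; case: (splitP l) => m lm.
  left; exists (fd_g (lsubmx (delta_mx 0 l))); congr (_, _).
  rewrite (_ : rsubmx _ = 0) ?linear0//; apply/rowP => j; rewrite !mxE /=.
  by rewrite -val_eqE /= lm; rewrite gtn_eqF//= ltn_addr.
right; exists (fd_g (rsubmx (delta_mx 0 l))); congr (_, _).
rewrite (_ : lsubmx _ = 0) ?linear0//; apply/rowP => j; rewrite !mxE /=.
by rewrite -val_eqE /= lm; rewrite ltn_eqF//= ltn_addr.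
Qed.

Lemma near_norm_lt (s T : R) : `|s| < T -> \forall u \near s, `|u| < T.
Proof.
move=> sT; have : {for s, continuous (fun t : R => `|t|)} by exact: norm_continuous.
by move=> /cvgr_lt; apply.
Qed.

Lemma is_derive_fst (V W X : normedModType R) (f : V * W -> X) (x v : V) (y : W) df :
  is_derive x v (fun z => f (z, y)) df -> is_derive (x, y) (v, 0) f df.
Proof.
have E : (fun h : R => h^-1 *: ((f \o shift (x, y)) (h *: (v, 0)) - f (x, y))) =
   (fun h : R => h^-1 *: (((fun z => f (z, y)) \o shift x) (h *: v) - f (x, y))).
  apply/funext => h /=; congr (_ *: (f _ - _)).
  by apply: injective_projections => //=; rewrite scaler0 add0r.
by move=> [d1 d2]; split; rewrite /derivable /derive E.
Qed.

Lemma is_derive_snd (V W X : normedModType R) (f : V * W -> X) (x : V) (y v : W) df :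
  is_derive y v (fun z => f (x, z)) df -> is_derive (x, y) (0, v) f df.
Proof.
have E : (fun h : R => h^-1 *: ((f \o shift (x, y)) (h *: (0, v)) - f (x, y))) =
   (fun h : R => h^-1 *: (((fun z => f (x, z)) \o shift y) (h *: v) - f (x, y))).
  apply/funext => h /=; congr (_ *: (f _ - _)).
  by apply: injective_projections => //=; rewrite scaler0 add0r.
by move=> [d1 d2]; split; rewrite /derivable /derive E.
Qed.

Lemma derivable1_dir (V : normedModType R) (f : R -> V) (t a : R) (df : V) :
  is_derive t 1 f df -> is_derive t a f (a *: df).
Proof.
move=> [d1 d2]; have fd : differentiable f t by exact/derivable1_diffP.
split; first exact: diff_derivable.
by rewrite -d2 -deriveZv// [a *: 1]mulr1.
Qed.

Section Domain.
Variables (P : normedModType R) (T : R) (C : set P).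
Definition flow_dom : set (R * P) := [set p | `|p.1| < T /\ C p.2].

Lemma flow_dom_open : open C -> open flow_dom.
Proof.
move=> Co; rewrite openE => -[t c] [/= tT Cc].
apply: filterI; first exact: (@cvg_fst _ _ _ _ _ _ (near_norm_lt tT)).
exact: (@cvg_snd _ _ _ _ _ _ (open_nbhs_nbhs (conj Co Cc))).
Qed.
End Domain.

(** The time derivative of phi is X(phi), and its parameter derivatives are components of tangent
    families. Both are C^n by induction, so phi is C^(n+1). The induction runs over all dimensions
    because the tangent family lives in dimension N + N. *)
Theorem family_smooth (P : normedModType R) (fP : fdim P) n N (K : set 'rV[R]_N) X (T : R)
   (C : set P) l y0 phi : ode_family K X T C l y0 phi ->
  Cn n (flow_dom T C) (fun p => phi p.1 p.2).
Proof.
elim: n N K X l y0 phi => [|n IH] N K X l y0 phi H /=.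
  by move=> [t c] [/= tT Cc]; exact: (family_cont H).
have Do : open (flow_dom T C) by apply: flow_dom_open; exact: (of_C H).
set Phi := fun p : R * P => phi p.1 p.2.
have PhiC : Cn n (flow_dom T C) Phi by exact: IH H.
have XC : Cn n (flow_dom T C) (fun p => X (Phi p)).
  apply: (@Cn_comp _ _ _ _ _ _ n _ [set y | sm X y] Phi X) => //.
  - by rewrite openE => y; exact: sm_near.
  - by move=> [t c] [/= tT Cc]; apply: (of_X H); exact: (of_in H).
  - by apply: sm_open.
have psiC v : Cn n (flow_dom T C) (fun p => 'D_v (phi p.1) p.2).
  have [_ [K' /IH H']] := tangent_family v H.
  rewrite (_ : (fun p => _) = (fun p : R * P => rsubmx (row_mx (phi p.1 p.2) ('D_v (phi p.1) p.2)))); last first.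
    by apply/funext => p; rewrite row_mxKr.
  have rc : continuous (@rsubmx R 1 N N) by move=> u; exact: sm_cont (sm_rsubmx u).
  exact: (@Cn_comp_lin _ _ _ _ n _ _ _ Do rc H').
have d1 p (a : R) : flow_dom T C p -> is_derive p (a, 0) Phi (a *: X (Phi p)).
  case: p => t c [/= tT Cc]; apply: is_derive_fst; apply: derivable1_dir.
  exact: (of_d H).
have d2 p v : flow_dom T C p -> is_derive p (0, v) Phi ('D_v (phi p.1) p.2).
  case: p => t c [/= tT Cc]; apply: is_derive_snd; apply: DeriveDef => //=.
  by have [+ _] := tangent_family v H; apply.
have diffPhi p : flow_dom T C p -> differentiable Phi p.
  move=> Dp; have nD := open_nbhs_nbhs (conj Do Dp).
  apply: partial_differentiable.
    apply: filterS nD => q Dq m; case: (prod_basis m) => -[a ->].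
      by have [] := d1 q a Dq.
    by have [] := d2 q a Dq.
  move=> m; case: (prod_basis m) => -[a ->].
    apply: (near_eq_continuous (f := fun q => a *: X (Phi q))).
      by apply: filterS nD => q Dq; have [_ ->] := d1 q a Dq.
    have := Cn_cont (Cn_comp_lin (l := *:%R a) Do (@scaler_continuous _ _ a) XC) Dp.
    exact.
  apply: (near_eq_continuous (f := fun q => 'D_a (phi q.1) q.2)).
    by apply: filterS nD => q Dq; have [_ ->] := d2 q a Dq.
  exact: (Cn_cont (psiC a) Dp).
split=> // -[a v].
apply: (@Cn_ext _ _ _ n _ (fun p => a *: X (Phi p) + 'D_v (phi p.1) p.2)) => //; last first.
  apply: CnD => //.
  exact: (Cn_comp_lin (l := *:%R a) Do (@scaler_continuous _ _ a) XC).
move=> p Dp; have -> : (a, v) = (a, 0) + (0, v) by apply: injective_projections; rewrite /= ?addr0 ?add0r.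
rewrite deriveDv; last exact: diffPhi.
by have [_ ->] := d1 p a Dp; have [_ ->] := d2 p v Dp.
Qed.

End FamilySmooth.

(** * Existence of solutions by Picard iteration *)

Section Picard.
Context {R : realType}.

Lemma mvt_vec N (z dz : R -> 'rV[R]_N) (T B : R) : 0 <= B ->
  (forall t : R, `|t| < T -> is_derive t 1 z (dz t) /\ `|dz t| <= B) ->
  forall t : R, `|t| < T -> `|z t - z 0| <= B * `|t|.
Proof.
move=> B0 H t tT; apply: mx_norm_le; first by rewrite mulr_ge0.
move=> i m; rewrite ord1 !mxE.
have Hd (s : R) : `|s| <= `|t| -> is_derive s 1 (fun u => z u 0 m) (dz s 0 m).
  by move=> st; apply: is_derive_coord; have [] := H s (le_lt_trans st tT).
have Hd' (s : R) : `|s| <= `|t| -> derivable (fun u => z u 0 m) (0 + s *: 1) 1.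
  by move=> st; rewrite add0r [s *: 1]mulr1; have [] := Hd s st.
have [s st] := mvt_line Hd'; rewrite !add0r ![_ *: 1]mulr1 => ->.
have [_ ->] := Hd s st; rewrite normrM mulrC ler_wpM2r//.
by rewrite (le_trans (mx_norm_coord _ _ _))//; have [] := H s (le_lt_trans st tT).
Qed.

Lemma antiderivative_itv (g : R -> R) (A : R) : 0 < A -> continuous g ->
  exists G : R -> R, G 0 = 0 /\ forall t : R, `|t| < A -> is_derive t 1 G (g t).
Proof.
move=> A0 gc.
(* Integrating from [- A] makes the fundamental theorem applicable at every point of ]-A, A[, on
   both sides of 0. *)
pose F (x : R) := (\int[lebesgue_measure]_(t in [set` Interval (BLeft (- A)) (BRight x)]) g t)%R.
have Fd (t : R) : `|t| < A -> is_derive t 1 F (g t).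
  move=> /ltr_normlP[t1 t2].
  have [|||d1 d2] := @continuous_FTC1 R g (BLeft (- A)) t A t2.
  - apply: continuous_compact_integrable; first exact: segment_compact.
    by apply: continuous_subspaceT => x; exact: gc.
  - by rewrite /= lte_fin ltrNl.
  - exact: gc.
  split; first exact: d1.
  by rewrite -derive1E; exact: d2.
exists (fun t => F t - F 0); split; first by rewrite subrr.
move=> t /Fd d; rewrite -[g t]subr0; apply: is_deriveB.
Qed.

(** Antiderivatives on growing intervals, normalised at 0, agree where both are defined; evaluating
    the one attached to radius |t| + 1 at [t] glues them. *)
Lemma antiderivative (g : R -> R) : continuous g ->
  exists G : R -> R, G 0 = 0 /\ forall t : R, is_derive t 1 G (g t).
Proof.
move=> gc.
have [F HF] : exists F : R -> R -> R, forall t, F t 0 = 0 /\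
    forall s : R, `|s| < `|t| + 1 -> is_derive s 1 (F t) (g s).
  apply: (@fin_choice _ _ (fun t F => F 0 = 0 /\ forall s : R, `|s| < `|t| + 1 -> is_derive s 1 F (g s))) => t.
  by apply: antiderivative_itv => //; rewrite ltr_wpDl.
have Feq (t t' : R) (s : R) : `|s| < `|t| + 1 -> `|s| < `|t'| + 1 -> F t s = F t' s.
  move=> st st'; have [F0 F1] := HF t; have [F0' F1'] := HF t'.
  have Hd (u : R) : `|u| <= `|s| -> is_derive u 1 (fun v => F t v - F t' v) 0.
    move=> us; rewrite -(subrr (g u)); apply: is_deriveB.
      by apply: F1; exact: le_lt_trans st.
    by apply: F1'; exact: le_lt_trans st'.
  have Hd' (u : R) : `|u| <= `|s| -> derivable (fun v => F t v - F t' v) (0 + u *: 1) 1.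
    by move=> us; rewrite add0r [u *: 1]mulr1; have [] := Hd u us.
  have [u us] := mvt_line Hd'; rewrite !add0r ![_ *: 1]mulr1 F0 F0'.
  have [_ ->] := Hd u us; rewrite subrr subr0 mulr0 => /eqP; rewrite subr_eq0.
  by move=> /eqP.
exists (fun t => F t t); split; first by have [] := HF 0.
move=> t; pose t1 := `|t| + 1.
have tt1 : `|t| + 1 < `|t1| + 1.
  by rewrite (@le_lt_trans _ _ `|t1|) ?ltrDl//; exact: ler_norm.
apply: (near_eq_is_derive (f := F t1)).
  have : \forall s \near t, `|s| < `|t| + 1 by apply: near_norm_lt; rewrite ltrDl.
  apply: filterS => s st; apply: Feq; last by rewrite ltrDl.
  exact: lt_trans st tt1.
have [_] := HF t1; apply; apply: lt_trans tt1.
by rewrite ltrDl.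
Qed.

Lemma antiderivative_rV N (g : R -> 'rV[R]_N) : continuous g ->
  exists G : R -> 'rV[R]_N, G 0 = 0 /\ forall t : R, is_derive t 1 G (g t).
Proof.
move=> gc.
have [F HF] : exists F : 'I_N -> R -> R, forall l, F l 0 = 0 /\
    forall s : R, is_derive s 1 (F l) (g s 0 l).
  apply: (@fin_choice _ _ (fun l F => F 0 = 0 /\ forall s : R, is_derive s 1 F (g s 0 l))) => l.
  apply: antiderivative => s; apply: (@continuous_comp _ _ _ g (fun M : 'rV[R]_N => M 0 l)); first exact: gc.
  exact: coord_continuous.
exists (fun t => \row_l F l t); split.
  by apply/rowP => l; rewrite !mxE; have [] := HF l.
move=> t; apply: is_derive_coordP => l; under eq_fun do rewrite mxE.
by have [] := HF l.
Qed.

Definition clampr (a rho x : R) := Num.max (a - rho) (Num.min x (a + rho)).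

Lemma clampr_in a rho x : 0 <= rho -> `|clampr a rho x - a| <= rho.
Proof.
move=> r0; rewrite /clampr ler_norml; apply/andP; split.
  by rewrite lerBrDr le_max; apply/orP; left; lra.
rewrite lerBlDr ge_max; apply/andP; split; first lra.
by rewrite ge_min addrC lexx orbT.
Qed.

Lemma clampr_id a rho x : `|x - a| <= rho -> clampr a rho x = x.
Proof.
rewrite ler_norml /clampr => /andP[h1 h2].
by rewrite min_l; [rewrite max_r//|]; lra.
Qed.

Lemma clampr_lip a rho x y : `|clampr a rho x - clampr a rho y| <= `|x - y|.
Proof.
wlog xy : x y / y <= x.
  move=> H; have [xy|/ltW xy] := leP y x; first exact: H.
  by rewrite distrC (distrC x); exact: H.
rewrite [leRHS]ger0_norm ?subr_ge0// /clampr.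
case: (leP x (a + rho)) => h1; case: (leP y (a + rho)) => h2;
 case: (leP (a - rho) x) => h3; case: (leP (a - rho) y) => h4;
 case: (leP (a - rho) (a + rho)) => h5;
 rewrite ler_norml; apply/andP; split; lra.
Qed.

(** For rho >= 0, the nonexpansive retraction onto the closed ball of the maximum norm. Composing
    with it makes a field that is Lipschitz on the ball Lipschitz everywhere. *)
Definition clamp N (a : 'rV[R]_N) (rho : R) (x : 'rV[R]_N) : 'rV[R]_N :=
  \row_l clampr (a 0 l) rho (x 0 l).

Lemma geo_small (D e : R) : 0 <= D -> 0 < e -> exists n : nat, D / 2 ^+ n <= e.
Proof.
move=> D0 e0; have De : 0 <= D / e by rewrite divr_ge0// ltW.
have := archi_boundP De; set n := Num.bound _ => Hn.
exists n; rewrite ler_pdivrMr ?exprn_gt0// -ler_pdivrMl// mulrC.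
rewrite (le_trans (ltW Hn))// -natrX ler_nat ltnW//; exact: ltn_expl.
Qed.

Lemma lip_continuous (V W : normedModType R) (f : V -> W) (L : R) : 0 <= L ->
  (forall y y', `|f y' - f y| <= L * `|y' - y|) -> continuous f.
Proof.
move=> L0 HL y; apply/cvgrPdist_le => e e0.
have d0 : 0 < e / (L + 1) by rewrite divr_gt0// ltr_wpDl.
apply/nbhs_normP; exists (e / (L + 1)) => //= z /ltW yz.
rewrite (le_trans (HL _ _))//.
apply: (@le_trans _ _ ((L + 1) * (e / (L + 1)))).
  by apply: ler_pM => //; rewrite lerDl.
by rewrite mulrC divfK// gt_eqF// ltr_wpDl.
Qed.

(** With L T <= 1/2 the distances of successive iterates halve, so the iterates converge uniformly
    on ]-T, T[, and [lim_derive] carries the differential equation to the limit. *)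
Lemma picard N (X : 'rV[R]_N -> 'rV[R]_N) (c : 'rV[R]_N) (L T : R) :
  0 < T -> 0 <= L -> L * T <= 2^-1 ->
  (forall y y', `|X y' - X y| <= L * `|y' - y|) ->
  exists y : R -> 'rV[R]_N, y 0 = c /\
    forall t : R, `|t| < T -> is_derive t 1 y (X (y t)).
Proof.
move=> T0 L0 LT HL.
have Xc : continuous X by exact: lip_continuous L0 HL.
have [anti Hanti] : exists A : {g : R -> 'rV[R]_N | continuous g} -> R -> 'rV[R]_N,
   forall g, A g 0 = 0 /\ forall t : R, is_derive t 1 (A g) (sval g t).
  apply: (@fin_choice _ _ (fun (g : {g : R -> 'rV[R]_N | continuous g}) A => A 0 = 0 /\ forall t : R, is_derive t 1 A (sval g t))).
  by move=> [g gc]; exact: antiderivative_rV.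
have stepc (g : {g : R -> 'rV[R]_N | continuous g}) :
    continuous (X \o sval g).
  move=> t; apply: continuous_comp; last exact: Xc.
  exact: (svalP g t).
have nextc (g : {g : R -> 'rV[R]_N | continuous g}) :
    continuous (fun t => c + anti (exist _ _ (stepc g)) t).
  move=> t; apply: cvgD; first exact: cvg_cst.
  have [_ /(_ t) [d _]] := Hanti (exist _ _ (stepc g)).
  by apply: differentiable_continuous; exact/derivable1_diffP.
have cc : continuous (fun _ : R => c) by move=> t; exact: cvg_cst.
(* The iterates carry their continuity with them, since the antiderivative is available for
   continuous integrands. *)
pose u := fix u n : {g : R -> 'rV[R]_N | continuous g} :=
  if n is n'.+1 then exist _ _ (nextc (u n')) else exist _ _ cc.
pose y n := sval (u n).
have y0 n : y n 0 = c.
  case: n => [//|n] /=; rewrite /y /=.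
  by have [-> _] := Hanti (exist _ _ (stepc (u n))); rewrite addr0.
have yd n (t : R) : is_derive t 1 (y n.+1) (X (y n t)).
  have [_ /(_ t) d] := Hanti (exist _ _ (stepc (u n))).
  have := @is_deriveD _ _ _ (cst c) _ t 1 _ _ (is_derive_cst _ _ _) d.
  by rewrite add0r.
have yc n : continuous (y n) by exact: svalP (u n).
pose D := `|X c| * T.
have D0 : 0 <= D by rewrite mulr_ge0// ltW.
have ystep n (t : R) : `|t| < T -> `|y n.+1 t - y n t| <= D / 2 ^+ n.
  elim: n t => [|n IHn] t tT.
    rewrite expr0 divr1.
    have := @mvt_vec N (y 1%N) (fun _ => X c) T `|X c| (normr_ge0 _) _ t tT.
    rewrite y0 => /(_ (fun s sT => conj (yd 0%N s) (lexx _))) h.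
    by apply: (le_trans h); rewrite ler_wpM2l// ltW.
  have B0 : 0 <= L * (D / 2 ^+ n) by rewrite mulr_ge0// divr_ge0// exprn_ge0.
  have Hz (s : R) : `|s| < T ->
      is_derive s 1 (fun t => y n.+2 t - y n.+1 t) (X (y n.+1 s) - X (y n s)) /\
      `|X (y n.+1 s) - X (y n s)| <= L * (D / 2 ^+ n).
    move=> sT; split; first by apply: is_deriveB; exact: yd.
    by rewrite (le_trans (HL _ _))// ler_wpM2l//; exact: IHn.
  have := mvt_vec B0 Hz tT; rewrite !y0 subrr subr0 => h.
  apply: (le_trans h).
  apply: (@le_trans _ _ (L * (D / 2 ^+ n) * T)); first by rewrite ler_wpM2l// ltW.
  rewrite mulrAC (le_trans (ler_wpM2r _ LT))//.
    by rewrite divr_ge0// exprn_ge0.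
  by rewrite exprS invfM mulrCA.
(* The geometric series in telescoped form, which is what makes the induction on [m] close. *)
have ydist n m (t : R) : `|t| < T -> `|y (n + m)%N t - y n t| <= 2 * D / 2 ^+ n - 2 * D / 2 ^+ (n + m).
  move=> tT; elim: m => [|m IHm]; first by rewrite addn0 !subrr normr0.
  rewrite -(subrKA (y (n + m)%N t)) (le_trans (ler_normD _ _))//.
  rewrite addnS; have h := ystep (n + m)%N t tT.
  apply: (le_trans (lerD h IHm)); rewrite exprS.
  have p0 : (2 : R) ^+ (n + m) != 0 by rewrite expf_neq0.
  have p1 : (2 : R) ^+ n != 0 by rewrite expf_neq0.
  rewrite le_eqVlt; apply/orP; left; apply/eqP; field.
  by rewrite p0 p1.
have D20 : 0 <= 2 * D by rewrite mulr_ge0.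
have ydist' n m (t : R) : `|t| < T -> (n <= m)%N -> `|y m t - y n t| <= 2 * D / 2 ^+ n.
  move=> tT nm; rewrite -(subnKC nm); apply: (le_trans (ydist _ _ _ tT)).
  rewrite gerBl; apply: divr_ge0; [exact: D20|exact: exprn_ge0].
have ycvg (t : R) : `|t| < T -> cvg ((fun n => y n t) @ \oo).
  move=> tT; apply: cauchy_cvg; apply/cauchyP => e e0.
  have e20 : 0 < e / 2 by rewrite divr_gt0.
  have [n Hn] := geo_small D20 e20.
  exists (y n t); exists n => // m /= nm.
  rewrite -ball_normE /ball_ /= distrC (le_lt_trans (ydist' _ _ _ tT nm))//.
  by rewrite (le_lt_trans Hn)// ltr_pdivrMr// ltr_pMr// ltr1n.
pose yl t := lim ((fun n => y n t) @ \oo).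
have yldist n (t : R) : `|t| < T -> `|yl t - y n t| <= 2 * D / 2 ^+ n.
  move=> tT; apply/ler_addgt0Pr => e e0.
  have /cvgrPdist_le /(_ e e0) [m _ Hm] := ycvg t tT.
  have := Hm (maxn m n) (leq_maxl _ _) => /= h.
  have h2 := ydist' n (maxn m n) t tT (leq_maxr _ _).
  rewrite -(subrKA (y (maxn m n) t)) (le_trans (ler_normD _ _))// addrC lerD//.
have ylc (t : R) : `|t| < T -> {for t, continuous yl}.
  move=> tT; apply/cvgrPdist_le => e e0.
  have e40 : 0 < e / 4 by rewrite divr_gt0.
  have [n Hn] := geo_small D20 e40.
  have /cvgrPdist_le /(_ _ e40) ny := yc n t.
  apply: filterS2 ny (near_norm_lt tT) => s ys sT.
  apply: (dist_le_quarter (a := y n t) (b := y n s)) => //.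
    by rewrite distrC (le_trans (yldist n t tT)).
  by rewrite distrC (le_trans (yldist n s sT)).
exists yl; split.
  rewrite /yl (_ : (fun n => y n 0) = cst c); last by apply/funext => n; rewrite y0.
  exact: lim_cst.
move=> t tT.
apply: (@lim_derive _ N yl (X \o yl) t T tT).
  by apply: continuous_comp; [exact: ylc|exact: Xc].
move=> e e0.
have D4 : 0 <= (L + 1) * (2 * D) by rewrite mulr_ge0// addr_ge0.
have [n Hn] := geo_small D4 e0.
exists (y n.+1), (fun s => X (y n s)) => s sT; split; first exact: yd.
  rewrite distrC (le_trans (yldist _ _ sT))//; apply: le_trans Hn.
  have Dn : 0 <= 2 * D / 2 ^+ n by apply: divr_ge0; [exact: D20|exact: exprn_ge0].
  apply: (@le_trans _ _ (2 * D / 2 ^+ n)).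
    rewrite exprS invfM mulrCA; apply: ler_piMl => //.
    by rewrite invf_le1// ler1n.
  by rewrite -[leRHS]mulrA; apply: ler_peMl => //; rewrite lerDr.
rewrite /= distrC (le_trans (HL _ _))//.
apply: (@le_trans _ _ (L * (2 * D / 2 ^+ n))); first by rewrite ler_wpM2l//; exact: yldist.
apply: le_trans Hn; rewrite -[leRHS]mulrA; apply: ler_wpM2r; last by rewrite lerDl.
by apply: divr_ge0; [exact: D20|exact: exprn_ge0].
Qed.

End Picard.

(** * Smooth local flows of vector fields *)

Section Flow.
Context {R : realType}.

Lemma ode_unique N (K : set 'rV[R]_N) (X : 'rV[R]_N -> 'rV[R]_N) (z1 z2 : R -> 'rV[R]_N) (T : R) :
  compact K -> cvx K -> (forall y, K y -> sm X y) ->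
  (forall t : R, `|t| < T -> [/\ K (z1 t), K (z2 t), is_derive t 1 z1 (X (z1 t)) &
     is_derive t 1 z2 (X (z2 t))]) ->
  z1 0 = z2 0 -> forall t : R, `|t| < T -> z1 t = z2 t.
Proof.
move=> Kc Kv Xs H z0 t tT.
have [L L0 HL] := C1_lipv Kc Kv Xs.
have Hz (s : R) : `|s| < T -> is_derive s 1 (fun t => z1 t - z2 t) (X (z1 s) - X (z2 s)) /\
    `|X (z1 s) - X (z2 s)| <= L * `|z1 s - z2 s| + 0.
  by move=> /H[k1 k2 d1 d2]; split; [exact: is_deriveB|rewrite addr0; exact: HL].
have := gronwall L0 (lexx 0) Hz tT.
rewrite z0 subrr normr0 !expr0n /= mulr0 add0r mul0r => h.
have /eqP : `|z1 t - z2 t| ^+ 2 == 0 by rewrite eq_le h sqr_ge0.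
by move/eqP; rewrite sqrf_eq0 normr_eq0 subr_eq0 => /eqP.
Qed.

Lemma compact_closed_ball N (y1 : 'rV[R]_N) (rho : R) :
  compact [set y : 'rV[R]_N | `|y - y1| <= rho].
Proof.
apply: bounded_closed_compact.
  exists (rho + `|y1|); split; first exact: num_real.
  move=> M BM w /= wB; rewrite (le_trans _ (ltW BM))//.
  by rewrite -[w](subrK y1) (le_trans (ler_normD _ _))// lerD2r.
rewrite (_ : [set w | _] = (fun w : 'rV[R]_N => `|w - y1|) @^-1` [set x | x <= rho])//.
apply: closed_comp => [w _|]; last exact: closed_le.
have sc : sm (fun w : 'rV[R]_N => w - y1) w.
  by apply: smB; [exact: sm_id|exact: sm_cst].
apply: (@continuous_comp _ _ _ (fun w : 'rV[R]_N => w - y1) (fun w => `|w|)).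
  exact: sm_cont sc.
exact: norm_continuous.
Qed.

Lemma open_ball_norm (V : normedModType R) (y1 : V) (d : R) : open (ball_ Num.norm y1 d).
Proof.
rewrite openE => y yr; apply/nbhs_normP; rewrite /ball_ /= in yr.
exists (d - `|y1 - y|); first by rewrite /= subr_gt0.
move=> z /= yz; rewrite /ball_ /= -(subrKA y) (le_lt_trans (ler_normD _ _))//.
by rewrite -ltrBrDl.
Qed.

(** Picard iteration solves the equation of the clamped field for every initial value. Trajectories
    starting in the half-sized ball do not leave the large one for short times, and there the
    clamping has no effect. *)
Lemma flow_family N (X : 'rV[R]_N -> 'rV[R]_N) (y1 : 'rV[R]_N) : sm X y1 ->
  exists (K : set 'rV[R]_N) (T d : R) (phi : R -> 'rV[R]_N -> 'rV[R]_N), 0 < d /\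
    ode_family K X T (ball_ Num.norm y1 d) id 0 phi.
Proof.
move=> /sm_near /nbhs_normP[r /= r0 Hr].
pose rho := r / 2.
have rho0 : 0 < rho by rewrite divr_gt0.
have rhor : rho < r by rewrite ltr_pdivrMr// ltr_pMr// ltr1n.
pose K := [set y : 'rV[R]_N | `|y - y1| <= rho].
have Kc : compact K by exact: compact_closed_ball.
have Kv : cvx K.
  move=> y y' t; rewrite /K /= => Ky Ky' /andP[t0 t1].
  have -> : y + t *: (y' - y) - y1 = (1 - t) *: (y - y1) + t *: (y' - y1).
    by apply/rowP => j; rewrite !mxE; ring.
  have t1' : 0 <= 1 - t by rewrite subr_ge0.
  rewrite (le_trans (ler_normD _ _))// !normrZ (ger0_norm t0) (ger0_norm t1').
  have h1 := ler_wpM2l t1' Ky; have h2 := ler_wpM2l t0 Ky'.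
  by apply: (le_trans (lerD h1 h2)); rewrite -mulrDl subrK mul1r.
have Ks y : K y -> sm X y.
  by move=> Ky; apply: Hr; rewrite /ball_ /= distrC (le_lt_trans Ky).
have [L L0 HL] := C1_lipv Kc Kv Ks.
have nc y : K y -> {for y, continuous (fun y => `|X y|)}.
  move=> Ky; apply: (@continuous_comp _ _ _ X); first exact: sm_cont (Ks _ Ky).
  exact: norm_continuous.
have [M M0 HM'] := compact_cont_bounded Kc nc.
have HM y : K y -> `|X y| <= M by move=> /HM'; rewrite normr_id.
pose cl := clamp y1 rho.
have clK y : K (cl y).
  apply: mx_norm_le; first exact: ltW.
  by move=> i j; rewrite ord1 !mxE; apply: clampr_in; exact: ltW.
have clid y : K y -> cl y = y.
  move=> Ky; apply/rowP => j; rewrite mxE; apply: clampr_id.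
  by apply: le_trans Ky; apply: le_trans (mx_norm_coord _ 0 j); rewrite !mxE.
have cllip y y' : `|cl y' - cl y| <= `|y' - y|.
  apply: mx_norm_le => // i j; rewrite ord1 !mxE (le_trans (clampr_lip _ _ _ _))//.
  by apply: le_trans (mx_norm_coord _ 0 j); rewrite !mxE.
have L1 : 0 < L + 1 by rewrite ltr_wpDl.
have M1 : 0 < M + 1 by rewrite ltr_wpDl.
(* The first bound makes Picard iteration contract; the second, with speed at most [M], confines
   trajectories from radius rho / 2 to radius rho. *)
pose T := Num.min (2^-1 / (L + 1)) (rho / 2 / (M + 1)).
have T0 : 0 < T by rewrite lt_min !divr_gt0// invr_gt0.
have LT : L * T <= 2^-1.
  apply: (@le_trans _ _ ((L + 1) * T)).
    by apply: ler_wpM2r; [exact: ltW|rewrite lerDl].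
  by rewrite mulrC -ler_pdivlMr// ge_min lexx.
have MT : M * T <= rho / 2.
  apply: (@le_trans _ _ ((M + 1) * T)).
    by apply: ler_wpM2r; [exact: ltW|rewrite lerDl].
  by rewrite mulrC -ler_pdivlMr// ge_min lexx orbT.
have [phi Hphi] : exists phi : 'rV[R]_N -> R -> 'rV[R]_N, forall c, phi c 0 = c /\
    forall t : R, `|t| < T -> is_derive t 1 (phi c) (X (cl (phi c t))).
  apply: (@fin_choice _ _ (fun c y => y 0 = c /\
    forall t : R, `|t| < T -> is_derive t 1 y (X (cl (y t))))) => c.
  apply: (@picard R N (X \o cl) c L T) => // y y' /=.
  by rewrite (le_trans (HL _ _ _ _))// ler_wpM2l.
have inK c (t : R) : ball_ Num.norm y1 (rho / 2) c -> `|t| < T -> K (phi c t).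
  move=> Cc tT; have [p0 pd] := Hphi c.
  have := mvt_vec M0 (fun s sT => conj (pd s sT) (HM _ (clK _))) tT.
  rewrite p0 => h; rewrite /K /= -(subrKA c) (le_trans (ler_normD _ _))//.
  rewrite [leRHS](splitr rho) lerD//; last by rewrite distrC ltW.
  by rewrite (le_trans h)// (le_trans _ MT)// ler_wpM2l// ltW.
exists K, T, (rho / 2), (fun t c => phi c t); split; first by rewrite divr_gt0.
split=> //.
- exact: open_ball_norm.
- by exists 1 => // c; rewrite mul1r.
- by move=> c _; have [-> _] := Hphi c; rewrite addr0.
- move=> c t Cc tT; have [_ /(_ t tT)] := Hphi c.
  by rewrite (clid _ (inK c t Cc tT)).
Qed.

(** The last clause is the part of the group law used below: running backwards undoes running
    forwards. *)
Definition local_flow (W : normedModType R) (X : W -> W) (w1 : W) (phi : R -> W -> W) :=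
  \forall p \near (0 : R, w1),
   [/\ sm (fun p : R * W => phi p.1 p.2) p,
       is_derive p.1 1 (fun t => phi t p.2) (X (phi p.1 p.2)),
       phi 0 p.2 = p.2 & phi (- p.1) (phi p.1 p.2) = p.2].

Lemma near_box (W : normedModType R) (w1 : W) (A : set (R * W)) :
  (\forall p \near (0 : R, w1), A p) <->
  exists2 e : R, 0 < e & forall t w, `|t| < e -> `|w - w1| < e -> A (t, w).
Proof.
split=> [/nbhs_normP[e /= e0 He]|[e e0 He]].
  exists e => // t w te we; apply: He.
  by rewrite /ball_ /= prod_normE /= gt_max sub0r normrN te distrC.
apply/nbhs_normP; exists e => //= -[t w] /=; rewrite /ball_ /=.
rewrite prod_normE /= gt_max sub0r normrN distrC => /andP[te we].
exact: He.
Qed.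

(** Smoothness comes from [family_smooth]. The inversion clause comes from uniqueness: phi(s + t) c
    and phi s (phi t c) solve the same equation in [s] with the same value at 0. Times are halved so
    that s + t stays admissible. *)
Lemma flow_rV N (X : 'rV[R]_N -> 'rV[R]_N) (y1 : 'rV[R]_N) : sm X y1 ->
  exists phi : R -> 'rV[R]_N -> 'rV[R]_N, local_flow X y1 phi.
Proof.
move=> /flow_family[K [T [d [phi [d0 H]]]]]; exists phi.
have T0 := of_T H.
have Do : open (flow_dom T (ball_ Num.norm y1 d)) by apply: flow_dom_open; exact: (of_C H).
have D1 : flow_dom T (ball_ Num.norm y1 d) (0, y1).
  by split; rewrite /= ?normr0// /ball_ /= subrr normr0.
have phi0 c : ball_ Num.norm y1 d c -> phi 0 c = c by move=> Cc; rewrite (of_0 H Cc) addr0.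
have sphi p : flow_dom T (ball_ Num.norm y1 d) p -> sm (fun p => phi p.1 p.2) p.
  by move=> Dp; exists (flow_dom T (ball_ Num.norm y1 d)); split=> // n; exact: family_smooth H.
have Cy1 : ball_ Num.norm y1 d y1 by case: D1.
have c1 := sm_cont (sphi _ D1); rewrite /prop_for /continuous_at /= (phi0 _ Cy1) in c1.
have T20 : 0 < T / 2 by rewrite divr_gt0.
have [e e0 He] := (@near_box _ y1 [set p | ball_ Num.norm y1 d (phi p.1 p.2)]).1
  (c1 _ (open_nbhs_nbhs (conj (@open_ball_norm _ y1 d) Cy1))).
apply/near_box; exists (Num.min e (Num.min d (T / 2))); first by rewrite !lt_min e0 d0.
move=> t c; rewrite !lt_min => /andP[te /andP[td tT2]] /andP[ce /andP[cd cT2]].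
have pb : ball_ Num.norm y1 d (phi t c) by exact: He.
have Cc : ball_ Num.norm y1 d c by rewrite /ball_ /= distrC.
have tT : `|t| < T by rewrite (lt_trans tT2)// ltr_pdivrMr// ltr_pMr// ltr1n.
have Dp : flow_dom T (ball_ Num.norm y1 d) (t, c) by [].
split.
- exact: sphi.
- exact: (of_d H).
- exact: phi0.
have T2T : T / 2 < T by rewrite ltr_pdivrMr// ltr_pMr// ltr1n.
have E (s : R) : `|s| < T / 2 -> phi (s + t) c = phi s (phi t c).
  apply: (@ode_unique N K X (fun s => phi (s + t) c) (fun s => phi s (phi t c)) (T / 2)
    (of_K H) (of_cvx H) (of_X H)); last first.
    by rewrite /= add0r phi0.
  move=> u uT; have utT : `|u + t| < T.
    by rewrite (le_lt_trans (ler_normD _ _))// (splitr T) ltrD.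
  have uT' : `|u| < T by exact: lt_trans T2T.
  split; [exact: (of_in H)|exact: (of_in H)| |exact: (of_d H)].
  have /= := @is_derive_line R R _ (fun s => phi s c) t 1 u.
  rewrite [u *: 1]mulr1 (addrC t) => h.
  have [dd1 dd2] := of_d H Cc utT.
  have := h dd1; rewrite dd2; congr is_derive.
  by apply/funext => s'; rewrite [s' *: 1]mulr1 addrC.
have := E (- t); rewrite normrN => <-//.
by rewrite addNr phi0.
Qed.

Theorem flow (W : normedModType R) (fW : fdim W) (X : W -> W) (w1 : W) : sm X w1 ->
  exists phi : R -> W -> W, local_flow X w1 phi.
Proof.
move=> Xw.
have sg y : sm (@fd_g _ _ fW) y by apply: sm_lin; exact: fd_gc.
have sf w : sm (@fd_f _ _ fW) w by apply: sm_lin; exact: fd_fc.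
have sX : sm (fun y => fd_f (X (fd_g y))) (fd_f w1).
  have s1 : sm (fun y => X (fd_g y)) (fd_f w1).
    by apply: (@sm_comp _ _ _ _ _ _ _ X _ (sg _)); rewrite fd_fK.
  exact: (@sm_comp _ _ _ _ _ _ _ _ _ s1 (sf _)).
have [phi Hphi] := flow_rV sX.
exists (fun t w => fd_g (phi t (fd_f w))).
pose m (p : R * W) := (p.1, @fd_f _ _ fW p.2).
have sm_m p : sm m p.
  apply: sm_pair; first exact: sm_fst.
  by apply: (@sm_comp _ _ _ _ _ _ _ _ _ (sm_snd p)).
have nm := (sm_cont (sm_m (0, w1))) _ Hphi.
have [e e0 He] := (@near_box _ w1 _).1 nm.
apply/near_box; exists e => // t w te we; have [/= h1 h2 h3 h4] := He t w te we; split => /=.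
- have s2 : sm (fun p : R * W => phi p.1 (@fd_f _ _ fW p.2)) (t, w).
    exact: (@sm_comp _ _ _ _ _ _ m (fun p => phi p.1 p.2) _ (sm_m (t, w)) h1).
  exact: (@sm_comp _ _ _ _ _ _ _ (@fd_g _ _ fW) _ s2 (sg _)).
- have [d1 d2] := h2.
  have pd : differentiable (fun t => phi t (fd_f w)) t by exact/derivable1_diffP.
  have gd : differentiable (@fd_g _ _ fW) (phi t (fd_f w)) by exact: sm_diff (sg _).
  have c1 := differentiable_comp pd gd.
  split; first exact: diff_derivable.
  rewrite (@derive_comp _ _ _ _ (fun t => phi t (fd_f w)) fd_g)// d2.
  by rewrite derive_lin ?fd_fK//; exact: fd_gc.
- by rewrite h3 fd_fK.
- by rewrite fd_gK h4 fd_fK.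
Qed.

End Flow.

(** * The implicit function theorem by flows *)

Section IFT.
Context {R : realType}.

Lemma is_derive_curve (W X : normedModType R) (z : R -> W) (g : W -> X) (t : R) (dz : W) :
  is_derive t 1 z dz -> differentiable g (z t) ->
  is_derive t 1 (fun s => g (z s)) ('D_dz g (z t)).
Proof.
move=> [d1 d2] gd; have zd : differentiable z t by exact/derivable1_diffP.
split; first by apply: diff_derivable; exact: differentiable_comp.
by rewrite derive_comp// d2.
Qed.

Lemma curve_const (W : normedModType R) (fW : fdim W) (z : R -> W) (T : R) :
  (forall t : R, `|t| < T -> is_derive t 1 z 0) -> forall t : R, `|t| < T -> z t = z 0.
Proof.
move=> H t tT; rewrite (fd_decomp (z t)) (fd_decomp (z 0)); apply: eq_bigr => l _.
congr (_ *: _).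
have Hd (s : R) : `|s| <= `|t| -> is_derive s 1 (fun u => @fd_co _ _ fW l (z u)) 0.
  move=> st; have zs := H s (le_lt_trans st tT).
  have gd : differentiable (@fd_co _ _ fW l) (z s).
    by apply: linear_differentiable; exact: fd_co_continuous.
  have := is_derive_curve zs gd; congr is_derive.
  by rewrite derive0.
have Hd' (s : R) : `|s| <= `|t| -> derivable (fun u => @fd_co _ _ fW l (z u)) (0 + s *: 1) 1.
  by move=> st; rewrite add0r [s *: 1]mulr1; have [] := Hd s st.
have [s st] := mvt_line Hd'; rewrite !add0r ![_ *: 1]mulr1.
have [_ ->] := Hd s st; rewrite mulr0 => /eqP; rewrite subr_eq0 => /eqP.
exact.
Qed.

Lemma is_derive_scale (W : normedModType R) (q : W) (t : R) : is_derive t 1 (fun s : R => s *: q) q.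
Proof.
have d : differentiable ( *:%R ^~ q : R -> W) t by [].
split; first exact: diff_derivable.
by rewrite deriveE// diff_val scale1r.
Qed.

Lemma curve_affine (W : normedModType R) (fW : fdim W) (z : R -> W) (q : W) (T : R) :
  (forall t : R, `|t| < T -> is_derive t 1 z q) ->
  forall t : R, `|t| < T -> z t = z 0 + t *: q.
Proof.
move=> H t tT.
have Hd (s : R) : `|s| < T -> is_derive s 1 (fun u => z u - u *: q) 0.
  move=> /H d; rewrite -(subrr q); apply: is_deriveB; exact: is_derive_scale.
have := curve_const fW Hd tT; rewrite scale0r subr0 => <-.
by rewrite subrK.
Qed.

Lemma near_box2 (Z W : normedModType R) (z0 : Z) (w0 : W) (A : set (Z * W)) :
  (\forall p \near (z0, w0), A p) <->
  exists2 e : R, 0 < e & forall z w, `|z - z0| < e -> `|w - w0| < e -> A (z, w).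
Proof.
split=> [/nbhs_normP[e /= e0 He]|[e e0 He]].
  exists e => // z w ze we; apply: He.
  by rewrite /ball_ /= prod_normE /= gt_max distrC ze distrC.
apply/nbhs_normP; exists e => //= -[z w] /=; rewrite /ball_ /=.
rewrite prod_normE /= gt_max distrC (distrC w0) => /andP[ze we].
exact: He.
Qed.

Lemma near_ball1 (Z : normedModType R) (z0 : Z) (A : set Z) :
  (\forall z \near z0, A z) <->
  exists2 e : R, 0 < e & forall z, `|z - z0| < e -> A z.
Proof.
split=> [/nbhs_normP[e /= e0 He]|[e e0 He]].
  by exists e => // z ze; apply: He; rewrite /ball_ /= distrC.
by apply/nbhs_normP; exists e => //= z; rewrite /ball_ /= distrC; exact: He.
Qed.

Section Implicit.
Variables (Z : normedModType R) (fZ : fdim Z) (F : Z * R -> R) (z0 : Z) (v0 : R).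
Hypotheses (Fs : sm F (z0, v0)) (F0 : F (z0, v0) = 0) (Fv : 'D_(0, 1) F (z0, v0) != 0).

(* Moving from z0 with velocity q, the solution v of F(z, v) = 0 obeys
   v' = - D_(q,0) F / D_(0,1) F, so its smoothness is that of a flow. *)
Let X (w : (Z * Z) * R) : (Z * Z) * R :=
  ((w.1.2, 0), - 'D_(w.1.2, 0) F (w.1.1, w.2) / 'D_(0, 1) F (w.1.1, w.2)).

Let pz (w : (Z * Z) * R) : Z * R := (w.1.1, w.2).

Let sm_pz w : sm pz w.
Proof.
have s1 : sm (fun w : (Z * Z) * R => w.1.1) w.
  by apply: (@sm_comp _ _ _ _ _ _ _ fst _ (sm_fst w)); exact: sm_fst.
by apply: sm_pair => //; exact: sm_snd.
Qed.

Let w0 : (Z * Z) * R := ((z0, 0), v0).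

Let sm_X : sm X w0.
Proof.
have sF : sm (fun w => F (pz w)) w0 by exact: (@sm_comp _ _ _ _ _ _ pz F _ (sm_pz w0)).
have s12 : sm (fun w : (Z * Z) * R => w.1.2) w0.
  by apply: (@sm_comp _ _ _ _ _ _ _ snd _ (sm_fst w0)); exact: sm_snd.
have sFv : sm (fun w => 'D_(0, 1) F (pz w)) w0.
  by apply: (@sm_comp _ _ _ _ _ _ pz (fun y => 'D_(0, 1) F y) _ (sm_pz w0)); exact: sm_derive.
have sFz : sm (fun w : (Z * Z) * R => 'D_(w.1.2, 0) F (pz w)) w0.
  have h : sm (fun w : (Z * Z) * R => 'D_((w.1.2, 0), 0) (fun w => F (pz w)) w) w0.
    apply: sm_dirD => //; apply: sm_pair; last exact: sm_cst.
    by apply: sm_pair => //; exact: sm_cst.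
  exact: h.
apply: sm_pair; first by apply: sm_pair => //; exact: sm_cst.
apply: smM; first exact: smN.
exact: smV.
Qed.

(** [F] is constant along the flow of [X], so flowing from (z0, v0) with the velocity that leads to
    [z] ends at a zero of [F] over [z], smoothly in [z]. Two zeros over the same [z] close to v0
    coincide by the mean value theorem in [v], since the partial derivative of [F] in [v] does not
    vanish there. *)
Theorem ift : exists phi : Z -> R, [/\ sm phi z0, phi z0 = v0,
  \forall z \near z0, F (z, phi z) = 0 &
  \forall p \near (z0, v0), F p = 0 -> p.2 = phi p.1].
Proof.
have [Phi HPhi] := flow _ sm_X.
have PhiC : {for (0 : R, w0), continuous (fun p : R * ((Z * Z) * R) => Phi p.1 p.2)}.
  by have /nbhs_singleton [h _ _ _] := HPhi; exact: sm_cont h.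
have Phi0 : Phi 0 w0 = w0 by have /nbhs_singleton [] := HPhi.
have nG : \forall p \near (z0, v0), sm F p /\ 'D_(0, 1) F p != 0.
  have c := sm_cont (sm_derive ((0, 1) : Z * R) Fs).
  have c0 : \forall p \near (z0, v0), 'D_(0, 1) F p != 0.
    by have /cvgr_neq0 := c; apply.
  exact: filterI (sm_near Fs) c0.
have nG2 : \forall p \near (0 : R, w0), sm F (pz (Phi p.1 p.2)) /\ 'D_(0, 1) F (pz (Phi p.1 p.2)) != 0.
  have nG3 : \forall w \near w0, sm F (pz w) /\ 'D_(0, 1) F (pz w) != 0.
    exact: ((sm_cont (sm_pz w0)) _ nG).
  by rewrite /prop_for /continuous_at /= Phi0 in PhiC; exact: (PhiC _ nG3).
have [e e0 He] := (@near_box _ _ w0 _).1 (filterI HPhi nG2).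
pose tau := e / 2.
have tau0 : 0 < tau by rewrite divr_gt0.
have taue : `|tau| < e by rewrite gtr0_norm// ltr_pdivrMr// ltr_pMr// ltr1n.
(* The time [tau] is fixed and the velocity depends on [z], so that the base point is exactly [z] at
   time [tau]; nearness of [z] to [z0] becomes smallness of the velocity. *)
pose iota (z : Z) : (Z * Z) * R := ((z0, tau^-1 *: (z - z0)), v0).
pose phi z := (Phi tau (iota z)).2.
have iota_e z : `|z - z0| < tau * e -> `|iota z - w0| < e.
  move=> ze; have -> : iota z - w0 = ((0, tau^-1 *: (z - z0)), 0).
    rewrite /iota /w0; apply: injective_projections => /=; last by rewrite subrr.
    by apply: injective_projections => /=; rewrite ?subrr ?subr0.
  rewrite !prod_normE /= !normr0 !gt_max e0 normrZ normfV (gtr0_norm tau0).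
  by rewrite ltr_pdivrMl// ze.
have traj w (t : R) : `|w - w0| < e -> `|t| < e ->
   [/\ (Phi t w).1.2 = w.1.2, (Phi t w).1.1 = w.1.1 + t *: w.1.2 &
       F (pz (Phi t w)) = F (pz w)].
  move=> we te.
  have Pw0 : Phi 0 w = w.
    by have [[_ _ /= h _] _] := He 0 w ltac:(by rewrite normr0) we.
  have Pd (s : R) : `|s| < e -> is_derive s 1 (fun u => Phi u w) (X (Phi s w)).
    by move=> se; have [[_ h _ _] _] := He s w se we.
  have P12 (s : R) : `|s| < e -> (Phi s w).1.2 = w.1.2.
    move=> se; rewrite -[in RHS]Pw0.
    apply: (@curve_const Z fZ (fun s => (Phi s w).1.2) e) => // u ue.
    have sg : sm (fun w : (Z * Z) * R => w.1.2) (Phi u w).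
      by apply: (@sm_comp _ _ _ _ _ _ _ snd _ (sm_fst _)); exact: sm_snd.
    have := is_derive_curve (Pd u ue) (sm_diff sg); congr is_derive.
    have lf : linear (fun w : Z * Z * R => w.1.2) by [].
    pose lM := GRing.isLinear.Build _ _ _ _ _ lf.
    pose L : {linear (Z * Z * R)%type -> Z} := HB.pack (fun w : Z * Z * R => w.1.2) lM.
    apply: (etrans (@derive_lin _ _ _ L _ _ _)) => // y.
    apply: sm_cont; apply: (@sm_comp _ _ _ _ _ _ _ snd _ (sm_fst y)); exact: sm_snd.
  split; first exact: P12.
    rewrite -[in X in X + _]Pw0.
    apply: (@curve_affine Z fZ (fun s => (Phi s w).1.1) _ e) => // u ue.
    have sg : sm (fun w : (Z * Z) * R => w.1.1) (Phi u w).
      by apply: (@sm_comp _ _ _ _ _ _ _ fst _ (sm_fst _)); exact: sm_fst.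
    have := is_derive_curve (Pd u ue) (sm_diff sg); congr is_derive.
    rewrite -(P12 u ue).
    have lf : linear (fun w : Z * Z * R => w.1.1) by [].
    pose lM := GRing.isLinear.Build _ _ _ _ _ lf.
    pose L : {linear (Z * Z * R)%type -> Z} := HB.pack (fun w : Z * Z * R => w.1.1) lM.
    apply: (etrans (@derive_lin _ _ _ L _ _ _)) => // y.
    apply: sm_cont; apply: (@sm_comp _ _ _ _ _ _ _ fst _ (sm_fst y)); exact: sm_fst.
  rewrite -[in RHS]Pw0.
  apply: (@curve_const R _ (fun s => F (pz (Phi s w))) e) => // u ue.
  have [_ [Fu Fvu]] := He u w ue we; rewrite /= in Fu Fvu.
  have lf : linear pz by [].
  pose lM := GRing.isLinear.Build _ _ _ _ _ lf.
  pose L : {linear (Z * Z * R)%type -> (Z * R)%type} := HB.pack pz lM.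
  have Lc : continuous L by move=> y; exact: sm_cont (sm_pz y).
  have d1 := is_derive_curve (Pd u ue) (sm_diff (sm_pz _)).
  have := is_derive_curve d1 (sm_diff Fu); congr is_derive.
  rewrite (@derive_lin _ _ _ L _ _ Lc).
  have -> : L (X (Phi u w)) = ((Phi u w).1.2, 0) + (X (Phi u w)).2 *: (0, 1).
    by apply: injective_projections => /=; rewrite ?scaler0 ?addr0 ?add0r ?[_ *: 1]mulr1.
  rewrite deriveDv; last exact: sm_diff Fu.
  rewrite deriveZv; last exact: sm_diff Fu.
  rewrite /X /= -/(pz (Phi u w)) /GRing.scale /= divfK//.
  by rewrite addrC addNr.
have iz0 : iota z0 = w0 by rewrite /iota subrr scaler0.
have siota : sm iota z0.
  apply: sm_pair; last exact: sm_cst.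
  apply: sm_pair; first exact: sm_cst.
  by apply: sm_scale; apply: smB; [exact: sm_id|exact: sm_cst].
have sphi : sm phi z0.
  have s1 : sm (fun z => (tau, iota z)) z0 by apply: sm_pair => //; exact: sm_cst.
  have s2 : sm (fun z => Phi tau (iota z)) z0.
    apply: (@sm_comp _ _ _ _ _ _ _ (fun p : R * ((Z * Z) * R) => Phi p.1 p.2) _ s1).
    by rewrite iz0; have [[] ] := He tau w0 taue ltac:(by rewrite subrr normr0).
  by apply: (@sm_comp _ _ _ _ _ _ _ snd _ s2); exact: sm_snd.
have phiF z : `|z - z0| < tau * e -> F (z, phi z) = 0.
  move=> ze; have [h1 h2 h3] := traj (iota z) tau (iota_e z ze) taue.
  rewrite -F0 -[RHS]h3; congr (F (_, _)); rewrite h2 /=.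
  by rewrite scalerA mulfV ?gt_eqF// scale1r addrC subrK.
have phiz0 : phi z0 = v0.
  rewrite /phi iz0.
  have w0e : `|w0 - w0| < e by rewrite subrr normr0.
  have Pd (s : R) : `|s| < e -> is_derive s 1 (fun u => Phi u w0) (X (Phi s w0)).
    by move=> se; have [[_ h _ _] _] := He s w0 se w0e.
  rewrite -[in RHS](_ : (Phi 0 w0).2 = v0); last by rewrite Phi0.
  apply: (@curve_const R _ (fun s => (Phi s w0).2) e) => // u ue.
  have := is_derive_curve (Pd u ue) (sm_diff (sm_snd _)); congr is_derive.
  have lf : linear_for *%R (fun w : Z * Z * R => w.2) by [].
  pose lM := GRing.isLinear.Build _ _ _ _ _ lf.
  pose L : {linear (Z * Z * R)%type -> R} := HB.pack (fun w : Z * Z * R => w.2) lM.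
  apply: (etrans (@derive_lin _ _ _ L _ _ _)) => [y|].
    by apply: sm_cont; exact: sm_snd.
  have [h1 _ _] := traj w0 u w0e ue.
  by rewrite /= h1 /= (_ : (0, 0) = 0 :> Z * R)// derive0 oppr0 mul0r.
exists phi; split=> //.
  by apply/near_ball1; exists (tau * e); [rewrite mulr_gt0|exact: phiF].
have [d d0 Hd] := (@near_box2 _ _ z0 v0 _).1 nG.
have phic : \forall z \near z0, `|phi z - v0| < d.
  have /cvgr_dist_lt /(_ d d0) := sm_cont sphi; rewrite phiz0.
  by apply: filterS => z; rewrite distrC.
have [d' d'0 Hd'] := (@near_ball1 _ z0 _).1 phic.
apply/near_box2; exists (Num.min (Num.min d d') (tau * e)).
  by rewrite !lt_min d0 d'0 mulr_gt0.
move=> z v; rewrite !lt_min => /andP[/andP[zd zd'] ze] /andP[/andP[vd _] _] Fzv /=.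
have seg (t : R) : 0 <= t <= 1 -> sm F ((z, phi z) + t *: (0, v - phi z)) /\
   'D_(0, 1) F ((z, phi z) + t *: (0, v - phi z)) != 0.
  move=> /andP[t0 t1].
  have -> : (z, phi z) + t *: (0, v - phi z) = (z, phi z + t * (v - phi z)).
    by apply: injective_projections => /=; rewrite ?scaler0 ?addr0.
  apply: Hd => //.
  apply: (@le_lt_trans _ _ (Num.max `|phi z - v0| `|v - v0|)); last first.
    by rewrite gt_max (Hd' z zd').
  set b := Num.max _ _.
  have /ler_normlP[h2 h3] : `|phi z - v0| <= b by rewrite le_max lexx.
  have /ler_normlP[h4 h5] : `|v - v0| <= b by rewrite le_max lexx orbT.
  by apply/ler_normlP; split; nra.
have [t t01 E] := mvt01 (f := F) (x := (z, phi z)) (v := (0, v - phi z))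
  (fun t t01 => sm_derivable _ (seg t t01).1).
have [Ft Fvt] := seg t t01.
have uE : (0, v - phi z) = (v - phi z) *: ((0, 1) : Z * R).
  by apply: injective_projections => /=; rewrite ?scaler0 ?[_ *: 1]mulr1.
have zv : (z, phi z) + (0, v - phi z) = (z, v).
  by apply: injective_projections => /=; rewrite ?addr0// addrC subrK.
rewrite zv Fzv (phiF z ze) subrr in E.
move: E Ft Fvt; move: ((z, phi z) + t *: _) => y E Ft Fvt.
rewrite uE deriveZv in E; last exact: sm_diff Ft.
move/esym/eqP: E; rewrite mulf_eq0 (negbTE Fvt) orbF subr_eq0 => /eqP.
exact.
Qed.

End Implicit.
End IFT.

(** * Jets of functions, total derivatives, realisation of jets *)

Section JetBasics.
Context {R : realType}.
Local Notation J := (jet_space R).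

Definition ed (l : 'I_2) : 'rV[R]_2 := delta_mx 0 l.

Lemma mi_inj r : injective (@mi r).
Proof.
move=> p q [h1 h2]; apply: enum_val_inj; apply: val_inj.
by apply: injective_projections; exact: val_inj.
Qed.

Lemma mi_le r (p : 'I_#|{: midx r}|) : ((mi p).1 + (mi p).2 <= r)%N.
Proof. exact: (valP (enum_val p)). Qed.

Lemma mi_surj r (al : nat * nat) : (al.1 + al.2 <= r)%N -> exists p : 'I_#|{: midx r}|, mi p = al.
Proof.
case: al => a b /= abr.
have ar : (a < r.+1)%N by rewrite ltnS (leq_trans _ abr)// leq_addr.
have br : (b < r.+1)%N by rewrite ltnS (leq_trans _ abr)// leq_addl.
pose m : midx r := exist _ (Ordinal ar, Ordinal br) abr.
by exists (enum_rank m); rewrite /mi enum_rankK.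
Qed.

Lemma ju_mi r (j : J r) p : ju j (mi p) = j.2 0 p.
Proof. by rewrite /ju (big_pred1 p)// => q; rewrite /= (inj_eq (@mi_inj r)). Qed.

Lemma ju_mkjet r x c al : (al.1 + al.2 <= r)%N -> ju (mkjet r x c : J r) al = c al.
Proof. by move=> /mi_surj[p <-]; rewrite ju_mi mxE. Qed.

Lemma ju_jet r u x al : (al.1 + al.2 <= r)%N -> ju (jet r u x : J r) al = pder al u x.
Proof. exact: ju_mkjet. Qed.

Lemma jproj_jet m n u (x : 'rV[R]_2) : (n <= m)%N -> jproj n (jet m u x) = jet n u x.
Proof.
move=> nm; rewrite /jproj /jet /mkjet; congr (_, _).
by apply/rowP => p; rewrite !mxE ju_jet// (leq_trans (mi_le p)).
Qed.

Lemma jproj_jproj m n k (j : J m) : (k <= n)%N -> (n <= m)%N -> jproj k (jproj n j) = jproj k j.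
Proof.
move=> kn nm; rewrite /jproj /mkjet /=; congr (_, _).
by apply/rowP => p; rewrite !mxE ju_mkjet// (leq_trans (mi_le p)).
Qed.

Lemma jproj_id n (j : J n) : jproj n j = j.
Proof.
rewrite /jproj /mkjet; case: j => x v; congr (_, _).
by apply/rowP => p; rewrite !mxE ju_mi.
Qed.

Lemma eu_delta n (p : 'I_#|{: midx n}|) : eu n (mi p) = (0, delta_mx 0 p) :> J n.
Proof.
rewrite /eu /mkjet; congr (_, _); apply/rowP => q.
by rewrite !mxE eqxx /= (inj_eq (@mi_inj n)).
Qed.

Global Instance fdim_jet n : fdim (J n) := fdim_prod _ _.

Lemma sm_ju n al (j : J n) : sm (fun j : J n => ju j al) j.
Proof.
apply: sm_sum => p _.
apply: (@sm_comp _ _ _ _ _ _ snd (fun v : 'rV[R]_#|{: midx n}| => v 0 p) j (sm_snd j)).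
exact: sm_coord.
Qed.

Lemma sm_jproj m n (j : J m) : sm (@jproj R m n) j.
Proof.
apply: sm_pair; first exact: sm_fst.
by apply: sm_row => p; exact: sm_ju.
Qed.

Lemma sm_pder u al (x : 'rV[R]_2) : sm u x -> sm (pder al u) x.
Proof. exact: sm_iderive. Qed.

Lemma sm_jet n u (x : 'rV[R]_2) : sm u x -> sm (jet n u) x.
Proof.
move=> ux; apply: sm_pair; first exact: sm_id.
by apply: sm_row => p; exact: sm_pder.
Qed.

Lemma derive_iderive_comm (V : normedModType R) (v w : V) a (g : V -> R) x : sm g x ->
  'D_w (iderive (nseq a v) g) x = iderive (nseq a v) (fun y => 'D_w g y) x.
Proof.
elim: a x => [//|a IH] x gx /=.
rewrite (@schwarz R V _ x v w (sm_iderive (nseq a v) gx)).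
apply: near_eq_derive; apply: filterS (sm_near gx) => y gy.
exact: IH.
Qed.

Lemma derive_pder l al u (x : 'rV[R]_2) : sm u x ->
  'D_(ed l) (pder al u) x = pder (mshift l 1 al) u x.
Proof.
case: al => a b ux; rewrite /mshift /pder /ed /=.
have [->|l0] := eqVneq l 0; first by rewrite /= addn1.
have -> : l = 1.
  by apply/val_inj => /=; case: l l0 => [[|[|l]]] //= lt; rewrite -val_eqE.
rewrite /= addn1 /iderive !foldr_cat -/(iderive _ _).
have := @derive_iderive_comm _ (delta_mx 0 0) (delta_mx 0 1) a
   (iderive (nseq b (delta_mx 0 1)) u) x (sm_iderive _ ux).
by [].
Qed.

Lemma derive_id_dir (V : normedModType R) (x v : V) : 'D_v (fun y : V => y) x = v.
Proof. by rewrite (@derive_id _ V x v). Qed.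

Lemma derive_jet l n u (x : 'rV[R]_2) : sm u x ->
  'D_(ed l) (jet n u) x = ex n l + \sum_(p < #|{: midx n}|) pder (mshift l 1 (mi p)) u x *: (eu n (mi p) : J n).
Proof.
move=> ux.
have sr : sm (fun y => \row_(p < #|{: midx n}|) pder (mi p) u y) x.
  by apply: sm_row => p; exact: sm_pder.
rewrite [LHS](@derive_pair _ _ _ _ id (fun y => \row_(p < #|{: midx n}|) pder (mi p) u y)); last 2 first.
- exact: sm_diff (sm_id _).
- exact: sm_diff sr.
rewrite [X in (X, _)]derive_id_dir.
have -> : \sum_(p < #|{: midx n}|) pder (mshift l 1 (mi p)) u x *: (eu n (mi p) : J n) =
    (0, \row_p pder (mshift l 1 (mi p)) u x) :> J n.
  rewrite [X in (_, X)]row_sum_delta.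
  under eq_bigr do rewrite eu_delta.
  apply: injective_projections => /=.
    rewrite (raddf_sum (@fst 'rV[R]_2 'rV[R]_#|{: midx n}|)) big1// => p _ /=.
    by rewrite scaler0.
  rewrite (raddf_sum (@snd 'rV[R]_2 'rV[R]_#|{: midx n}|)).
  by apply: eq_bigr => p _ /=; rewrite mxE.
apply: injective_projections => /=; first by rewrite addr0.
rewrite add0r; apply/rowP => p; rewrite derive_rowE; last exact: sm_derivable sr.
rewrite mxE -derive_pder//; congr ('D__ _ x).
by apply/funext => y; rewrite mxE.
Qed.

(** The defining sum of a total derivative is the chain rule for [F] along the graph of jets of [u].
    Computations with D_1 and D_2 are thereby replaced by ordinary derivatives of functions of x. *)
Lemma tder_jet l n (F : J n -> R) u (x : 'rV[R]_2) : sm u x -> differentiable F (jet n u x) ->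
  tder l F (jet n.+1 u x) = 'D_(ed l) (fun y => F (jet n u y)) x.
Proof.
move=> ux Fx.
rewrite (@derive_comp _ _ _ _ (jet n u) F)//; last exact: sm_diff (sm_jet n ux).
rewrite derive_jet// deriveDv// derive_sumv// /tder jproj_jet//; congr (_ + _).
apply: eq_bigr => p _; rewrite deriveZv// ju_jet//.
have := mi_le p; case: (mi p) => a b /= ab; rewrite /mshift /=.
by case: ifP => _ /=; rewrite ?addn1 ?addSn ?addnS.
Qed.

Lemma sm_tder l n (F : J n -> R) (j : J n.+1) : sm F (jproj n j) -> sm (tder l F) j.
Proof.
move=> Fj.
have D v : sm (fun j : J n.+1 => 'D_v F (jproj n j)) j.
  by apply: (@sm_comp _ _ _ _ _ _ (@jproj R n.+1 n) (fun y => 'D_v F y) j (sm_jproj _ _)); exact: sm_derive.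
apply: smD; first exact: D.
by apply: sm_sum => p _; apply: smM; [exact: sm_ju|exact: D].
Qed.

Lemma sm_titer l m n (F : J n -> R) (j : J (m + n)) : sm F (jproj n j) -> sm (@titer R l m n F) j.
Proof.
elim: m j => [|m IH] j; first by rewrite jproj_id.
move=> Fj; apply: sm_tder; apply: IH.
by rewrite jproj_jproj// ?leq_addl.
Qed.

Lemma near_sm_jet n (F : J n -> R) u (x : 'rV[R]_2) : sm u x -> sm F (jet n u x) ->
  \forall y \near x, sm u y /\ sm F (jet n u y).
Proof.
move=> ux Fx; apply: filterI; first exact: sm_near ux.
exact: ((sm_cont (sm_jet n ux)) _ (sm_near Fx)).
Qed.

Lemma titer_jet l m n (F : J n -> R) u (x : 'rV[R]_2) : sm u x -> sm F (jet n u x) ->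
  @titer R l m n F (jet (m + n) u x) = iderive (nseq m (ed l)) (fun y => F (jet n u y)) x.
Proof.
elim: m x => [//|m IH] x ux Fx /=.
rewrite (@tder_jet l (m + n) (@titer R l m n F) u x ux); last first.
  by apply: sm_diff; apply: sm_titer; rewrite jproj_jet// leq_addl.
apply: near_eq_derive; apply: filterS (near_sm_jet ux Fx) => y [uy Fy].
exact: IH.
Qed.

(** Iterating [tder_jet] turns membership of a jet in a manifold of differential consequences into
    the vanishing at one point of the partial derivatives of y |-> F(jet u y). *)
Lemma consequences_jet n (F : J n -> R) r u (x : 'rV[R]_2) : sm u x -> sm F (jet n u x) ->
  consequences F r (jet r u x) <->
  forall a b, (a + b + n <= r)%N -> pder (a, b) (fun y => F (jet n u y)) x = 0.
Proof.
move=> ux Fx.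
have E a b : (a + b + n <= r)%N -> @titer R 0 a _ (@titer R 1 b n F) (jproj (a + (b + n)) (jet r u x)) =
    pder (a, b) (fun y => F (jet n u y)) x.
  move=> abr; rewrite jproj_jet ?addnA//.
  have sF y : sm u y -> sm F (jet n u y) -> sm (@titer R 1 b n F) (jet (b + n) u y).
    by move=> uy Fy; apply: sm_titer; rewrite jproj_jet// leq_addl.
  rewrite titer_jet//; last exact: sF.
  rewrite /pder /iderive /= foldr_cat -/(iderive _ _) -/(iderive (nseq b _) _).
  have : forall y, sm u y /\ sm F (jet n u y) ->
     @titer R 1 b n F (jet (b + n) u y) = iderive (nseq b (delta_mx 0 1)) (fun y => F (jet n u y)) y.
    by move=> y [uy Fy]; exact: titer_jet.
  move=> EE; have := near_sm_jet ux Fx; elim: a {abr} x {ux Fx} => [|a IH] x nx /=.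
    by rewrite EE//; exact: nbhs_singleton nx.
  apply: near_eq_derive; move: nx => /nbhs_interior; apply: filterS => y ny.
  exact: IH.
by split=> H a b abr; [rewrite -E//; exact: H|rewrite E//; exact: H].
Qed.

(** The [k]th derivative of s^a / a!, whose value at 0 is Kronecker's delta. *)
Definition dmon (a k : nat) (s : R) : R := if (k <= a)%N then s ^+ (a - k) / (a - k)`!%:R else 0.

Lemma dmon_derive a k (s : R) : is_derive s 1 (dmon a k) (dmon a k.+1 s).
Proof.
rewrite /dmon; case: (ltnP k a) => ka.
  rewrite (ltnW ka); have -> : (a - k = (a - k.+1).+1)%N by rewrite subnS prednK// subn_gt0.
  set m := (a - k.+1)%N.
  have d : is_derive s 1 (fun u : R => u ^+ m.+1) (m.+1%:R * s ^+ m).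
    split; first exact: exprn_derivable.
    by rewrite exp_derive [_ *: 1]mulr1.
  have d2 := is_derive_mulfun d (is_derive_cst ((m.+1)`!%:R^-1 : R) s (1 : R)).
  have <- : s ^+ m.+1 * 0 + (m.+1)`!%:R^-1 * (m.+1%:R * s ^+ m) = s ^+ m / m`!%:R.
    rewrite mulr0 add0r factS natrM.
    have m0 : m.+1%:R != 0 :> R by rewrite pnatr_eq0.
    have f0 : m`!%:R != 0 :> R by rewrite pnatr_eq0 -lt0n fact_gt0.
    move: m0 f0; move: (m.+1%:R) (m`!%:R) => q f q0 f0; field.
    by rewrite q0 f0.
  exact: d2.
move: ka; rewrite leq_eqVlt => /orP[/eqP ->|ka].
  rewrite leqnn subnn.
  have -> : (fun s0 : R => s0 ^+ 0 / 0`!%:R) = cst 1.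
    by apply/funext => u; rewrite expr0 fact0 divr1.
  exact: is_derive_cst.
by rewrite leqNgt ka; exact: is_derive_cst.
Qed.

Lemma dmon_sm a k (s : R) : sm (dmon a k) s.
Proof.
exists setT; split; [exact: openT|by []|].
move=> n; elim: n k => [|n IH] k /=.
  move=> t _; have [d _] := dmon_derive a k t.
  by apply: differentiable_continuous; exact/derivable1_diffP.
have df t : differentiable (dmon a k) t.
  by have [d _] := dmon_derive a k t; exact/derivable1_diffP.
split=> // v; apply: (@Cn_ext _ _ _ n _ (fun t => v *: dmon a k.+1 t)); first exact: openT.
  move=> t _; have [_ <-] := dmon_derive a k t.
  by rewrite -deriveZv// [v *: 1]mulr1.
exact: (@Cn_comp_lin _ _ _ _ n setT _ ( *:%R v) openT (@scaler_continuous _ _ v) (IH k.+1)).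
Qed.

Lemma dmon0 a k : dmon a k 0 = (k == a)%:R.
Proof.
rewrite /dmon; case: ltngtP => // ka; last by rewrite ka subnn expr0 fact0 divr1.
by rewrite expr0n subn_eq0 leqNgt ka mul0r.
Qed.

Lemma derive_coord2 (x v c : 'rV[R]_2) (i : 'I_2) : 'D_v (fun y : 'rV[R]_2 => y 0 i - c 0 i) x = v 0 i.
Proof.
pose lM := GRing.isLinear.Build _ _ _ _ _ (@coord_linear R 2 i).
pose L : {linear 'rV[R]_2 -> R} := HB.pack (fun v : 'rV[R]_2 => v 0 i) lM.
have Lc : continuous L by exact: coord_continuous.
have h := @deriveB _ _ _ L (cst (c 0 i)) x v (diff_derivable (linear_differentiable _ Lc)) (derivable_cst _ _ _).
by rewrite derive_cst subr0 in h; exact: etrans h (derive_lin x v Lc).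
Qed.

Definition tayl r (j : J r) (a b : nat) (y : 'rV[R]_2) : R :=
  \sum_p j.2 0 p * (dmon (mi p).1 a (y 0 0 - j.1 0 0) * dmon (mi p).2 b (y 0 1 - j.1 0 1)).

Lemma sm_coordB (y c : 'rV[R]_2) (i : 'I_2) : sm (fun y : 'rV[R]_2 => y 0 i - c 0 i) y.
Proof. by apply: smB; [exact: sm_coord|exact: sm_cst]. Qed.

Lemma sm_dmonB a k (y c : 'rV[R]_2) (i : 'I_2) : sm (fun y : 'rV[R]_2 => dmon a k (y 0 i - c 0 i)) y.
Proof.
apply: (@sm_comp _ _ _ _ _ _ (fun y : 'rV[R]_2 => y 0 i - c 0 i) (dmon a k)).
  exact: sm_coordB.
exact: dmon_sm.
Qed.

Lemma sm_tayl r (j : J r) a b y : sm (tayl j a b) y.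
Proof.
apply: sm_sum => p _; apply: smM; first exact: sm_cst.
by apply: smM; exact: sm_dmonB.
Qed.

Lemma derive_dmonB a k (y v c : 'rV[R]_2) (i : 'I_2) :
  'D_v (fun y : 'rV[R]_2 => dmon a k (y 0 i - c 0 i)) y = v 0 i * dmon a k.+1 (y 0 i - c 0 i).
Proof.
rewrite (@derive_comp _ _ _ _ (fun y : 'rV[R]_2 => y 0 i - c 0 i) (dmon a k)).
- rewrite derive_coord2 -[X in 'D__ _ X]/(y 0 i - c 0 i).
  have [_ <-] := dmon_derive a k (y 0 i - c 0 i).
  have := @deriveZv _ _ _ (dmon a k) (y 0 i - c 0 i) (v 0 i) 1 (sm_diff (dmon_sm _ _ _)).
  by rewrite [v 0 i *: 1]mulr1.
- exact: sm_diff (sm_coordB _ _ _).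
- exact: sm_diff (dmon_sm _ _ _).
Qed.

Lemma derive_tayl r (j : J r) a b v y :
  'D_v (tayl j a b) y = v 0 0 * tayl j a.+1 b y + v 0 1 * tayl j a b.+1 y.
Proof.
have sp (p : 'I_#|{: midx r}|) : sm (fun y : 'rV[R]_2 => dmon (mi p).1 a (y 0 0 - j.1 0 0) * dmon (mi p).2 b (y 0 1 - j.1 0 1)) y.
  by apply: smM; exact: sm_dmonB.
have -> : tayl j a b = \sum_p (fun y : 'rV[R]_2 => j.2 0 p * (dmon (mi p).1 a (y 0 0 - j.1 0 0) * dmon (mi p).2 b (y 0 1 - j.1 0 1))).
  by apply/funext => z; rewrite fct_sumE.
rewrite derive_sum; last first.
  by move=> p; apply: sm_derivable; apply: smM; [exact: sm_cst|exact: sp].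
rewrite /tayl !mulr_sumr -big_split /=; apply: eq_bigr => p _.
have := @deriveZ _ _ _ _ (j.2 0 p) y v (sm_derivable v (sp p)).
have -> : (j.2 0 p \*: (fun y : 'rV[R]_2 => dmon (mi p).1 a (y 0 0 - j.1 0 0) * dmon (mi p).2 b (y 0 1 - j.1 0 1))) =
  (fun y : 'rV[R]_2 => j.2 0 p * (dmon (mi p).1 a (y 0 0 - j.1 0 0) * dmon (mi p).2 b (y 0 1 - j.1 0 1))) by [].
move=> ->.
have s1 := @sm_dmonB (mi p).1 a y j.1 0; have s2 := @sm_dmonB (mi p).2 b y j.1 1.
have := @deriveM _ _ _ _ y v (sm_derivable v s1) (sm_derivable v s2).
rewrite !derive_dmonB => h.
have -> : 'D_v (fun y : 'rV[R]_2 => dmon (mi p).1 a (y 0 0 - j.1 0 0) * dmon (mi p).2 b (y 0 1 - j.1 0 1)) y =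
  dmon (mi p).1 a (y 0 0 - j.1 0 0) * (v 0 1 * dmon (mi p).2 b.+1 (y 0 1 - j.1 0 1)) +
  dmon (mi p).2 b (y 0 1 - j.1 0 1) * (v 0 0 * dmon (mi p).1 a.+1 (y 0 0 - j.1 0 0)) by exact: h.
rewrite /GRing.scale /=; ring.
Qed.

Lemma pder_tayl r (j : J r) a b : pder (a, b) (tayl j 0 0) = tayl j a b.
Proof.
rewrite /pder /iderive /= foldr_cat -/(iderive (nseq b _) _).
have -> : iderive (nseq b (delta_mx 0 1)) (tayl j 0 0) = tayl j 0 b.
  elim: b => [//|b IH] /=; rewrite IH; apply/funext => y.
  by rewrite derive_tayl !mxE /= mul0r mul1r add0r.
rewrite -/(iderive _ _); elim: a => [//|a IH] /=; rewrite IH; apply/funext => y.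
by rewrite derive_tayl !mxE /= mul0r mul1r addr0.
Qed.

(** The Taylor polynomial with the prescribed coefficients. It lets conditions on a single jet be
    read as conditions on a smooth function. *)
Lemma taylor r (j : J r) : exists u, (forall x, sm u x) /\ jet r u j.1 = j.
Proof.
exists (tayl j 0 0); split; first by move=> x; exact: sm_tayl.
rewrite -[RHS]jproj_id /jet /jproj /mkjet; congr (_, _); apply/rowP => p; rewrite !mxE ju_mi.
case E : (mi p) => [a b]; rewrite pder_tayl /tayl (bigD1 p)// !subrr !dmon0 E !eqxx !mulr1.
rewrite big1 => [|q qp]; first exact: addr0.
rewrite !dmon0.
case: eqP => [h1|_]; last by rewrite mul0r mulr0.
case: eqP => [h2|_]; last by rewrite mulr0 mulr0.
exfalso; move/negP: qp; apply; apply/eqP; apply: (@mi_inj r).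
by rewrite E [LHS]surjective_pairing -h1 -h2.
Qed.

End JetBasics.

(** * The prolonged vector field along Q-invariant functions *)

Section Prolongation.
Context {R : realType}.
Local Notation J := (jet_space R).

Lemma iderive_near_eq (V W : normedModType R) (s : seq V) (f g : V -> W) x :
  (\forall y \near x, f y = g y) -> iderive s f x = iderive s g x.
Proof.
move=> fg; elim: s x fg => [|v s IH] x fg /=; first exact: nbhs_singleton fg.
apply: near_eq_derive; move: fg => /nbhs_interior; apply: filterS => y.
exact: IH.
Qed.

Lemma iderive0 (V W : normedModType R) (s : seq V) (x : V) :
  iderive s (fun _ : V => 0 : W) x = 0.
Proof.
have -> : iderive s (fun _ : V => 0 : W) = fun=> 0; last by [].
by elim: s => //= v s ->; apply/funext => y; rewrite derive_cst.
Qed.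

Lemma mshiftC (l i : 'I_2) al : mshift l 1 (mshift i 1 al) = mshift i 1 (mshift l 1 al).
Proof. by rewrite /mshift; case: eqP; case: eqP. Qed.

Lemma mshift_le (l : 'I_2) al n : (al.1 + al.2 <= n)%N ->
  ((mshift l 1 al).1 + (mshift l 1 al).2 <= n.+1)%N.
Proof. by rewrite /mshift; case: ifP => _ /=; rewrite ?addn1 ?addSn ?addnS. Qed.

Lemma mulr_diff (a b c d : R) : (c - d) * a + (a - b) * d = a * c - b * d.
Proof. by ring. Qed.

Lemma addr3K (a a' b c : R) : a = a' -> a + (b + c) - c = a' + b.
Proof. by move=> <-; ring. Qed.

Lemma addrMK (a b c : R) : a + b * c - c * b = a.
Proof. by ring. Qed.

Section Field.
Variables (xi : 'I_2 -> J 0 -> R) (eta : J 0 -> R).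

Lemma charE u x : sm u x -> characteristic xi eta (jet 1 u x) =
  eta (jet 0 u x) - \sum_(l < 2) xi l (jet 0 u x) * 'D_(ed l) u x.
Proof.
move=> ux; rewrite /characteristic jproj_jet//; congr (_ - _).
apply: eq_bigr => l _; rewrite ju_jet; last by rewrite mshift_le.
by rewrite -derive_pder.
Qed.

Lemma sm_char (j : J 1) : (forall l, sm (xi l) (jproj 0 j)) -> sm eta (jproj 0 j) ->
  sm (characteristic xi eta) j.
Proof.
move=> xs es; apply: smB; first exact: (@sm_comp _ _ _ _ _ _ (@jproj R 1 0) eta j (sm_jproj _ _)).
apply: sm_sum => l _; apply: smM; last exact: sm_ju.
exact: (@sm_comp _ _ _ _ _ _ (@jproj R 1 0) (xi l) j (sm_jproj _ _)).
Qed.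

Lemma sm_eta_step i al n (F : J n -> R) (j : J n.+1) :
  (forall l, sm (xi l) (jproj 0 j)) -> sm F (jproj n j) -> sm (eta_step xi i al F) j.
Proof.
move=> xs Fs; apply: smB; first exact: sm_tder.
apply: sm_sum => l _; apply: smM; last exact: sm_ju.
apply: (@sm_comp _ _ _ _ _ _ (@jproj R n.+1 1) (tder i (xi l)) j (sm_jproj _ _)).
by apply: sm_tder; rewrite jproj_jproj.
Qed.

Lemma sm_eta2 b (j : J b) : (forall l, sm (xi l) (jproj 0 j)) -> sm eta (jproj 0 j) ->
  sm (@eta2 R xi eta b) j.
Proof.
elim: b j => [|b IH] j xs es; first by rewrite jproj_id in es.
apply: sm_eta_step => //; apply: IH; first by move=> l; rewrite jproj_jproj.
by rewrite jproj_jproj.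
Qed.

Lemma sm_eta_coef a b (j : J (a + b)) : (forall l, sm (xi l) (jproj 0 j)) -> sm eta (jproj 0 j) ->
  sm (@eta_coef R xi eta a b) j.
Proof.
elim: a j => [|a IH] j xs es; first exact: sm_eta2.
apply: (@sm_eta_step 0 (a, b) (a + b)) => //; apply: IH; first by move=> l; rewrite jproj_jproj.
by rewrite jproj_jproj.
Qed.

Section Invariant.
Variables (u : 'rV[R]_2 -> R).

(** Q[u] vanishes on a neighbourhood, not merely at [x], so that all its derivatives vanish at [x]
    as well. *)
Definition invariant_near (x : 'rV[R]_2) := [/\ sm u x, forall l, sm (xi l) (jet 0 u x),
  sm eta (jet 0 u x) & \forall y \near x, characteristic xi eta (jet 1 u y) = 0].

Lemma invariant_near_near x : invariant_near x -> \forall y \near x, invariant_near y.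
Proof.
move=> [us xs es Q].
have nu := sm_near us.
have nx l : \forall y \near x, sm (xi l) (jet 0 u y).
  exact: ((sm_cont (sm_jet 0 us)) _ (sm_near (xs l))).
have ne : \forall y \near x, sm eta (jet 0 u y).
  exact: ((sm_cont (sm_jet 0 us)) _ (sm_near es)).
have nx' : \forall y \near x, forall l, sm (xi l) (jet 0 u y) by exact: filter_forall nx.
have nQ := nbhs_interior Q.
have n1 : \forall y \near x, sm u y /\ sm eta (jet 0 u y) by exact: filterI nu ne.
have n2 : \forall y \near x, (forall l, sm (xi l) (jet 0 u y)) /\
   \forall z \near y, characteristic xi eta (jet 1 u z) = 0 by exact: filterI nx' nQ.
by apply: filterS2 n1 n2 => y [uy ey] [xy Qy]; split.
Qed.

Let S al x := \sum_(l < 2) xi l (jet 0 u x) * pder (mshift l 1 al) u x.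

(** If eta^al is the sum of the xi^l u_(al + delta_l), Leibniz's rule for D_i produces the terms
    (D_i xi^l) u_(al + delta_l), and these are exactly what the recursion subtracts. The form of the
    coefficient is thus inherited by al + delta_i; for al = 0 it is Q[u] = 0. *)
Lemma eta_step_jet i al n (F : J n -> R) x : invariant_near x ->
  (al.1 + al.2 <= n)%N -> sm F (jet n u x) -> (\forall y \near x, F (jet n u y) = S al y) ->
  eta_step xi i al F (jet n.+1 u x) = S (mshift i 1 al) x.
Proof.
move=> [us xs es _] aln Fs FS; rewrite /eta_step tder_jet//; last exact: sm_diff.
rewrite (near_eq_derive _ FS).
have sxl l : sm (fun y => xi l (jet 0 u y)) x.
  exact: (@sm_comp _ _ _ _ _ _ (jet 0 u) (xi l) x (sm_jet 0 us)).
have st l : sm (fun y => xi l (jet 0 u y) * pder (mshift l 1 al) u y) x.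
  by apply: smM => //; exact: sm_pder.
have -> : S al = \sum_(l < 2) (fun y => xi l (jet 0 u y) * pder (mshift l 1 al) u y).
  by apply/funext => y; rewrite fct_sumE.
rewrite derive_sum; last by move=> l; exact: sm_derivable.
rewrite -sumrB; apply: eq_bigr => l _.
have -> : 'D_(ed i) (fun y => xi l (jet 0 u y) * pder (mshift l 1 al) u y) x =
   xi l (jet 0 u x) * 'D_(ed i) (pder (mshift l 1 al) u) x +
   pder (mshift l 1 al) u x * 'D_(ed i) (fun y => xi l (jet 0 u y)) x.
  exact: (deriveM (sm_derivable _ (sxl l)) (sm_derivable _ (sm_pder _ us))).
rewrite derive_pder// mshiftC jproj_jet// tder_jet//; last exact: sm_diff.
rewrite ju_jet; last exact: mshift_le.
exact: addrMK.
Qed.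

Lemma eta2_jet b x : invariant_near x -> @eta2 R xi eta b (jet b u x) = S (0, b)%N x.
Proof.
elim: b x => [|b IH] x Hx.
  have [us _ _ Q] := Hx; have := nbhs_singleton Q; rewrite charE// => /eqP.
  rewrite subr_eq0 => /eqP /= ->; apply: eq_bigr => l _.
  by rewrite -derive_pder.
rewrite /= (@eta_step_jet 1 (0, b)%N b (@eta2 R xi eta b) x)//.
- by rewrite /mshift /= addn1.
- have [us xs es _] := Hx; apply: sm_eta2; first by move=> l; rewrite jproj_jet.
  by rewrite jproj_jet.
- by apply: filterS (invariant_near_near Hx) => y /IH.
Qed.

Lemma eta_coef_jet a b x : invariant_near x ->
  @eta_coef R xi eta a b (jet (a + b) u x) = S (a, b) x.
Proof.
elim: a x => [|a IH] x Hx; first exact: eta2_jet.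
rewrite /= (@eta_step_jet 0 (a, b)%N (a + b) (@eta_coef R xi eta a b) x)//.
- by rewrite /mshift /= addn1.
- have [us xs es _] := Hx; apply: sm_eta_coef; first by move=> l; rewrite jproj_jet.
  by rewrite jproj_jet.
- by apply: filterS (invariant_near_near Hx) => y /IH.
Qed.

(** With every coefficient eta^al equal to the sum of the xi^l u_(al + delta_l), the prolonged field
    is tangent to the graph of jets of [u] and acts there as xi^1 D_1 + xi^2 D_2. *)
Lemma prolong_jet r (F : J r -> R) x : invariant_near x -> sm F (jet r u x) ->
  prolong xi eta F (jet r u x) =
  \sum_(l < 2) xi l (jet 0 u x) * 'D_(ed l) (fun y => F (jet r u y)) x.
Proof.
move=> Hx Fs; have [us xs es _] := Hx; rewrite /prolong jproj_jet//.
have Fd := sm_diff Fs.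
have E l : 'D_(ed l) (fun y => F (jet r u y)) x = 'D_(ex r l) F (jet r u x) +
    \sum_(p < #|{: midx r}|) pder (mshift l 1 (mi p)) u x * 'D_(eu r (mi p)) F (jet r u x).
  rewrite (@derive_comp _ _ _ _ (jet r u) F)//; last exact: sm_diff (sm_jet r us).
  rewrite derive_jet// deriveDv// derive_sumv//; congr (_ + _).
  by apply: eq_bigr => p _; rewrite deriveZv.
under [RHS]eq_bigr do rewrite E mulrDr mulr_sumr.
rewrite big_split /=; congr (_ + _).
rewrite exchange_big /=; apply: eq_bigr => p _.
rewrite jproj_jet ?mi_le// eta_coef_jet// /S mulr_suml; apply: eq_bigr => l _.
by rewrite -mulrA.
Qed.

Lemma Qmanifold_jet r x : invariant_near x -> Qmanifold xi eta r (jet r u x).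
Proof.
move=> Hx; have [us xs es Q] := Hx.
apply/consequences_jet => //; first by apply: sm_char; rewrite ?jproj_jet// => l; rewrite jproj_jet.
by move=> a b _; rewrite /pder (iderive_near_eq _ Q) iderive0.
Qed.

End Invariant.
End Field.
End Prolongation.

(** * Order of vanishing at a point *)

Section Vanish.
Context {R : realType} {V : normedModType R}.

(** The iterated derivatives of [f] along directions in [D], up to order [n], vanish at the single
    point [x]. The set [D] is either both axes or one axis. *)
Fixpoint vanish (D : set V) (n : nat) (f : V -> R) (x : V) : Prop :=
  f x = 0 /\ match n with 0%N => True
    | n'.+1 => forall v, D v -> vanish D n' (fun y => 'D_v f y) x end.

Variable D : set V.

Lemma vanish0 n f x : vanish D n f x -> f x = 0.
Proof. by case: n => [|n] []. Qed.

Lemma vanish_near_eq n f g x : (\forall y \near x, f y = g y) -> vanish D n f x -> vanish D n g x.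
Proof.
elim: n f g => [|n IH] f g fg /= [f0 H]; split; rewrite -?(nbhs_singleton fg)//.
move=> v /H; apply: IH; move: fg => /nbhs_interior; apply: filterS => y.
exact: near_eq_derive.
Qed.

Lemma vanishW n f x : vanish D n.+1 f x -> vanish D n f x.
Proof.
elim: n f => [|n IH] f; first by move=> [].
by move=> [f0 H]; split=> // v /H; exact: IH.
Qed.

Lemma vanish_le m n f x : (m <= n)%N -> vanish D n f x -> vanish D m f x.
Proof. by move=> /subnK <-; elim: (n - m)%N => // k IH /vanishW. Qed.

Lemma vanish_cst0 n x : vanish D n (fun=> 0) x.
Proof.
elim: n => [//|n IH] /=; split=> // v _; apply: vanish_near_eq IH.
by apply: nearW => y; rewrite derive_cst.
Qed.

Lemma vanishD n f g x : sm f x -> sm g x -> vanish D n f x -> vanish D n g x ->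
  vanish D n (fun y => f y + g y) x.
Proof.
elim: n f g => [|n IH] f g fs gs /= [f0 H1] [g0 H2]; split; rewrite ?f0 ?g0 ?addr0//.
move=> v Dv; apply: vanish_near_eq (IH _ _ (sm_derive v fs) (sm_derive v gs) (H1 v Dv) (H2 v Dv)).
apply: filterS2 (sm_near fs) (sm_near gs) => y fy gy.
by rewrite [RHS](deriveD (sm_derivable v fy) (sm_derivable v gy)).
Qed.

Lemma vanishM n f g x : sm f x -> sm g x -> vanish D n f x ->
  vanish D n (fun y => f y * g y) x.
Proof.
elim: n f g => [|n IH] f g fs gs.
  by move=> [f0 _]; split=> //; rewrite f0 mul0r.
move=> /[dup] /vanishW fn /= [f0 H1]; split; first by rewrite f0 mul0r.
move=> v Dv.
have h1 := IH _ _ fs (sm_derive v gs) fn.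
have h2 := IH _ _ (sm_derive v fs) gs (H1 v Dv).
apply: vanish_near_eq (vanishD _ _ h1 h2).
- apply: filterS2 (sm_near fs) (sm_near gs) => y fy gy.
  by rewrite [RHS](deriveM (sm_derivable v fy) (sm_derivable v gy)) [X in _ + X]mulrC.
- by apply: smM => //; exact: sm_derive.
- by apply: smM => //; exact: sm_derive.
Qed.

Lemma vanishN n f x : sm f x -> vanish D n f x -> vanish D n (fun y => - f y) x.
Proof.
move=> fs H; apply: vanish_near_eq (vanishM fs (sm_cst (-1 : R) x) H).
by apply: nearW => y; rewrite mulrN1.
Qed.

Lemma vanish_sum (I : Type) (r : seq I) n (F : I -> V -> R) x :
  (forall i, sm (F i) x) -> (forall i, vanish D n (F i) x) ->
  vanish D n (fun y => \sum_(i <- r) F i y) x.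
Proof.
move=> Fs H; elim: r => [|a r IH].
  by apply: vanish_near_eq (vanish_cst0 n x); apply: nearW => y; rewrite big_nil.
apply: (@vanish_near_eq _ (fun y => F a y + \sum_(i <- r) F i y)).
  by apply: nearW => y; rewrite big_cons.
by apply: vanishD => //; exact: sm_sum.
Qed.

(** Maps that agree to order [n] still agree to order [n] after composition with a smooth [H]. The
    induction is over all [H], because differentiating once replaces [H] by its partial
    derivatives. *)
Lemma vanish_comp (W : normedModType R) (fW : fdim W) n (H : W -> R) (F1 F2 : V -> W) x :
  sm F1 x -> sm F2 x -> sm H (F1 x) -> F1 x = F2 x ->
  (forall l : 'I_(@fd_n _ _ fW), vanish D n (fun y => fd_c (F1 y) l - fd_c (F2 y) l) x) ->
  vanish D n (fun y => H (F1 y) - H (F2 y)) x.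
Proof.
elim: n H => [|n IH] H s1 s2 Hs E HF; first by split=> //; rewrite E subrr.
split; first by rewrite E subrr.
move=> v Dv.
have scoF (F : V -> W) (l : 'I_(@fd_n _ _ fW)) : sm F x -> sm (fun y => fd_c (F y) l) x.
  by move=> Fs; exact: (sm_comp_lin (@fd_co_continuous _ _ _ l) Fs).
have dcoF (F : V -> W) (l : 'I_(@fd_n _ _ fW)) y : sm F y ->
    'D_v (fun y => fd_c (F y) l) y = fd_c ('D_v F y) l.
  move=> Fs; rewrite (@derive_comp _ _ _ _ F (@fd_co _ _ fW l)).
  - by rewrite derive_lin//; exact: fd_co_continuous.
  - exact: sm_diff.
  - by apply: linear_differentiable; exact: fd_co_continuous.
have Hs2 : sm H (F2 x) by rewrite -E.
have n1 : \forall y \near x, sm F1 y /\ sm H (F1 y).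
  by apply: filterI; [exact: sm_near s1|exact: ((sm_cont s1) _ (sm_near Hs))].
have n2 : \forall y \near x, sm F2 y /\ sm H (F2 y).
  by apply: filterI; [exact: sm_near s2|exact: ((sm_cont s2) _ (sm_near Hs2))].
have dH (F : V -> W) y : sm F y -> sm H (F y) ->
   'D_v (fun y => H (F y)) y = \sum_(l < @fd_n _ _ fW) fd_c ('D_v F y) l * 'D_(fd_e l) H (F y).
  move=> Fs HFs; rewrite (@derive_comp _ _ _ _ F H); [|exact: sm_diff|exact: sm_diff].
  by rewrite (derive_decomp _ (sm_diff HFs)).
(* One term of the differentiated difference, split so that each product has a factor vanishing to
   order [n]: the difference of ['D_(fd_e l) H] by induction, the differentiated coordinate
   difference by hypothesis. *)
pose T (l : 'I_(@fd_n _ _ fW)) y := ('D_(fd_e l) H (F1 y) - 'D_(fd_e l) H (F2 y)) * 'D_v (fun y => fd_c (F1 y) l) y +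
  'D_v (fun y => fd_c (F1 y) l - fd_c (F2 y) l) y * 'D_(fd_e l) H (F2 y).
have sDH (F : V -> W) l : sm F x -> sm H (F x) -> sm (fun y => 'D_(fd_e l) H (F y)) x.
  move=> Fs HFs; apply: (@sm_comp _ _ _ _ _ _ F (fun w => 'D_(fd_e l) H w)) => //.
  exact: sm_derive.
have sd l : sm (fun y => fd_c (F1 y) l - fd_c (F2 y) l) x by apply: smB; exact: scoF.
have sT1 l : sm (fun y => ('D_(fd_e l) H (F1 y) - 'D_(fd_e l) H (F2 y)) * 'D_v (fun y => fd_c (F1 y) l) y) x.
  apply: smM; first by apply: smB; exact: sDH.
  by apply: sm_derive; exact: scoF.
have sT2 l : sm (fun y => 'D_v (fun y => fd_c (F1 y) l - fd_c (F2 y) l) y * 'D_(fd_e l) H (F2 y)) x.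
  by apply: smM; [exact: sm_derive|exact: sDH].
apply: (@vanish_near_eq _ (fun y => \sum_l T l y)).
  apply: filterS2 n1 n2 => y [F1y HF1y] [F2y HF2y].
  have sH1 : sm (fun y => H (F1 y)) y by exact: (@sm_comp _ _ _ _ _ _ F1 H).
  have sH2 : sm (fun y => H (F2 y)) y by exact: (@sm_comp _ _ _ _ _ _ F2 H).
  rewrite [RHS](deriveB (sm_derivable v sH1) (sm_derivable v sH2)) !dH// -sumrB.
  apply: eq_bigr => l _; rewrite /T.
  have sF (F : V -> W) : sm F y -> sm (fun y => fd_c (F y) l) y.
    by move=> Fs; exact: (sm_comp_lin (@fd_co_continuous _ _ _ l) Fs).
  have -> : 'D_v (fun y => fd_c (F1 y) l - fd_c (F2 y) l) y =
     'D_v (fun y => fd_c (F1 y) l) y - 'D_v (fun y => fd_c (F2 y) l) y.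
    exact: (deriveB (sm_derivable v (sF _ F1y)) (sm_derivable v (sF _ F2y))).
  rewrite !dcoF//.
  exact: mulr_diff.
apply: vanish_sum => [l|l]; first by apply: smD.
apply: vanishD => //.
  apply: vanishM.
  - by apply: smB; exact: sDH.
  - by apply: sm_derive; exact: scoF.
  - apply: (IH (fun w => 'D_(fd_e l) H w)) => //; first exact: sm_derive.
    by move=> m; exact: vanishW.
apply: vanishM; [exact: sm_derive|exact: sDH|].
by have [_] := HF l; apply.
Qed.

Lemma vanish_iderive n s f x : (forall v, v \in s -> D v) -> (size s <= n)%N ->
  vanish D n f x -> vanish D (n - size s) (iderive s f) x.
Proof.
elim: s => [|v s IH] Ds sn H /=; first by rewrite subn0.
have := IH (fun w ws => Ds w (mem_behead (s := v :: s) ws)) (ltnW sn) H.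
rewrite (_ : (n - size s)%N = (n - (size s).+1).+1)%N; last by rewrite -subSn.
by move=> [_]; apply; apply: Ds; rewrite mem_head.
Qed.

Lemma vanish_iderive0 n s f x : (forall v, v \in s -> D v) -> (size s <= n)%N ->
  vanish D n f x -> iderive s f x = 0.
Proof. by move=> Ds sn H; apply: vanish0; exact: vanish_iderive Ds sn H. Qed.

End Vanish.

(** * Vanishing in the plane and its transport across a direction *)

Section VanishPlane.
Context {R : realType}.
Implicit Types (f d zeta : 'rV[R]_2 -> R).

Definition dirs : set 'rV[R]_2 := range (@ed R).

Lemma vanish_pder n f x : sm f x -> vanish dirs n f x <->
  forall a b, (a + b <= n)%N -> pder (a, b) f x = 0.
Proof.
move=> fs; split=> [H a b abn|].
  apply: vanish_iderive0 H; last by rewrite size_cat !size_nseq.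
  move=> v; rewrite mem_cat !mem_nseq => /orP[] /andP[_ /eqP ->]; first by exists 0.
  by exists 1.
elim: n f fs => [|n IH] f fs H; first by split=> //; exact: (H 0 0)%N.
split; first exact: (H 0 0)%N.
move=> _ [l _ <-]; apply: IH; first exact: sm_derive.
move=> a b abn.
have -> : pder (a, b) (fun y => 'D_(ed l) f y) x = pder (mshift l 1 (a, b)) f x.
  rewrite -derive_pder// /pder /iderive !foldr_cat /=.
  rewrite (@derive_iderive_comm R _ (delta_mx 0 0) (ed l) a (iderive (nseq b (delta_mx 0 1)) f) x (sm_iderive _ fs)).
  apply: iderive_near_eq; apply: filterS (sm_near fs) => y fy.
  by rewrite (@derive_iderive_comm R _ (delta_mx 0 1) (ed l) b f y fy).
by rewrite /mshift; case: ifP => _; apply: H; rewrite /= ?addn1 ?addSn ?addnS.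
Qed.

Lemma vanish_pure n f x (e : 'rV[R]_2) : vanish [set e] n f x <->
  forall a, (a <= n)%N -> iderive (nseq a e) f x = 0.
Proof.
split=> [H a an|].
  apply: vanish_iderive0 H; last by rewrite size_nseq.
  by move=> v; rewrite mem_nseq => /andP[_ /eqP ->].
elim: n f => [|n IH] f H; first by split=> //; exact: (H 0%N).
split; first exact: (H 0%N).
move=> _ ->; apply: IH => a an.
have -> : iderive (nseq a e) (fun y => 'D_e f y) = iderive (nseq a.+1 e) f.
  by rewrite -(addn1 a) nseqD /iderive foldr_cat.
exact: H.
Qed.

Lemma vanish_dirs_pure n f x i : vanish dirs n f x -> vanish [set ed i] n f x.
Proof.
elim: n f => [//|n IH] f [f0 H]; split=> // _ ->; apply: IH; apply: H.
by exists i.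
Qed.

Lemma neq_ord2 (i i' l : 'I_2) : i != i' -> l = i \/ l = i'.
Proof.
move=> ii'; suff : (l == i) || (l == i') by case/orP => /eqP; [left|right].
by case: i i' l ii' => [[|[|i]] ?] [[|[|i']] ?] [[|[|l]] ?] //; rewrite -!val_eqE.
Qed.

(** The equation expresses the derivative across the axis through the one along it, so vanishing
    along direction [i] spreads to all directions. The induction on the order is applied to [d]
    itself and then to its derivative in direction [i]. *)
Lemma vanish_transport (i i' : 'I_2) n d zeta x : i != i' -> sm d x -> sm zeta x ->
  vanish [set ed i] n.+1 d x ->
  vanish dirs n (fun y => 'D_(ed i') d y + zeta y * 'D_(ed i) d y) x ->
  vanish dirs n.+1 d x.
Proof.
move=> ii'; elim: n d => [|n IH] d ds zs Hp H; have [d0 Hi] := Hp.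
  have di : 'D_(ed i) d x = 0 by have [] := Hi (ed i) erefl.
  have di' : 'D_(ed i') d x = 0 by move: H => [+ _]; rewrite di mulr0 addr0.
  split; first exact: d0.
  move=> _ [l _ <-]; split; last by [].
  by have [->|->] := neq_ord2 l ii'.
have dn : vanish dirs n.+1 d x.
  by apply: (IH d ds zs); [exact: vanishW Hp|exact: vanishW H].
have sdi := sm_derive (ed i) ds; have sdi' := sm_derive (ed i') ds.
(* Differentiating the transport equation in direction [i] gives the same equation for ['D_(ed i) d]
   up to the product of ['D_(ed i) zeta] and ['D_(ed i) d], which vanishes to order [n] by [dn]. *)
have dni : vanish dirs n.+1 (fun y => 'D_(ed i) d y) x.
  apply: IH => //; first exact: Hi.
  have hz : vanish dirs n (fun y => 'D_(ed i) (fun y => 'D_(ed i') d y + zeta y * 'D_(ed i) d y) y) x.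
    by move: H => [_]; apply; exists i.
  have hd : vanish dirs n (fun y => 'D_(ed i) d y) x by move: dn => [_]; apply; exists i.
  have := vanishD _ _ hz (vanishN _ (vanishM sdi (sm_derive (ed i) zs) hd)).
  move=> hh; apply: vanish_near_eq (hh _ _ _); last 3 first.
  - by apply: sm_derive; apply: smD => //; exact: smM.
  - by apply: smN; apply: smM => //; exact: sm_derive.
  - by apply: smM => //; exact: sm_derive.
  apply: filterS2 (sm_near ds) (sm_near zs) => y dy zy.
  have dyi := sm_derive (ed i) dy; have dyi' := sm_derive (ed i') dy.
  have -> : 'D_(ed i) (fun y => 'D_(ed i') d y + zeta y * 'D_(ed i) d y) y =
     'D_(ed i) (fun y => 'D_(ed i') d y) y + 'D_(ed i) (fun y => zeta y * 'D_(ed i) d y) y.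
    exact: (deriveD (sm_derivable _ dyi') (sm_derivable _ (smM zy dyi))).
  have -> : 'D_(ed i) (fun y => zeta y * 'D_(ed i) d y) y =
     zeta y * 'D_(ed i) (fun y => 'D_(ed i) d y) y + 'D_(ed i) d y * 'D_(ed i) zeta y.
    exact: (deriveM (sm_derivable _ zy) (sm_derivable _ dyi)).
  exact: addr3K (@schwarz R _ d y (ed i') (ed i) dy).
split; first exact: d0.
move=> _ [l _ <-]; have [->|->] := neq_ord2 l ii'; first exact: dni.
have := vanishD _ _ H (vanishN _ (vanishM sdi zs dni)).
move=> hh; apply: vanish_near_eq (hh _ _ _); last 3 first.
- by apply: smD => //; exact: smM.
- by apply: smN; exact: smM.
- exact: smM.
by apply: filterS (sm_near ds) => y _; exact: addrMK.
Qed.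

End VanishPlane.

(** * The Cauchy problem for a quasilinear equation, by characteristics *)

Section Cauchy.
Context {R : realType}.

Lemma derive_fstE (V W X : normedModType R) (f : V * W -> X) (x v : V) (y : W) :
  'D_(v, 0) f (x, y) = 'D_v (fun z => f (z, y)) x.
Proof.
have E : (fun h : R => h^-1 *: ((f \o shift (x, y)) (h *: (v, 0)) - f (x, y))) =
   (fun h : R => h^-1 *: (((fun z => f (z, y)) \o shift x) (h *: v) - f (x, y))).
  apply/funext => h /=; congr (_ *: (f _ - _)).
  by apply: injective_projections => //=; rewrite scaler0 add0r.
by rewrite /derive E.
Qed.

Lemma derive_sndE (V W X : normedModType R) (f : V * W -> X) (x : V) (y v : W) :
  'D_(0, v) f (x, y) = 'D_v (fun z => f (x, z)) y.
Proof.
have E : (fun h : R => h^-1 *: ((f \o shift (x, y)) (h *: (0, v)) - f (x, y))) =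
   (fun h : R => h^-1 *: (((fun z => f (x, z)) \o shift y) (h *: v) - f (x, y))).
  apply/funext => h /=; congr (_ *: (f _ - _)).
  by apply: injective_projections => //=; rewrite scaler0 add0r.
by rewrite /derive E.
Qed.

Lemma sm_fst_comp (V W X : normedModType R) (fV : fdim V) (fW : fdim W) (fX : fdim X) (f : V -> W * X) x :
  sm f x -> sm (fun y => (f y).1) x.
Proof. by move=> fx; apply: (@sm_comp _ _ _ _ _ _ f fst _ fx); exact: sm_fst. Qed.

Lemma sm_snd_comp (V W X : normedModType R) (fV : fdim V) (fW : fdim W) (fX : fdim X) (f : V -> W * X) x :
  sm f x -> sm (fun y => (f y).2) x.
Proof. by move=> fx; apply: (@sm_comp _ _ _ _ _ _ f snd _ fx); exact: sm_snd. Qed.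

Lemma near_cont (V W : normedModType R) (f : V -> W) x (A : set W) :
  {for x, continuous f} -> (\forall y \near f x, A y) -> \forall y \near x, A (f y).
Proof. by move=> fc nA; exact: (fc _ nA). Qed.

Lemma near_sm (V W : normedModType R) (f : V -> W) x (A : set W) :
  sm f x -> (\forall y \near f x, A y) -> \forall y \near x, A (f y).
Proof. by move=> /sm_cont; exact: near_cont. Qed.

Lemma near_near (V : normedModType R) (x : V) (A : set V) :
  (\forall y \near x, A y) -> \forall y \near x, \forall z \near y, A z.
Proof. exact: nbhs_interior. Qed.

Lemma filter2 (V : normedModType R) (x : V) (A B C : set V) :
  (forall y, A y -> B y -> C y) ->
  (\forall y \near x, A y) -> (\forall y \near x, B y) -> \forall y \near x, C y.
Proof. by move=> H a b; apply: filterS2 a b. Qed.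

Lemma filter1 (V : normedModType R) (x : V) (A C : set V) :
  (forall y, A y -> C y) -> (\forall y \near x, A y) -> \forall y \near x, C y.
Proof. by move=> H a; apply: filterS a. Qed.

Lemma near_and (V : normedModType R) (x : V) (A B : set V) :
  (\forall y \near x, A y) -> (\forall y \near x, B y) -> \forall y \near x, A y /\ B y.
Proof. exact: filterI. Qed.

Lemma near_at (V : normedModType R) (x : V) (A : set V) : (\forall y \near x, A y) -> A x.
Proof. exact: nbhs_singleton. Qed.

Lemma derive1_near_const (V : normedModType R) (f : R -> V) (g : R -> V) (t : R) (df dg : V) :
  (\forall s \near t, f s = g s) -> is_derive t 1 f df -> is_derive t 1 g dg -> df = dg.
Proof. by move=> fg [_ <-] [_ <-]; exact: near_eq_derive. Qed.

Section Data.
Variables (T : normedModType R) (fT : fdim T) (i i' : 'I_2) (hh zt : 'rV[R]_2 * R -> R)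
  (X1 : T -> 'rV[R]_2) (gam : R * T -> R) (x0 : 'rV[R]_2) (v0 : R) (t0 : T).
Hypotheses (ii' : i != i') (hs : sm hh (x0, v0)) (zs : sm zt (x0, v0))
  (X1s : sm X1 t0) (X10 : X1 t0 = x0) (gams : sm gam (0, t0)) (gam0 : gam (0, t0) = v0).

Let Z (p : 'rV[R]_2 * R) : 'rV[R]_2 * R := (zt p *: ed i + ed i', hh p).

Lemma ed_coord (l m : 'I_2) : (ed l : 'rV[R]_2) 0 m = (m == l)%:R.
Proof. by rewrite /ed mxE eqxx. Qed.

Let sm_Z : sm Z (x0, v0).
Proof.
apply: sm_pair => //; apply: smD; last exact: sm_cst.
apply: sm_rowP => l; under eq_fun do rewrite mxE.
by apply: smM => //; exact: sm_cst.
Qed.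

(** Instead of inverting the characteristic map, the value v = u(x) is defined implicitly: the
    characteristic through (x, v), followed back to the initial line, must meet the prescribed data
    there. The implicit function theorem gives a solution depending smoothly on the parameter of the
    line and of the data. *)
Theorem cauchy_family : exists uf : 'rV[R]_2 * T -> R,
  [/\ sm uf (x0, t0), uf (x0, t0) = v0,
   \forall p \near (x0, t0), 'D_(ed i', 0) uf p + zt (p.1, uf p) * 'D_(ed i, 0) uf p = hh (p.1, uf p) &
   \forall p \near (0 : R, t0), uf (X1 p.2 + p.1 *: ed i, p.2) = gam p].
Proof.
have [phi Hphi] := flow _ sm_Z.
pose fl (p : R * ('rV[R]_2 * R)) := phi p.1 p.2.
have sfl : sm fl (0, (x0, v0)) by have [] := near_at Hphi.
have fl0 : fl (0, (x0, v0)) = (x0, v0) by have [] := near_at Hphi.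
have [e e0 He] := (@near_box _ _ (x0, v0) _).1 Hphi.
(* The last clause records that the coordinate i' moves at unit speed along characteristics, so
   travel times are read off from it. *)
pose N1 (p : R * ('rV[R]_2 * R)) := [/\ sm fl p, is_derive p.1 1 (fun t => phi t p.2) (Z (fl p)),
   phi 0 p.2 = p.2, phi (- p.1) (fl p) = p.2 & (fl p).1 0 i' = p.2.1 0 i' + p.1].
have n1 : \forall p \near (0 : R, (x0, v0)), N1 p.
  apply/near_box; exists e => // t w te we; have [h1 h2 h3 h4] := He t w te we; split=> //=.
  rewrite /= in h3; rewrite /fl /= -[in RHS]h3 -[X in _ + X]mulr1.
  apply: (@curve_affine R R _ (fun s => (phi s w).1 0 i') 1 e) => // s se.
  have [_ ds _ _] := He s w se we.
  have sg : sm (fun p : 'rV[R]_2 * R => p.1 0 i') (phi s w).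
    by apply: sm_coordF; exact: sm_fst.
  have := is_derive_curve ds (sm_diff sg); congr is_derive.
  have lf : linear_for *%R (fun p : 'rV[R]_2 * R => p.1 0 i').
    by move=> a x y /=; rewrite !mxE.
  pose lM := GRing.isLinear.Build _ _ _ _ _ lf.
  pose Lf : {linear ('rV[R]_2 * R)%type -> R} := HB.pack (fun p : 'rV[R]_2 * R => p.1 0 i') lM.
  apply: (etrans (@derive_lin _ _ _ Lf _ _ _)) => [y|].
    by apply: sm_cont; apply: sm_coordF; exact: sm_fst.
  by rewrite /= !mxE !eqxx (negbTE (_ : i' != i)) ?mulr0 ?add0r// eq_sym.
(* The time needed to come from [p.1] to the initial line through [X1 p.2]. In [F] below, [q] is the
   point of arrival and is compared with the data [gam]. *)
pose tm (p : 'rV[R]_2 * T) := X1 p.2 0 i' - p.1 0 i'.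
pose m1 (a : ('rV[R]_2 * T) * R) : R * ('rV[R]_2 * R) := (tm a.1, (a.1.1, a.2)).
pose q (a : ('rV[R]_2 * T) * R) := fl (m1 a).
pose F (a : ('rV[R]_2 * T) * R) := (q a).2 - gam ((q a).1 0 i - X1 a.1.2 0 i, a.1.2).
pose a0 : ('rV[R]_2 * T) * R := ((x0, t0), v0).
have sX1c (V : normedModType R) (fV : fdim V) (f : V -> T) x l : sm f x -> f x = t0 ->
    sm (fun y => X1 (f y) 0 l) x.
  by move=> fx fx0; apply: sm_coordF; apply: (@sm_comp _ _ _ _ _ _ f X1) => //; rewrite fx0.
have s11 : sm (fun a : ('rV[R]_2 * T) * R => a.1.1) a0 by apply: sm_fst_comp; exact: sm_fst.
have s12 : sm (fun a : ('rV[R]_2 * T) * R => a.1.2) a0 by apply: sm_snd_comp; exact: sm_fst.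
have s2 : sm (fun a : ('rV[R]_2 * T) * R => a.2) a0 by exact: sm_snd.
have sm1 : sm m1 a0.
  apply: sm_pair; last exact: sm_pair.
  by apply: smB; [exact: sX1c|exact: sm_coordF].
have m10 : m1 a0 = (0, (x0, v0)) by rewrite /m1 /tm /= X10 subrr.
have sq : sm q a0 by apply: (@sm_comp _ _ _ _ _ _ m1 fl) => //; rewrite m10.
have q0 : q a0 = (x0, v0) by rewrite /q m10.
have sqi : sm (fun a => (q a).1 0 i) a0 by apply: sm_coordF; exact: sm_fst_comp.
have sm2 : sm (fun a : ('rV[R]_2 * T) * R => ((q a).1 0 i - X1 a.1.2 0 i, a.1.2)) a0.
  by apply: sm_pair => //; apply: smB => //; exact: sX1c.
have sF : sm F a0.
  apply: smB; first exact: sm_snd_comp.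
  apply: (@sm_comp _ _ _ _ _ _ _ gam _ sm2); by rewrite /= q0 /= X10 subrr.
have F0 : F a0 = 0 by rewrite /F q0 /= X10 subrr gam0 subrr.
(* Over a point of the initial line the travel time is 0, so there [F] reduces to v - v0. *)
have Fv : 'D_(0, 1) F a0 != 0.
  rewrite /a0 derive_sndE.
  have nv : \forall v \near v0, v - v0 = F ((x0, t0), v).
    have s3 : sm (fun v : R => m1 ((x0, t0), v)) v0.
      apply: (@sm_comp _ _ _ _ _ _ (fun v : R => ((x0, t0), v)) m1) => //.
      by apply: sm_pair; [exact: sm_cst|exact: sm_id].
    have n1' : \forall p \near m1 ((x0, t0), v0), N1 p by rewrite -/a0 m10.
    have := near_sm s3 n1'; apply: filter1 => v [_ _ /= h _ _].
    have mv : m1 (x0, t0, v) = (0, (x0, v)) by rewrite /m1 /tm /= X10 subrr.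
    by rewrite /F /q /fl mv /= h /= X10 subrr gam0.
  rewrite -(near_eq_derive _ nv).
  have := @is_deriveB _ _ _ id (cst v0) v0 1 _ _ (is_derive_id _ _) (is_derive_cst _ _ _).
  by move=> [_]; rewrite subr0 => ->; exact: oner_neq0.
have [uf [ufs uf0 ufF ufU]] := ift _ sF F0 Fv.
exists uf; split=> //.
- pose a (p : 'rV[R]_2 * T) := (p, uf p).
  have sa : sm a (x0, t0) by apply: sm_pair => //; exact: sm_id.
  have a00 : a (x0, t0) = a0 by rewrite /a uf0.
  have sma : sm (fun p => m1 (a p)) (x0, t0).
    by apply: (@sm_comp _ _ _ _ _ _ a m1) => //; rewrite a00.
  have sqa : sm (fun p => q (a p)) (x0, t0).
    by apply: (@sm_comp _ _ _ _ _ _ a q) => //; rewrite a00.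
  have k1 : \forall p \near (x0, t0), N1 (m1 (a p)).
    by apply: near_sm sma _; rewrite a00 m10.
  have k2 : \forall p \near (x0, t0), \forall z \near (- tm p, q (a p)), N1 z.
    have sx : sm (fun p => (- tm p, q (a p))) (x0, t0).
      apply: sm_pair => //; apply: smN.
      exact: (sm_fst_comp _ _ _ sma).
    apply: (near_sm sx (A := fun b => \forall z \near b, N1 z)).
    have -> : (- tm (x0, t0), q (a (x0, t0))) = (0, (x0, v0)).
      by rewrite a00 q0 /tm /= X10 subrr oppr0.
    exact: near_near.
  have k3 : \forall p \near (x0, t0), \forall z \near (p, uf p), F z = 0 -> z.2 = uf z.1.
    apply: (near_sm sa (A := fun b => \forall z \near b, F z = 0 -> z.2 = uf z.1)).
    by rewrite a00; exact: near_near ufU.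
  have k4 := sm_near ufs.
  have := near_and (near_and k1 k2) (near_and (near_and k3 k4) ufF).
  apply: filter1 => p [[[h1 _ _ h4 h5] k2p] [[k3p ufp] Fp]].
  rewrite /= in h4 h5.
  pose qq := q (a p).
  have q1 : qq.1 0 i' = X1 p.2 0 i'.
    by rewrite /qq /q h5 /= /tm addrC subrK.
  have md : is_derive (- tm p) 1 (fun s => phi s qq) (Z (p.1, uf p)).
    by have [_ + _ _ _] := near_at k2p; rewrite /fl /= h4.
  have mc : {for - tm p, continuous (fun s => phi s qq)}.
    by have [d _] := md; apply: differentiable_continuous; exact/derivable1_diffP.
  have lineN : \forall s \near - tm p, N1 (s, qq).
    have sc : sm (fun s : R => (s, qq)) (- tm p) by apply: sm_pair; [exact: sm_id|exact: sm_cst].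
    exact: near_sm sc k2p.
  (* All points of one characteristic have the same point of arrival, hence are zeros of [F]; the
     uniqueness clause of [ift] places the characteristic in the graph of [uf], and differentiating
     along it yields the equation. *)
  have uniq : \forall s \near - tm p, uf ((phi s qq).1, p.2) = (phi s qq).2.
    have cc : {for - tm p, continuous (fun s => (((phi s qq).1, p.2), (phi s qq).2))}.
      pose ff (w : 'rV[R]_2 * R) := ((w.1, p.2), w.2).
      apply: (@continuous_comp _ _ _ (fun s => phi s qq) ff) => //.
      apply: sm_cont; apply: sm_pair; last exact: sm_snd.
      by apply: sm_pair; [exact: sm_fst|exact: sm_cst].
    have k3' : \forall z \near (((phi (- tm p) qq).1, p.2), (phi (- tm p) qq).2), F z = 0 -> z.2 = uf z.1.
      by rewrite /qq h4 /=; move: k3p; rewrite {1}[p]surjective_pairing.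
    have := near_and lineN (near_cont cc k3'); apply: filter1 => s [[_ _ _ g4 g5] /= FU].
    apply/esym/FU; rewrite /F /q /m1 /=.
    have -> : tm ((phi s qq).1, p.2) = - s.
      rewrite /tm /=; move: g5; rewrite /fl /= => ->.
      by rewrite q1 opprD addrA subrr add0r.
    rewrite /fl /= -surjective_pairing; move: g4; rewrite /fl /= => ->.
    exact: Fp.
  have d1 : is_derive (- tm p) 1 (fun s => uf ((phi s qq).1, p.2))
     ('D_((Z (p.1, uf p)).1, 0) uf p).
    pose f2 (w : 'rV[R]_2 * R) := uf (w.1, p.2).
    have sw : sm (fun w : 'rV[R]_2 * R => (w.1, p.2)) (phi (- tm p) qq).
      by apply: sm_pair; [exact: sm_fst|exact: sm_cst].
    have pE : ((phi (- tm p) qq).1, p.2) = p by rewrite /qq h4 /= -surjective_pairing.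
    have uw : sm uf ((phi (- tm p) qq).1, p.2) by rewrite pE.
    have sf2 : sm f2 (phi (- tm p) qq) by apply: (@sm_comp _ _ _ _ _ _ (fun w : 'rV[R]_2 * R => (w.1, p.2)) uf).
    have := is_derive_curve md (sm_diff sf2); congr is_derive.
    rewrite /f2 (@derive_comp _ _ _ _ (fun w : 'rV[R]_2 * R => (w.1, p.2)) uf); last 2 first.
    + exact: sm_diff sw.
    + exact: sm_diff uw.
    rewrite pE; congr ('D__ uf p).
    rewrite derive_pair; last 2 first.
    + by apply: sm_diff; exact: sm_fst.
    + by apply: sm_diff; exact: sm_cst.
    rewrite derive_cst; congr (_, _).
    have lf : linear (@fst 'rV[R]_2 R) by [].
    pose lM := GRing.isLinear.Build _ _ _ _ _ lf.
    pose Lf : {linear ('rV[R]_2 * R)%type -> 'rV[R]_2} := HB.pack (@fst 'rV[R]_2 R) lM.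
    apply: (etrans (@derive_lin _ _ _ Lf _ _ _)) => // y.
    by apply: sm_cont; exact: sm_fst.
  have d2 : is_derive (- tm p) 1 (fun s => (phi s qq).2) (hh (p.1, uf p)).
    have := is_derive_curve md (sm_diff (sm_snd _)); congr is_derive.
    have lf : linear_for *%R (@snd 'rV[R]_2 R) by [].
    pose lM := GRing.isLinear.Build _ _ _ _ _ lf.
    pose Lf : {linear ('rV[R]_2 * R)%type -> R} := HB.pack (@snd 'rV[R]_2 R) lM.
    apply: (etrans (@derive_lin _ _ _ Lf _ _ _)) => // y.
    by apply: sm_cont; exact: sm_snd.
  have E := derive1_near_const uniq d1 d2; rewrite -E /Z /=.
  have -> : (zt (p.1, uf p) *: ed i + ed i', 0) =
     zt (p.1, uf p) *: (ed i, 0) + (ed i', 0) :> 'rV[R]_2 * T.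
    by apply: injective_projections => //=; rewrite scaler0 addr0.
  by rewrite deriveDv ?deriveZv; [rewrite addrC| exact: sm_diff|exact: sm_diff].
- pose y (p : R * T) := (X1 p.2 + p.1 *: ed i, p.2).
  have sy : sm y (0, t0).
    apply: sm_pair; last exact: sm_snd.
    apply: smD; first by apply: (@sm_comp _ _ _ _ _ _ snd X1) => //; exact: sm_snd.
    apply: sm_rowP => l; under eq_fun do rewrite mxE.
    by apply: smM; [exact: sm_fst|exact: sm_cst].
  have y0 : y (0, t0) = (x0, t0) by rewrite /y /= scale0r addr0 X10.
  pose a (p : R * T) := (y p, uf (y p)).
  have sa : sm a (0, t0).
    by apply: sm_pair => //; apply: (@sm_comp _ _ _ _ _ _ y uf) => //; rewrite y0.
  have a00 : a (0, t0) = a0 by rewrite /a y0 uf0.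
  have sma : sm (fun p => m1 (a p)) (0, t0).
    by apply: (@sm_comp _ _ _ _ _ _ a m1) => //; rewrite a00.
  have k1 : \forall p \near (0 : R, t0), N1 (m1 (a p)).
    by apply: near_sm sma _; rewrite a00 m10.
  have k2 : \forall p \near (0 : R, t0), F (a p) = 0.
    by apply: (near_sm sy (A := fun z => F (z, uf z) = 0)); rewrite y0.
  have := near_and k1 k2; apply: filter1 => -[s t] /= [[_ _ /= h _ _]].
  have m1E : m1 (a (s, t)) = (0, ((X1 t + s *: ed i), uf (y (s, t)))).
    rewrite /m1 /tm /=; congr (_, _).
    by rewrite !mxE ?eqxx (negbTE (_ : i' != i)) ?mulr0 ?addr0 ?subrr// eq_sym.
  rewrite /F /q m1E /fl /= h /= => /eqP; rewrite subr_eq0 => /eqP ->.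
  congr (gam (_, _)); rewrite !mxE !eqxx mulr1.
  by rewrite addrAC subrr add0r.
Qed.

End Data.
End Cauchy.

(** * Iterated Lie derivatives and pure jets *)

Section Lie.
Context {R : realType}.

Definition lieD (S : normedModType R) (A : S -> S) (n : nat) (c : S -> R) : S -> R :=
  iter n (fun c s => 'D_(A s) c s) c.

Lemma sm_lieD (S : normedModType R) (fS : fdim S) (A : S -> S) n (c : S -> R) s :
  sm A s -> sm c s -> sm (lieD A n c) s.
Proof. by move=> As cs; elim: n => [//|n IH]; exact: sm_dirD. Qed.

(** If [Z] follows the field [A] in direction [e], each derivative along [e] of a function of [Z] is
    a Lie derivative along [A], by the chain rule. *)
Lemma lie_comp (V S : normedModType R) (fV : fdim V) (fS : fdim S) (Z : V -> S) (e x : V)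
    (A : S -> S) n (c : S -> R) :
  sm Z x -> sm A (Z x) -> sm c (Z x) -> (\forall y \near x, 'D_e Z y = A (Z y)) ->
  \forall y \near x, iderive (nseq n e) (fun y => c (Z y)) y = lieD A n c (Z y).
Proof.
move=> Zs As cs ZA; elim: n => [|n IH]; first exact: filter1 ZA.
have s1 := near_sm Zs (sm_near (sm_lieD fS n As cs)).
have := near_and (near_and (near_near IH) ZA) (near_and s1 (sm_near Zs)).
apply: filter1 => y [[IHy ZAy] [s1y Zy]].
transitivity ('D_e (fun y => lieD A n c (Z y)) y); first exact: near_eq_derive.
rewrite (@derive_comp _ _ _ _ Z (lieD A n c)); [|exact: sm_diff|exact: sm_diff].
by rewrite ZAy.
Qed.

Lemma derive_lineE (V W : normedModType R) (f : V -> W) (x e : V) (s : R) :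
  'D_1 (fun s : R => f (x + s *: e)) s = 'D_e f (x + s *: e).
Proof.
have E : (fun h : R => h^-1 *: (((fun s : R => f (x + s *: e)) \o shift s) (h *: (1 : R)) - f (x + s *: e))) =
   (fun h : R => h^-1 *: ((f \o shift (x + s *: e)) (h *: e) - f (x + s *: e))).
  apply/funext => h /=; congr (_ *: (f _ - _)).
  by rewrite [h *: 1]mulr1 scalerDl addrCA.
by rewrite /derive E.
Qed.

Lemma iderive_lineE (V W : normedModType R) n (f : V -> W) (x e : V) (s : R) :
  iderive (nseq n (1 : R)) (fun s : R => f (x + s *: e)) s = iderive (nseq n e) f (x + s *: e).
Proof.
elim: n s => [//|n IH] s.
transitivity ('D_1 (fun s : R => iderive (nseq n e) f (x + s *: e)) s); last exact: derive_lineE.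
rewrite /=; congr ('D_1 _ s); exact/funext.
Qed.

Lemma iderive_line0 (V W : normedModType R) n (f : V -> W) (x e : V) :
  (\forall s \near (0 : R), f (x + s *: e) = 0) -> iderive (nseq n e) f x = 0.
Proof.
move=> H; have := iderive_near_eq (nseq n (1 : R)) H.
by rewrite iderive_lineE iderive0 scale0r addr0.
Qed.

Lemma iderive_sm_near (V W : normedModType R) (s : seq V) (f g : V -> W) x :
  sm f x -> sm g x -> iderive s (fun y => f y - g y) x = iderive s f x - iderive s g x.
Proof.
elim: s x => [//|v s IH] x fs gs /=.
have H : \forall y \near x, iderive s (fun y => f y - g y) y = iderive s f y - iderive s g y.
  by have := near_and (sm_near fs) (sm_near gs); apply: filter1 => y [/IH]; apply.
rewrite (near_eq_derive v H); apply: deriveB; apply: sm_derivable; exact: sm_iderive.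
Qed.

Section VanishComponents.
Context {V : normedModType R} (D : set V).

Definition vanishv (W : normedModType R) {fW : fdim W} n (F1 F2 : V -> W) x :=
  forall l : 'I_(@fd_n _ _ fW), vanish D n (fun y => fd_c (F1 y) l - fd_c (F2 y) l) x.

Lemma vanishv_refl (W : normedModType R) (fW : fdim W) n (F : V -> W) x : vanishv n F F x.
Proof.
move=> l; apply: (vanish_near_eq (f := fun=> 0)); last exact: vanish_cst0.
by apply: nearW => y; rewrite subrr.
Qed.

Lemma vanishv_pair (W X : normedModType R) (fW : fdim W) (fX : fdim X) n
    (f1 f2 : V -> W) (g1 g2 : V -> X) x : vanishv n f1 f2 x -> vanishv n g1 g2 x ->
  vanishv n (fun y => (f1 y, g1 y)) (fun y => (f2 y, g2 y)) x.
Proof.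
move=> Hf Hg l; rewrite /fd_c /=.
case: (split_ordP l) => a ->.
- apply: vanish_near_eq (Hf a); apply: nearW => y.
  by rewrite /fd_pf /fd_c !row_mxEl.
- apply: vanish_near_eq (Hg a); apply: nearW => y.
  by rewrite /fd_pf /fd_c !row_mxEr.
Qed.

Lemma vanishv_R n (f1 f2 : V -> R) x : vanish D n (fun y => f1 y - f2 y) x -> vanishv n f1 f2 x.
Proof.
by move=> H l; apply: vanish_near_eq H; apply: nearW => y; rewrite /fd_c /= /rv1 !mxE.
Qed.

Lemma vanishv_rV m n (f1 f2 : V -> 'rV[R]_m) x :
  (forall a, vanish D n (fun y => f1 y 0 a - f2 y 0 a) x) -> vanishv n f1 f2 x.
Proof. by move=> H l; exact: H. Qed.

End VanishComponents.

Lemma pure_iderive (i : 'I_2) a (u : 'rV[R]_2 -> R) :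
  pder (mshift i a (0, 0)%N) u = iderive (nseq a (ed i)) u.
Proof.
have [->|->] := neq_ord2 i (isT : (0 : 'I_2) != 1); rewrite /mshift /pder /=.
- by rewrite add0n cats0.
- by rewrite add0n.
Qed.

Lemma pure_jetE (i : 'I_2) k n u (y : 'rV[R]_2) : (k <= n)%N ->
  pure_jet i k (jet n u y) = (y, \row_(a < k.+1) iderive (nseq a (ed i)) u y).
Proof.
move=> kn; rewrite /pure_jet; congr (_, _); apply/rowP => a; rewrite !mxE.
have an : (a <= n)%N by apply: leq_trans kn; rewrite -ltnS.
rewrite -pure_iderive ju_jet // /mshift.
by case: ifP => _ /=; rewrite ?addn0 ?add0n.
Qed.

(** Identifies pairs (x, u) with points of J^0, whose fibre is formally a space of row vectors
    indexed by multi-indices. *)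
Definition emb (p : 'rV[R]_2 * R) : jet_space R 0 := mkjet 0 p.1 (fun=> p.2).

Lemma jet0E u (y : 'rV[R]_2) : jet 0 u y = emb (y, u y).
Proof.
rewrite /jet /emb /mkjet; congr (_, _); apply/rowP => p; rewrite !mxE.
have := mi_le p; rewrite leqn0 addn_eq0 => /andP[/eqP a0 /eqP b0].
by rewrite /pder a0 b0.
Qed.

Lemma sm_emb p : sm emb p.
Proof.
apply: sm_pair; first exact: sm_fst.
by apply: sm_rowP => l; under eq_fun do rewrite mxE; exact: sm_snd.
Qed.

Lemma invariant_pde (i i' : 'I_2) (xi : 'I_2 -> jet_space R 0 -> R) (eta : jet_space R 0 -> R)
    (u : 'rV[R]_2 -> R) y : i != i' -> sm u y -> xi i' (emb (y, u y)) != 0 ->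
  characteristic xi eta (jet 1 u y) =
  xi i' (emb (y, u y)) * (eta (emb (y, u y)) / xi i' (emb (y, u y))
    - xi i (emb (y, u y)) / xi i' (emb (y, u y)) * 'D_(ed i) u y - 'D_(ed i') u y).
Proof.
move=> ii' us x0; rewrite charE// jet0E.
rewrite (bigD1 i)//= (bigD1 i')/=; last by rewrite eq_sym.
rewrite big1 ?addr0; last first.
  by move=> l /andP[li li']; have [E|E] := neq_ord2 l ii'; rewrite E eqxx in li li'.
move: ('D_(ed i) u y) ('D_(ed i') u y) x0 => a b; move: (xi i' _) (xi i _) (eta _) => p q h p0.
by field.
Qed.

End Lie.

(** * Solving for the highest derivative *)

Section Top.
Context {R : realType} {k : nat}.
Local Notation S := ('rV[R]_2 * 'rV[R]_k)%type.

Definition snoc (w : 'rV[R]_k) (v : R) : 'rV[R]_k.+1 :=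
  \row_a (if unlift ord_max a is Some b then w 0 b else v).

Lemma snoc_lift w v (a : 'I_k) : snoc w v 0 (widen_ord (leqnSn k) a) = w 0 a.
Proof.
rewrite mxE; have -> : widen_ord (leqnSn k) a = lift ord_max a.
  by apply: ord_inj; rewrite lift_max.
by rewrite liftK.
Qed.

Lemma snoc_max w v : snoc w v 0 ord_max = v.
Proof. by rewrite mxE unlift_none. Qed.

Lemma snocE (a : 'I_k.+1) : (exists b : 'I_k, a = widen_ord (leqnSn k) b) \/ a = ord_max.
Proof.
case: (unliftP ord_max a) => [b ->|->]; last by right.
by left; exists b; apply: ord_inj; rewrite lift_max.
Qed.

Lemma snocP (c : nat -> R) (w : 'rV[R]_k) (v : R) : (forall a : 'I_k, w 0 a = c a) -> v = c k ->
  snoc w v = \row_(a < k.+1) c a.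
Proof.
move=> wc vc; apply/rowP => a; rewrite [RHS]mxE.
by have [[b ->]|->] := snocE a; rewrite ?snoc_lift ?snoc_max.
Qed.

Lemma sm_snoc (V : normedModType R) (w : V -> 'rV[R]_k) (v : V -> R) x :
  sm w x -> sm v x -> sm (fun y => snoc (w y) (v y)) x.
Proof.
move=> ws vs; apply: sm_rowP => a.
have [[b ->]|->] := snocE a; last by under eq_fun do rewrite snoc_max.
by under eq_fun do rewrite snoc_lift; exact: sm_coordF.
Qed.

(** The value of [G] is kept as an extra argument of [gt]: the highest derivative is solved from G =
    c for every small c, not for c = 0 alone. The resulting formula can then be differentiated
    across G = 0. *)
Lemma solve_top (G : 'rV[R]_2 * 'rV[R]_k.+1 -> R) (s0 : S) (v0 : R) :
  sm G (s0.1, snoc s0.2 v0) -> G (s0.1, snoc s0.2 v0) = 0 ->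
  'D_(0, delta_mx 0 ord_max) G (s0.1, snoc s0.2 v0) != 0 ->
  exists gt : S * R -> R, [/\ sm gt (s0, 0), gt (s0, 0) = v0,
   \forall p \near (s0, 0 : R), G (p.1.1, snoc p.1.2 (gt p)) = p.2 &
   \forall p \near ((s0, 0 : R), v0), G (p.1.1.1, snoc p.1.1.2 p.2) = p.1.2 -> p.2 = gt p.1].
Proof.
move=> Gs G0 Gn.
pose F (p : (S * R) * R) := G (p.1.1.1, snoc p.1.1.2 p.2) - p.1.2.
pose m (p : (S * R) * R) := (p.1.1.1, snoc p.1.1.2 p.2).
have sm_m p : sm m p.
  have s1 : sm (fun p : (S * R) * R => p.1.1) p by apply: sm_fst_comp; exact: sm_fst.
  apply: sm_pair; first exact: sm_fst_comp.
  by apply: sm_snoc; [exact: sm_snd_comp|exact: sm_snd].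
have Fs : sm F ((s0, 0), v0).
  apply: smB; first by apply: (@sm_comp _ _ _ _ _ _ m G).
  by apply: sm_snd_comp; exact: sm_fst.
have F0 : F ((s0, 0), v0) = 0 by rewrite /F /= G0 subrr.
have Fn : 'D_(0, 1) F ((s0, 0), v0) != 0.
  rewrite derive_sndE; have -> : (fun v => F ((s0, 0), v)) = (fun v => G (s0.1, snoc s0.2 v)).
    by apply/funext => v; rewrite /F /= subr0.
  have sv : sm (fun v : R => (s0.1, snoc s0.2 v)) v0.
    by apply: sm_pair; [exact: sm_cst|apply: sm_snoc; [exact: sm_cst|exact: sm_id]].
  rewrite (@derive_comp _ _ _ _ (fun v : R => (s0.1, snoc s0.2 v)) G); [|exact: sm_diff|exact: sm_diff].
  suff -> : 'D_1 (fun v : R => (s0.1, snoc s0.2 v)) v0 = (0, delta_mx 0 ord_max) by [].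
  rewrite derive_pair; [|by apply: sm_diff; exact: sm_cst|
    by apply: sm_diff; apply: sm_snoc; [exact: sm_cst|exact: sm_id]].
  rewrite derive_cst; congr (_, _); apply/rowP => a.
  rewrite derive_rowE; last by apply: sm_derivable; apply: sm_snoc; [exact: sm_cst|exact: sm_id].
  rewrite mxE eqxx /=; have [[b ->]|->] := snocE a.
  - under eq_fun do rewrite snoc_lift; rewrite derive_cst.
    by rewrite (_ : _ == _ = false)//; apply/eqP => /(congr1 val) /= E; have := ltn_ord b; rewrite E ltnn.
  - by under eq_fun do rewrite snoc_max; rewrite derive_id eqxx.
have [gt [gs g0 gF gU]] := ift _ Fs F0 Fn.
exists gt; split=> //.
- by apply: filter1 gF => p /eqP; rewrite subr_eq0 => /eqP.
- by apply: filter1 gU => p H E; apply: H; rewrite /F E subrr.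
Qed.

End Top.

(** * Rigidity: the r-jet is determined by the pure derivatives up to order k *)

Section Rigidity.
Context {R : realType}.

Lemma near_neq0 (V : normedModType R) (f : V -> R) x :
  sm f x -> f x != 0 -> \forall y \near x, f y != 0.
Proof. by move=> fx f0; have /cvgr_neq0 := sm_cont fx; exact. Qed.

Lemma near_all (V : normedModType R) (x : V) (A : set V) : (forall y, A y) -> \forall y \near x, A y.
Proof. exact: nearW. Qed.

Variables (r k : nat) (xi : 'I_2 -> jet_space R 0 -> R) (eta : jet_space R 0 -> R)
  (i i' : 'I_2) (G : 'rV[R]_2 * 'rV[R]_k.+1 -> R).
Hypotheses (kr : (k <= r)%N) (ii' : i != i').

Definition wjet (u : 'rV[R]_2 -> R) y : 'rV[R]_k := \row_(a < k) iderive (nseq a (ed i)) u y.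

Lemma pure_jet_snoc n u y : (k <= n)%N ->
  pure_jet i k (jet n u y) = (y, snoc (wjet u y) (iderive (nseq k (ed i)) u y)).
Proof.
move=> kn; rewrite pure_jetE//; congr (_, _); apply/esym.
by apply: (snocP (c := fun a => iderive (nseq a (ed i)) u y)) => // a; rewrite mxE.
Qed.

Lemma sm_wjet u y : sm u y -> sm (wjet u) y.
Proof.
move=> us; apply: sm_rowP => a; under eq_fun do rewrite mxE.
exact: sm_iderive.
Qed.

(* In the coordinates (x, u), Q[u] = 0 reads u_i' + zta u_i = hta. *)
Definition hta (q : 'rV[R]_2 * R) := eta (emb q) / xi i' (emb q).
Definition zta (q : 'rV[R]_2 * R) := xi i (emb q) / xi i' (emb q).

Lemma sm_hta q : sm eta (emb q) -> sm (xi i') (emb q) -> xi i' (emb q) != 0 -> sm hta q.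
Proof.
by move=> es xs xn; apply: smM; [|apply: smV => //];
  apply: (@sm_comp _ _ _ _ _ _ emb) => //; exact: sm_emb.
Qed.

Lemma sm_zta q : sm (xi i) (emb q) -> sm (xi i') (emb q) -> xi i' (emb q) != 0 -> sm zta q.
Proof.
by move=> es xs xn; apply: smM; [|apply: smV => //];
  apply: (@sm_comp _ _ _ _ _ _ emb) => //; exact: sm_emb.
Qed.

Lemma char_hz u y : sm u y -> xi i' (emb (y, u y)) != 0 ->
  characteristic xi eta (jet 1 u y) =
  xi i' (emb (y, u y)) * (hta (y, u y) - zta (y, u y) * 'D_(ed i) u y - 'D_(ed i') u y).
Proof. exact: invariant_pde. Qed.

(** The differential consequences of Q[u] = 0 and of G = 0 at one point, as orders of vanishing. As
    Q[u] has order 1 and G order k, consequences within J^r mean orders r - 1 and r - k; for G only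
    direction i is recorded. *)
Definition good_jet (u : 'rV[R]_2 -> R) x :=
  [/\ sm u x, vanish dirs r.-1 (fun y => characteristic xi eta (jet 1 u y)) x &
      vanish [set ed i] (r - k) (fun y => G (pure_jet i k (jet k u y))) x].

Section TwoJets.
Variables (u p : 'rV[R]_2 -> R) (x : 'rV[R]_2).
Hypotheses (us : good_jet u x) (ps : good_jet p x)
  (up : forall a, (a <= k)%N -> iderive (nseq a (ed i)) u x = iderive (nseq a (ed i)) p x)
  (Gs : sm G (pure_jet i k (jet k p x)))
  (Gn : 'D_(0, delta_mx 0 ord_max) G (pure_jet i k (jet k p x)) != 0)
  (xs : forall l, sm (xi l) (jet 0 p x)) (es : sm eta (jet 0 p x))
  (xn : xi i' (jet 0 p x) != 0).

Let d y := u y - p y.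

Let sm_d : sm d x.
Proof. by have [? _ _] := us; have [? _ _] := ps; exact: smB. Qed.

(** The highest pure derivative of either function is [gt] of its lower ones and of the value of G,
    and the latter vanishes to order r - k for both. Agreement up to order n thus passes to order n
    + 1. *)
Lemma rigid_pure : vanish [set ed i] r d x.
Proof.
have [su _ Gu] := us; have [sp _ Gp] := ps.
pose v0 := iderive (nseq k (ed i)) p x; pose s0 := (x, wjet p x).
have pj : pure_jet i k (jet k p x) = (s0.1, snoc s0.2 v0) by rewrite pure_jet_snoc.
have dE a y : sm u y -> sm p y -> iderive (nseq a (ed i)) d y =
    iderive (nseq a (ed i)) u y - iderive (nseq a (ed i)) p y.
  exact: iderive_sm_near.
have G0 : G (s0.1, snoc s0.2 v0) = 0 by rewrite -pj; exact: vanish0 Gp.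
have Gs' := Gs; have Gn' := Gn; rewrite pj in Gs' Gn'.
have [gt [gs g0 gF gU]] := solve_top Gs' G0 Gn'.
pose Ga (f : 'rV[R]_2 -> R) y := G (pure_jet i k (jet k f y)).
have GaE f y : Ga f y = G (y, snoc (wjet f y) (iderive (nseq k (ed i)) f y)).
  by rewrite /Ga pure_jet_snoc.
have wE : wjet u x = wjet p x.
  by apply/rowP => a; rewrite !mxE; apply: up; exact: ltnW.
have top f : sm f x -> wjet f x = wjet p x -> iderive (nseq k (ed i)) f x = v0 ->
   Ga f x = 0 -> sm (Ga f) x /\
   \forall y \near x, iderive (nseq k (ed i)) f y = gt ((y, wjet f y), Ga f y).
  move=> fs wf vf Gf0.
  have s1 : sm (fun y => (y, wjet f y)) x by apply: sm_pair; [exact: sm_id|exact: sm_wjet].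
  have s3 : sm (fun y => (y, snoc (wjet f y) (iderive (nseq k (ed i)) f y))) x.
    apply: sm_pair; first exact: sm_id.
    by apply: sm_snoc; [exact: sm_wjet|exact: sm_iderive].
  have s2 : sm (Ga f) x.
    have : sm (fun y => G (y, snoc (wjet f y) (iderive (nseq k (ed i)) f y))) x.
      apply: (@sm_comp _ _ _ _ _ _ (fun y => (y, snoc (wjet f y) (iderive (nseq k (ed i)) f y))) G) => //.
      by rewrite wf vf.
    by apply: sm_ext; apply: near_all => y; rewrite GaE.
  split=> //.
  have s4 : sm (fun y => (((y, wjet f y), Ga f y), iderive (nseq k (ed i)) f y)) x.
    by apply: sm_pair; [exact: sm_pair|exact: sm_iderive].
  have := near_sm s4 (A := fun q => G (q.1.1.1, snoc q.1.1.2 q.2) = q.1.2 -> q.2 = gt q.1).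
  rewrite /= wf vf Gf0 => /(_ gU); apply: filter1 => y /=; apply.
  by rewrite GaE.
have [sGu Eu] := top u su wE (up (leqnn k)) (vanish0 Gu).
have [sGp Ep] := top p sp erefl erefl (vanish0 Gp).
suff H n : (n <= r)%N -> forall a, (a <= n)%N -> iderive (nseq a (ed i)) d x = 0.
  by apply/vanish_pure => a ar; exact: H ar _ (leqnn a).
have base a : (a <= k)%N -> iderive (nseq a (ed i)) d x = 0.
  by move=> ak; rewrite dE// up// subrr.
elim: n => [|n IH] nr a an; first by apply: base; apply: leq_trans an _.
have [ak|ka] := leqP a k; first exact: base.
have {}IH := IH (ltnW nr).
have kn : (k <= n)%N by rewrite -ltnS (leq_trans ka).
have [/IH//|na] := leqP a n.
have -> : a = n.+1 by apply/eqP; rewrite eqn_leq an.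
(* The derivative of order n + 1 is the (n + 1 - k)th one of the kth. On the other side [gt] sees
   pure derivatives of order below k, and n + 1 - k further derivatives of these have order at most
   n. *)
suff V : vanish [set ed i] (n.+1 - k) (fun y => iderive (nseq k (ed i)) u y - iderive (nseq k (ed i)) p y) x.
  have := (vanish_pure _ _ _ _).1 V (n.+1 - k)%N (leqnn _).
  have Ed : \forall y \near x, iderive (nseq k (ed i)) u y - iderive (nseq k (ed i)) p y =
      iderive (nseq k (ed i)) d y.
    by have := near_and (sm_near su) (sm_near sp); apply: filter1 => y [uy py]; rewrite dE.
  rewrite (iderive_near_eq _ Ed) /iderive -foldr_cat -nseqD.
  by rewrite subnK// ltnW// ltnS.
have s1 f : sm f x -> sm (Ga f) x -> sm (fun y => ((y, wjet f y), Ga f y)) x.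
  by move=> fs Gfs; apply: sm_pair => //; apply: sm_pair; [exact: sm_id|exact: sm_wjet].
have : vanish [set ed i] (n.+1 - k) (fun y => gt ((y, wjet u y), Ga u y) - gt ((y, wjet p y), Ga p y)) x.
  apply: (vanish_comp (F1 := fun y => ((y, wjet u y), Ga u y)) (F2 := fun y => ((y, wjet p y), Ga p y))).
  - exact: s1.
  - exact: s1.
  - by rewrite /= wE (vanish0 Gu : Ga u x = 0).
  - by rewrite /= wE (vanish0 Gu : Ga u x = 0) (vanish0 Gp : Ga p x = 0).
  - apply: vanishv_pair.
      apply: vanishv_pair; first exact: vanishv_refl.
      apply: vanishv_rV => c; apply/vanish_pure => b bn.
      have Ed : \forall y \near x, (wjet u y) 0 c - (wjet p y) 0 c = iderive (nseq c (ed i)) d y.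
        by have := near_and (sm_near su) (sm_near sp); apply: filter1 => y [uy py]; rewrite !mxE dE.
      rewrite (iderive_near_eq _ Ed) /iderive -foldr_cat -nseqD; apply: IH.
      have := leq_add bn (ltn_ord c); rewrite addnS subnK//; exact: ltnW.
    apply: vanishv_R; apply: vanishD => //; first exact: smN.
      by apply: vanish_le Gu; apply: leq_sub2r.
    by apply: vanishN => //; apply: vanish_le Gp; apply: leq_sub2r.
apply: vanish_near_eq; have := near_and Eu Ep; apply: filter1 => y [-> ->].
by [].
Qed.

Lemma transport_eq (a b c e h1 h2 z1 z2 q1 q2 x1 x2 : R) : x1 != 0 -> x2 != 0 ->
  q1 = x1 * (h1 - z1 * b - a) -> q2 = x2 * (h2 - z2 * e - c) ->
  (h1 - h2) + (- ((z1 - z2) * b) + (- (q1 * x1^-1) + q2 * x2^-1)) = a - c + z2 * (b - e).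
Proof. by move=> x10 x20 -> ->; field; apply/andP. Qed.

(** The difference [d] satisfies a transport equation whose right-hand side consists of the
    differences of h and z at the two functions and of multiples of Q[u] and Q[p]. These vanish to
    order n by induction and by [good_jet], so [vanish_transport] raises the order starting from the
    pure derivatives. *)
Lemma rigid_all : vanish dirs r d x.
Proof.
have [su Qu _] := us; have [sp Qp _] := ps.
have u0 : u x = p x by have := up (leq0n k).
have xs' := xs; have es' := es; have xn' := xn; rewrite jet0E in es' xn'.
have {}xs' l : sm (xi l) (emb (x, p x)) by rewrite -jet0E.
have hs : sm hta (x, p x) by exact: sm_hta.
have zs : sm zta (x, p x) by exact: sm_zta.
have s1 f : sm f x -> sm (fun y => (y, f y)) x by move=> fs; apply: sm_pair => //; exact: sm_id.
have xis f : sm f x -> f x = p x -> sm (fun y => xi i' (emb (y, f y))) x.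
  move=> fs fp; apply: (@sm_comp _ _ _ _ _ _ (fun y => emb (y, f y))); last by rewrite fp.
  by apply: (@sm_comp _ _ _ _ _ _ (fun y => (y, f y)) emb) => //; [exact: s1|exact: sm_emb].
have szt f : sm f x -> f x = p x -> sm (fun y => zta (y, f y)) x.
  by move=> fs fp; apply: (@sm_comp _ _ _ _ _ _ (fun y => (y, f y))); [exact: s1|rewrite fp].
have sht f : sm f x -> f x = p x -> sm (fun y => hta (y, f y)) x.
  by move=> fs fp; apply: (@sm_comp _ _ _ _ _ _ (fun y => (y, f y))); [exact: s1|rewrite fp].
have nz f : sm f x -> f x = p x -> \forall y \near x, xi i' (emb (y, f y)) != 0.
  by move=> fs fp; apply: near_neq0; [exact: xis|rewrite fp].
have sQ f : sm f x -> f x = p x -> sm (fun y => characteristic xi eta (jet 1 f y)) x.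
  move=> fs fp.
  have E : \forall y \near x, xi i' (emb (y, f y)) * (hta (y, f y) - zta (y, f y) * 'D_(ed i) f y - 'D_(ed i') f y) =
       characteristic xi eta (jet 1 f y).
    by have := near_and (sm_near fs) (nz f fs fp); apply: filter1 => y [fy ny]; rewrite char_hz.
  apply: (sm_ext E); apply: smM; first exact: xis.
  apply: smB; last exact: sm_derive.
  by apply: smB; [exact: sht|apply: smM; [exact: szt|exact: sm_derive]].
have invs f : sm f x -> f x = p x -> sm (fun y => (xi i' (emb (y, f y)))^-1) x.
  by move=> fs fp; apply: smV; [exact: xis|rewrite fp].
suff H n : (n <= r)%N -> vanish dirs n d x by exact: H.
elim: n => [_|n IH nr]; first by split=> //; rewrite /d u0 subrr.
have {}IH := IH (ltnW nr).
apply: (@vanish_transport _ i i' n d (fun y => zta (y, p y))) => //; first exact: szt.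
  exact: vanish_le nr rigid_pure.
have vd : vanishv dirs n (fun y => (y, u y)) (fun y => (y, p y)) x.
  by apply: vanishv_pair; [exact: vanishv_refl|exact: vanishv_R].
have nr' : (n <= r.-1)%N by case: (r) nr.
have E : \forall y \near x,
   (hta (y, u y) - hta (y, p y)) + (- ((zta (y, u y) - zta (y, p y)) * 'D_(ed i) u y) +
     (- (characteristic xi eta (jet 1 u y) * (xi i' (emb (y, u y)))^-1) +
      characteristic xi eta (jet 1 p y) * (xi i' (emb (y, p y)))^-1)) =
   'D_(ed i') d y + zta (y, p y) * 'D_(ed i) d y.
  have := near_and (near_and (sm_near su) (sm_near sp)) (near_and (nz u su u0) (nz p sp erefl)).
  apply: filter1 => y [[uy py] [un pn]].
  have dd v : 'D_v d y = 'D_v u y - 'D_v p y.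
    by apply: deriveB; exact: sm_derivable.
  rewrite !dd; exact: (transport_eq un pn (char_hz uy un) (char_hz py pn)).
apply: (vanish_near_eq E).
have sD : sm (fun y => 'D_(ed i) u y) x by exact: sm_derive.
have sz1 : sm (fun y => zta (y, u y) - zta (y, p y)) x by apply: smB; exact: szt.
have sq1 : sm (fun y => characteristic xi eta (jet 1 u y) * (xi i' (emb (y, u y)))^-1) x.
  by apply: smM; [exact: sQ|exact: invs].
have sq2 : sm (fun y => characteristic xi eta (jet 1 p y) * (xi i' (emb (y, p y)))^-1) x.
  by apply: smM; [exact: sQ|exact: invs].
have spp : sm (fun y => (zta (y, u y) - zta (y, p y)) * 'D_(ed i) u y) x by exact: smM.
apply: vanishD.
- by apply: smB; exact: sht.
- by apply: smD; [exact: smN|apply: smD => //; exact: smN].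
- apply: (vanish_comp (F1 := fun y => (y, u y)) (F2 := fun y => (y, p y))); [exact: s1|exact: s1| | |exact: vd].
    by rewrite /= u0.
  by rewrite /= u0.
apply: vanishD.
- exact: smN.
- by apply: smD => //; exact: smN.
- apply: vanishN => //; apply: vanishM => //.
  apply: (vanish_comp (F1 := fun y => (y, u y)) (F2 := fun y => (y, p y))); [exact: s1|exact: s1| | |exact: vd].
    by rewrite /= u0.
  by rewrite /= u0.
apply: vanishD.
- exact: smN.
- by [].
- apply: vanishN => //; apply: vanishM; [exact: sQ|exact: invs|exact: vanish_le nr' Qu].
- apply: vanishM; [exact: sQ|exact: invs|exact: vanish_le nr' Qp].
Qed.

(** Ensures that auxiliary functions, constructed with prescribed pure derivatives only, have the
    given r-jet, and hence that the hypotheses near this jet apply to them. *)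
Lemma rigid_jet : jet r u x = jet r p x.
Proof.
have [su _ _] := us; have [sp _ _] := ps.
rewrite /jet /mkjet; congr (_, _); apply/rowP => l; rewrite !mxE.
have := (vanish_pder r sm_d).1 rigid_all (mi l).1 (mi l).2 (mi_le l).
rewrite /pder iderive_sm_near// => /eqP; rewrite subr_eq0 => /eqP.
by [].
Qed.

End TwoJets.
End Rigidity.

(** * Slices and lines *)

Section Fibers.
Context {R : realType}.

Lemma near_fst (V W : normedModType R) (fV : fdim V) (fW : fdim W) (a : V) (b : W) (A : set (V * W)) :
  (\forall z \near (a, b), A z) -> \forall y \near a, A (y, b).
Proof.
move=> H; have s : sm (fun y : V => (y, b)) a by apply: sm_pair; [exact: sm_id|exact: sm_cst].
exact: near_sm s H.
Qed.

Lemma near_snd (V W : normedModType R) (fV : fdim V) (fW : fdim W) (a : V) (b : W) (A : set (V * W)) :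
  (\forall z \near (a, b), A z) -> \forall y \near b, A (a, y).
Proof.
move=> H; have s : sm (fun y : W => (a, y)) b by apply: sm_pair; [exact: sm_cst|exact: sm_id].
exact: near_sm s H.
Qed.

Lemma iderive_fstE (V W X : normedModType R) (s : seq V) (f : V * W -> X) x y :
  iderive [seq (v, 0) | v <- s] f (x, y) = iderive s (fun z => f (z, y)) x.
Proof.
elim: s x => [//|v s IH] x /=; rewrite derive_fstE.
by congr ('D_v _ x); apply/funext => z; exact: IH.
Qed.

Lemma lie_line (V S : normedModType R) (fV : fdim V) (fS : fdim S) (Z : R -> S) (e x : V)
    (A : S -> S) n (c : S -> R) (f : V -> R) :
  sm Z 0 -> sm A (Z 0) -> sm c (Z 0) -> (\forall s \near (0 : R), 'D_1 Z s = A (Z s)) ->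
  (\forall s \near (0 : R), f (x + s *: e) = c (Z s)) ->
  \forall s \near (0 : R), iderive (nseq n e) f (x + s *: e) = lieD A n c (Z s).
Proof.
move=> Zs As cs ZA fc; have := near_and (near_near fc) (lie_comp (fdim_R R) fS n Zs As cs ZA).
apply: filter1 => s [E <-]; rewrite -iderive_lineE; exact: iderive_near_eq.
Qed.

End Fibers.

(** * The two vector fields of the total differential system *)

Section Fields.
Context {R : realType} {k : nat}.
Local Notation S := ('rV[R]_2 * 'rV[R]_k)%type.
Variables (i i' : 'I_2) (h z : 'rV[R]_2 * R -> R) (g : S -> R).

(* If u_(k) = g(x, u, ..., u_(k-1)) and u_i' = h - z u_i, then Afield and Bfield are the
   derivatives of (x, u, ..., u_(k-1)) in the directions i and i'. *)
Definition ucoord (s : S) : R := snoc s.2 (g s) 0 ord0.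
Definition Afield (s : S) : S := (ed i, \row_(a < k) snoc s.2 (g s) 0 (lift ord0 a)).
Definition bcoord (s : S) : R := h (s.1, ucoord s) - z (s.1, ucoord s) * 'D_(Afield s) ucoord s.
Definition Bfield (s : S) : S := (ed i', \row_(a < k) lieD Afield a bcoord s).

Lemma derive_coord2r (a : 'I_k) (s v : S) : 'D_v (fun s : S => s.2 0 a) s = v.2 0 a.
Proof.
have lf : linear_for *%R (fun s : S => s.2 0 a) by move=> c x y /=; rewrite !mxE.
pose lM := GRing.isLinear.Build _ _ _ _ _ lf.
pose Lf : {linear S -> R} := HB.pack (fun s : S => s.2 0 a) lM.
apply: (etrans (@derive_lin _ _ _ Lf _ _ _)) => // y.
by apply: sm_cont; apply: sm_coordF; exact: sm_snd.
Qed.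

(** Deriving the coordinate u along [Afield] runs through the coordinates of w in order and ends
    with g, as it must if w stands for (u, ..., u_i^(k-1)). *)
Lemma lieD_ucoord (a : nat) (ak : (a < k.+1)%N) s : lieD Afield a ucoord s = snoc s.2 (g s) 0 (Ordinal ak).
Proof.
elim: a ak s => [|a IH] ak s; first by congr (snoc _ _ _ _); exact: ord_inj.
have ak' : (a < k)%N by [].
have E : lieD Afield a ucoord = fun s : S => s.2 0 (Ordinal ak').
  apply/funext => t; rewrite (IH (ltnW ak)) -(snoc_lift t.2 (g t)).
  by congr (snoc _ _ _ _); exact: ord_inj.
rewrite [LHS]/= -/(lieD Afield a ucoord) E derive_coord2r mxE.
by congr (snoc _ _ _ _); apply: ord_inj; rewrite lift0.
Qed.

Lemma lieD_ucoord_lt (a : 'I_k) s : lieD Afield a ucoord s = s.2 0 a.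
Proof.
rewrite (lieD_ucoord (ltnW (ltn_ord a : (a.+1 < k.+1)%N))) -(snoc_lift s.2 (g s)).
by congr (snoc _ _ _ _); exact: ord_inj.
Qed.

Lemma lieD_ucoord_max s : lieD Afield k ucoord s = g s.
Proof.
rewrite (lieD_ucoord (ltnSn k)) -[RHS](snoc_max s.2).
by congr (snoc _ _ _ _); exact: ord_inj.
Qed.

Lemma AfieldE s : Afield s = (ed i, \row_(a < k) lieD Afield a.+1 ucoord s).
Proof.
rewrite {1}/Afield; congr (_, _); apply/rowP => a; rewrite [LHS]mxE [RHS]mxE.
rewrite (@lieD_ucoord a.+1 (ltn_ord a : (a.+1 < k.+1)%N)).
by congr (snoc _ _ _ _); apply: ord_inj; rewrite lift0.
Qed.

Lemma sm_ucoord s : sm g s -> sm ucoord s.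
Proof. by move=> gs; apply: sm_coordF; apply: sm_snoc => //; exact: sm_snd. Qed.

Lemma sm_Afield s : sm g s -> sm Afield s.
Proof.
move=> gs; apply: sm_pair; first exact: sm_cst.
apply: sm_row => a; apply: sm_coordF; apply: sm_snoc => //; exact: sm_snd.
Qed.

Lemma sm_bcoord s : sm g s -> sm h (s.1, ucoord s) -> sm z (s.1, ucoord s) -> sm bcoord s.
Proof.
move=> gs hs zs; have ps := sm_ucoord gs.
have pp : sm (fun s : S => (s.1, ucoord s)) s by apply: sm_pair => //; exact: sm_fst.
apply: smB; first exact: (@sm_comp _ _ _ _ _ _ (fun s : S => (s.1, ucoord s)) h).
apply: smM; first exact: (@sm_comp _ _ _ _ _ _ (fun s : S => (s.1, ucoord s)) z).
by apply: sm_dirD => //; exact: sm_Afield.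
Qed.

Lemma sm_Bfield s : sm g s -> sm bcoord s -> sm Bfield s.
Proof.
move=> gs bs; apply: sm_pair; first exact: sm_cst.
apply: sm_row => a; apply: sm_lieD => //; exact: sm_Afield.
Qed.

(* The components of [Afield, Bfield] = 0 below the top one hold by construction. *)
Lemma commute_fields s : sm g s -> sm bcoord s ->
  (\forall t \near s, 'D_(Bfield t) g t = lieD Afield k bcoord t) -> 'D_(Afield s) Bfield s = 'D_(Bfield s) Afield s.
Proof.
move=> gs bs gB; have As := sm_Afield gs; have Bs := sm_Bfield gs bs.
have [s1 s2] : sm (fun t => (Afield t).2) s /\ sm (fun t => (Bfield t).2) s by split; exact: sm_snd_comp.
have EA v : 'D_v Afield s = (0, 'D_v (fun t => (Afield t).2) s).
  rewrite (derive_pair (f := fun=> ed i) (g := fun t => (Afield t).2)) ?derive_cst//.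
  exact: sm_diff.
have EB v : 'D_v Bfield s = (0, 'D_v (fun t => (Bfield t).2) s).
  rewrite (derive_pair (f := fun=> ed i') (g := fun t => (Bfield t).2)) ?derive_cst//.
  exact: sm_diff.
rewrite EA EB; congr (_, _); apply/rowP => a.
rewrite !derive_rowE; try exact: sm_derivable.
have -> : (fun t => (Bfield t).2 0 a) = lieD Afield a bcoord by apply/funext => t; rewrite mxE.
have -> : (fun t => (Afield t).2 0 a) = lieD Afield a.+1 ucoord.
  by apply/funext => t; rewrite AfieldE mxE.
have [ak|ka] := ltnP a.+1 k.
  have -> : lieD Afield a.+1 ucoord = fun t => t.2 0 (Ordinal ak).
    by apply/funext => t; rewrite (lieD_ucoord_lt (Ordinal ak)).
  by rewrite derive_coord2r mxE.
have ka' : a.+1 = k by apply/eqP; rewrite eqn_leq ka andbT; exact: ltn_ord.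
have -> : lieD Afield a.+1 ucoord = g by apply/funext => t; rewrite ka' lieD_ucoord_max.
by rewrite (near_at gB); exact: (congr1 (fun n => lieD Afield n bcoord s) ka').
Qed.

(** For k > 0 the coordinate u is the first entry of w and the claim holds by definition of
    [Bfield]; for k = 0 it is g itself, and the claim is the hypothesis. *)
Lemma derive_Bfield_ucoord s : 'D_(Bfield s) g s = lieD Afield k bcoord s -> 'D_(Bfield s) ucoord s = bcoord s.
Proof.
have [k0|k0] := posnP k.
  have E c t : lieD Afield k c t = c t := congr1 (fun n => lieD Afield n c t) k0.
  have -> : ucoord = g by apply/funext => t; rewrite -lieD_ucoord_max E.
  by move->; rewrite E.
have -> : ucoord = fun t => t.2 0 (Ordinal k0).
  by rewrite -[ucoord]/(lieD Afield 0 ucoord); apply/funext => t; rewrite (lieD_ucoord_lt (Ordinal k0)).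
by rewrite derive_coord2r mxE.
Qed.

End Fields.

(** * Local uniqueness for differential equations; fields with constant horizontal part *)

Section Uniqueness.
Context {R : realType}.

Lemma cvx_closed_ball (V : normedModType R) (y1 : V) (rho : R) : cvx [set y : V | `|y - y1| <= rho].
Proof.
move=> y y' t /= Ky Ky' /andP[t0 t1].
have -> : y + t *: (y' - y) - y1 = (1 - t) *: (y - y1) + t *: (y' - y1).
  rewrite scalerBl scale1r [RHS]addrAC -[RHS]addrA -scalerBr opprB [y' - y1 + _]addrA.
  by rewrite subrK addrAC.
have t1' : 0 <= 1 - t by rewrite subr_ge0.
rewrite (le_trans (ler_normD _ _))// !normrZ (ger0_norm t0) (ger0_norm t1').
have h1 := ler_wpM2l t1' Ky; have h2 := ler_wpM2l t0 Ky'.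
by apply: (le_trans (lerD h1 h2)); rewrite -mulrDl subrK mul1r.
Qed.

(** The radius depends on the field alone, so curves that remain in the ball may be compared on an
    interval of any length. *)
Lemma ode_unique_near (W : normedModType R) (fW : fdim W) (X : W -> W) (w1 : W) : sm X w1 ->
  exists2 e : R, 0 < e & forall (z1 z2 : R -> W) (T : R),
    (forall t : R, `|t| < T -> [/\ `|z1 t - w1| < e, `|z2 t - w1| < e,
       is_derive t 1 z1 (X (z1 t)) & is_derive t 1 z2 (X (z2 t))]) ->
    z1 0 = z2 0 -> forall t : R, `|t| < T -> z1 t = z2 t.
Proof.
move=> Xw.
have sg y : sm (@fd_g _ _ fW) y by apply: sm_lin; exact: fd_gc.
have sf w : sm (@fd_f _ _ fW) w by apply: sm_lin; exact: fd_fc.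
have sX : sm (fun y => fd_f (X (fd_g y))) (fd_f w1).
  have s1 : sm (fun y => X (fd_g y)) (fd_f w1).
    by apply: (@sm_comp _ _ _ _ _ _ _ X _ (sg _)); rewrite fd_fK.
  exact: (@sm_comp _ _ _ _ _ _ _ _ _ s1 (sf _)).
have [r0 r00 Hr] := (near_ball1 _ _).1 (sm_near sX).
pose rho := r0 / 2.
have rho0 : 0 < rho by rewrite divr_gt0.
have rhor : rho < r0 by rewrite ltr_pdivrMr// ltr_pMr// ltr1n.
have nb : \forall y \near fd_f w1, `|y - fd_f w1| <= rho.
  by apply/near_ball1; exists rho => // z /ltW.
have [e e0 He] := (near_ball1 _ _).1 (near_sm (sf w1) nb).
exists e => // z1 z2 T H z120 t tT.
suff : @fd_f _ _ fW (z1 t) = @fd_f _ _ fW (z2 t) by move=> E; rewrite -(fd_fK (z1 t)) E fd_fK.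
have Hd (z : R -> W) (s : R) (dz : W) : is_derive s 1 z dz -> is_derive s 1 (fun s => @fd_f _ _ fW (z s)) (@fd_f _ _ fW dz).
  move=> dzs; have := is_derive_curve dzs (sm_diff (sf (z s))).
  by rewrite derive_lin//; exact: fd_fc.
have Kv : cvx [set y | `|y - @fd_f _ _ fW w1| <= rho] by exact: cvx_closed_ball.
have Kc := @compact_closed_ball R _ (@fd_f _ _ fW w1) rho.
refine (@ode_unique R _ _ (fun y => @fd_f _ _ fW (X (@fd_g _ _ fW y)))
  (fun s => @fd_f _ _ fW (z1 s)) (fun s => @fd_f _ _ fW (z2 s)) T Kc Kv _ _ _ t tT).
- by move=> y /= yr; apply: Hr; exact: le_lt_trans rhor.
- move=> s sT; have [h1 h2 d1 d2] := H s sT; split=> //.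
  + exact: He.
  + exact: He.
  + by rewrite fd_fK; exact: Hd.
  + by rewrite fd_fK; exact: Hd.
- by rewrite /= z120.
Qed.

Lemma flow_fst (V W : normedModType R) (fV : fdim V) (fW : fdim W) (e : V) (c : V * W -> W)
    (w1 : V * W) (phi : R -> V * W -> V * W) :
  local_flow (fun w => (e, c w)) w1 phi ->
  \forall p \near (0 : R, w1), (phi p.1 p.2).1 = p.2.1 + p.1 *: e.
Proof.
move=> H; have [d d0 Hd] := (@near_box _ _ w1 _).1 H.
apply/near_box; exists d => // t w td wd.
have d1 (s : R) : `|s| < d -> is_derive s 1 (fun s => (phi s w).1) e.
  move=> sd; have [_ dw _ _] := Hd s w sd wd.
  have := is_derive_curve dw (sm_diff (sm_fst _)); congr is_derive.
  have lf : linear (@fst V W) by [].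
  pose lM := GRing.isLinear.Build _ _ _ _ _ lf.
  pose Lf : {linear (V * W)%type -> V} := HB.pack (@fst V W) lM.
  apply: (etrans (@derive_lin _ _ _ Lf _ _ _)) => // y.
  by apply: sm_cont; exact: sm_fst.
have [_ _ /= p0 _] := Hd t w td wd.
by rewrite (curve_affine fV d1 td) p0.
Qed.

Lemma fd_co_inj (W : normedModType R) (fW : fdim W) (a b : W) :
  (forall l, fd_co (fW := fW) l a = fd_co l b) -> a = b.
Proof.
move=> H; rewrite (fd_decomp a) (fd_decomp b); apply: eq_bigr => l _.
by congr (_ *: _); exact: H.
Qed.

Lemma schwarzv (V W : normedModType R) (fV : fdim V) (fW : fdim W) (f : V -> W) (x v w : V) : sm f x ->
  'D_w (fun z => 'D_v f z) x = 'D_v (fun z => 'D_w f z) x.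
Proof.
move=> fs; apply: fd_co_inj => l.
have cl y a (g : V -> W) : sm g y -> fd_co l ('D_a g y) = 'D_a (fun z => fd_co l (g z)) y.
  move=> gs; rewrite (@derive_comp _ _ _ _ g (fd_co l)); [|exact: sm_diff|].
    by rewrite derive_lin//; exact: fd_co_continuous.
  by apply: sm_diff; apply: sm_lin; exact: fd_co_continuous.
rewrite !cl; [|exact: sm_derive|exact: sm_derive].
have fls : sm (fun z => fd_co l (f z)) x by apply: sm_comp_lin => //; exact: fd_co_continuous.
have E a : \forall z \near x, fd_co l ('D_a f z) = 'D_a (fun z => fd_co l (f z)) z.
  by apply: filter1 (sm_near fs) => z /cl.
by rewrite (near_eq_derive _ (E v)) (near_eq_derive _ (E w)); exact: schwarz.
Qed.

Lemma sm_tangent (W : normedModType R) (fW : fdim W) (X : W -> W) (w e : W) : sm X w ->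
  sm (fun p : W * W => (X p.1, 'D_(p.2) X p.1)) (w, e).
Proof.
move=> Xs; have s1 : sm (fun p : W * W => X p.1) (w, e).
  by apply: (@sm_comp _ _ _ _ _ _ fst X) => //; exact: sm_fst.
apply: sm_pair => //.
have sv : sm (fun p : W * W => (p.2, 0 : W)) (w, e).
  by apply: sm_pair; [exact: sm_snd|exact: sm_cst].
have := @sm_dirD _ _ _ (fdim_prod fW fW) fW _ _ _ s1 sv; apply: sm_ext; apply: near_all => -[a b].
exact: derive_fstE.
Qed.

Lemma near_open (V : normedModType R) (W : set V) x :
  open W -> W x -> \forall y \near x, W y.
Proof. by move=> Wo Wx; exact: open_nbhs_nbhs. Qed.

Lemma derive_fst_id (V W : normedModType R) (q v : V * W) : 'D_v fst q = v.1.
Proof.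
have lf : linear (@fst V W) by [].
pose lM := GRing.isLinear.Build _ _ _ _ _ lf.
pose Lf : {linear (V * W)%type -> V} := HB.pack (@fst V W) lM.
by apply: (etrans (@derive_lin _ _ _ Lf _ _ _)) => // y; apply: sm_cont; exact: sm_fst.
Qed.

Lemma derive_snd_id (V W : normedModType R) (q v : V * W) : 'D_v snd q = v.2.
Proof.
have lf : linear (@snd V W) by [].
pose lM := GRing.isLinear.Build _ _ _ _ _ lf.
pose Lf : {linear (V * W)%type -> W} := HB.pack (@snd V W) lM.
by apply: (etrans (@derive_lin _ _ _ Lf _ _ _)) => // y; apply: sm_cont; exact: sm_snd.
Qed.

Lemma derive0v (V W : normedModType R) (F : V -> W) x : differentiable F x -> 'D_0 F x = 0.
Proof. by move=> Fd; rewrite -(scale0r (0 : V)) deriveZv// scale0r. Qed.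

End Uniqueness.

(** * Frobenius' theorem for two commuting fields over the plane *)

Section Frobenius.
Context {R : realType}.
Variables (W : normedModType R) (fW : fdim W) (i i' : 'I_2).
Local Notation S := ('rV[R]_2 * W)%type.
Variables (a b : S -> W) (x0 : 'rV[R]_2) (w0 : W).
Let s0 : S := (x0, w0).
Let A (s : S) : S := (ed i, a s).
Let B (s : S) : S := (ed i', b s).
Hypotheses (ii' : i != i') (sa : sm a s0) (sb : sm b s0)
  (AB : \forall s \near s0, 'D_(A s) B s = 'D_(B s) A s).
Let fS : fdim S := fdim_prod (fdim_rV R 2) fW.

Let sA : sm A s0. Proof. by apply: sm_pair => //; exact: sm_cst. Qed.
Let sB : sm B s0. Proof. by apply: sm_pair => //; exact: sm_cst. Qed.

Lemma ed_nn (l : 'I_2) : (ed l : 'rV[R]_2) 0 l = 1.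
Proof. by rewrite /ed mxE !eqxx. Qed.

Lemma ed_ne (l m : 'I_2) : l != m -> (ed l : 'rV[R]_2) 0 m = 0.
Proof. by move=> lm; rewrite /ed mxE eqxx eq_sym (negbTE lm). Qed.

Lemma norm_ed (l : 'I_2) (t : R) : `|t *: (ed l : 'rV[R]_2)| <= `|t|.
Proof.
apply: mx_norm_le => // c m; rewrite ord1 mxE /ed mxE eqxx /=.
by case: eqP => _; rewrite ?mulr1// mulr0 normr0.
Qed.

Let sc (x : 'rV[R]_2) := x 0 i - x0 0 i.
Let tc (x : 'rV[R]_2) := x 0 i' - x0 0 i'.

Lemma plane_decomp x : x = x0 + sc x *: ed i + tc x *: ed i'.
Proof.
apply/rowP => l; rewrite !mxE; have [->|->] := neq_ord2 l ii'; rewrite !eqxx /=.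
- by rewrite (negbTE ii') mulr1 mulr0 addr0 addrC subrK.
- by rewrite eq_sym (negbTE ii') mulr1 mulr0 addr0 addrC subrK.
Qed.

Section Flows.
Variables al be : R -> S -> S.
Hypotheses (Hal : local_flow A s0 al) (Hbe : local_flow B s0 be).

Let fal (q : R * S) := al q.1 q.2.
Let fbe (q : R * S) := be q.1 q.2.
Let NA (q : R * S) := [/\ sm fal q, is_derive q.1 1 (fun t => al t q.2) (A (fal q)),
  al 0 q.2 = q.2, al (- q.1) (fal q) = q.2 & (fal q).1 = q.2.1 + q.1 *: ed i].
Let NB (q : R * S) := [/\ sm fbe q, is_derive q.1 1 (fun t => be t q.2) (B (fbe q)),
  be 0 q.2 = q.2, be (- q.1) (fbe q) = q.2 & (fbe q).1 = q.2.1 + q.1 *: ed i'].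

Let nNA : \forall q \near (0 : R, s0), NA q.
Proof.
have := near_and Hal (flow_fst (fdim_rV R 2) fW Hal).
by apply: filter1 => q [[? ? ? ?] ?].
Qed.

Let nNB : \forall q \near (0 : R, s0), NB q.
Proof.
have := near_and Hbe (flow_fst (fdim_rV R 2) fW Hbe).
by apply: filter1 => q [[? ? ? ?] ?].
Qed.

(** For p = (x, c), [Z p] starts at (x0, c), follows [A] for the time [sc x] and then [B] for the
    time [tc x], arriving over x. [Y] runs the legs backwards in reverse order. *)
Let q1 (p : S) : R * S := (sc p.1, (x0, p.2)).
Let m p := fal (q1 p).
Let q2 (p : S) : R * S := (tc p.1, m p).
Let Z p := fbe (q2 p).
Let r3 (p : S) := fbe (- tc p.1, p).
Let Y (p : S) := fal (- sc p.1, r3 p).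

Let ssc (l : 'I_2) (p : S) : sm (fun p : S => p.1 0 l - x0 0 l) p.
Proof. by apply: smB; [apply: sm_coordF; exact: sm_fst|exact: sm_cst]. Qed.

Let sq1 p : sm q1 p.
Proof.
have s2 : sm (fun p : S => (x0, p.2)) p by apply: sm_pair; [exact: sm_cst|exact: sm_snd].
by apply: sm_pair; [exact: ssc|exact: s2].
Qed.

Let q10 : q1 s0 = (0, s0). Proof. by rewrite /q1 /sc subrr. Qed.

Let fal0 : fal (0, s0) = s0. Proof. by have [] := near_at nNA. Qed.
Let fbe0 : fbe (0, s0) = s0. Proof. by have [] := near_at nNB. Qed.

Let sm_m : sm m s0.
Proof. by apply: (@sm_comp _ _ _ _ _ _ q1 fal) => //; rewrite q10; have [] := near_at nNA. Qed.

Let m0 : m s0 = s0. Proof. by rewrite /m q10. Qed.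

Let sq2 : sm q2 s0. Proof. by apply: sm_pair; [exact: ssc|exact: sm_m]. Qed.

Let q20 : q2 s0 = (0, s0). Proof. by rewrite /q2 m0 /tc subrr. Qed.

Let sZ : sm Z s0.
Proof. by apply: (@sm_comp _ _ _ _ _ _ q2 fbe) => //; rewrite q20; have [] := near_at nNB. Qed.

Let Z0 : Z s0 = s0. Proof. by rewrite /Z q20. Qed.

Let sr3' : sm (fun p : S => (- tc p.1, p)) s0.
Proof. by apply: sm_pair; [apply: smN; exact: ssc|exact: sm_id]. Qed.

Let r30' : (- tc s0.1, s0) = (0, s0). Proof. by rewrite /tc subrr oppr0. Qed.

Let sr3 : sm r3 s0.
Proof.
apply: (@sm_comp _ _ _ _ _ _ (fun p : S => (- tc p.1, p)) fbe) => //.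
by rewrite r30'; have [] := near_at nNB.
Qed.

Let r30 : r3 s0 = s0. Proof. by rewrite /r3 r30'. Qed.

Let sY' : sm (fun p : S => (- sc p.1, r3 p)) s0.
Proof. by apply: sm_pair; [apply: smN; exact: ssc|exact: sr3]. Qed.

Let Y0' : (- sc s0.1, r3 s0) = (0, s0). Proof. by rewrite r30 /sc subrr oppr0. Qed.

Let sY : sm Y s0.
Proof.
apply: (@sm_comp _ _ _ _ _ _ (fun p : S => (- sc p.1, r3 p)) fal) => //.
by rewrite Y0'; have [] := near_at nNA.
Qed.

Let Y0 : Y s0 = s0. Proof. by rewrite /Y Y0'. Qed.

Let n1 : \forall p \near s0, NA (q1 p).
Proof. by apply: (near_sm (sq1 s0)); rewrite q10. Qed.
Let n2 : \forall p \near s0, NB (q2 p).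
Proof. by apply: (near_sm sq2); rewrite q20. Qed.
Let n3 : \forall p \near s0, NB (- tc p.1, p).
Proof. by apply: (near_sm sr3'); rewrite r30'. Qed.
Let n4 : \forall p \near s0, NA (- sc p.1, r3 p).
Proof. by apply: (near_sm sY'); rewrite Y0'. Qed.

Lemma frob_fst : \forall p \near s0, (Z p).1 = p.1.
Proof.
have := near_and n1 n2; apply: filter1 => p [[_ _ _ _ e1] [_ _ _ _ e2]].
rewrite /= in e1 e2.
by rewrite [(Z p).1]e2 [(m p).1]e1 -plane_decomp.
Qed.

Lemma frob_inv1 : \forall p \near s0, Y (Z p) = (x0, p.2).
Proof.
have := near_and frob_fst (near_and n1 n2); apply: filter1 => p [z1 [[_ _ _ e1 _] [_ _ _ e2 _]]].
rewrite /= in e1 e2; rewrite /Y /r3 z1 /fbe /fal /=.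
by rewrite (_ : be (- tc p.1) (Z p) = m p) // e2.
Qed.

Lemma frob_inv2 : \forall p \near s0, Y p = (x0, (Y p).2) /\ Z (p.1, (Y p).2) = p.
Proof.
have := near_and n3 n4; apply: filter1 => p [[_ _ _ e1 e2] [_ _ _ e3 e4]].
rewrite /= in e1 e2 e3 e4.
have Y1 : Y p = (x0, (Y p).2).
  rewrite [LHS]surjective_pairing; congr (_, _).
  rewrite [(Y p).1]e4 [(r3 p).1]e2 {1}(plane_decomp p.1).
  by rewrite !scaleNr addrK addrK.
split=> //; rewrite /Z /q2 /m /q1 /= -Y1 /fbe /fal /=.
rewrite !opprK in e1 e3.
by rewrite (_ : al (sc p.1) (Y p) = r3 p).
Qed.

(** The leg along [B] comes last, so moving x in direction i' only lengthens it. *)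
Lemma frob_B : \forall p \near s0, 'D_(ed i', 0) Z p = B (Z p).
Proof.
apply: filter1 n2 => p [_ d2 _ _ _].
have := derive_lineE Z p (ed i', 0) 0; rewrite scale0r addr0 => <-.
have E : (fun s : R => Z (p + s *: (ed i', 0))) = (fun s : R => be (tc p.1 + s *: (1 : R)) (m p)).
  apply/funext => s; rewrite /Z /fbe /q2 /m /q1 /=; congr (be _ (fal (_, (_, _)))).
  - by rewrite /tc !mxE !eqxx [s *: 1]mulr1 mulr1 addrAC.
  - by rewrite /sc !mxE eqxx (negbTE ii') mulr0 addr0.
  - by rewrite scaler0 addr0.
rewrite E (derive_lineE (fun s => be s (m p)) (tc p.1) 1 0) scale0r addr0.
by case: d2 => _ ->.
Qed.

(** Where [tc] is 0 the leg along [B] is trivial, and moving x in direction i lengthens the leg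
    along [A]. *)
Lemma frob_A0 : \forall p \near s0, tc p.1 = 0 -> 'D_(ed i, 0) Z p = A (Z p).
Proof.
have := near_and n1 (near_near n2); apply: filter1 => p [[_ d1 _ _ _] n2p] tp.
have Zp : Z p = m p by have [_ _ e _ _] := near_at n2p; rewrite /Z /fbe /q2 /= tp.
have := derive_lineE Z p (ed i, 0) 0; rewrite scale0r addr0 => <-.
have sl : sm (fun s : R => p + s *: (ed i, 0)) 0.
  apply: smD; first exact: sm_cst.
  apply: sm_pair; last by apply: (sm_ext (f := fun=> 0)); [apply: near_all => s; rewrite scaler0|exact: sm_cst].
  apply: sm_rowP => l; under eq_fun do rewrite mxE.
  by apply: smM; [exact: sm_id|exact: sm_cst].
have nl := near_sm sl (A := fun p => NB (q2 p)).
rewrite scale0r addr0 in nl; have {}nl := nl n2p.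
have E : \forall s \near (0 : R), al (sc p.1 + s *: (1 : R)) (x0, p.2) = Z (p + s *: (ed i, 0)).
  apply: filter1 nl => s [_ _ e _ _]; rewrite /= in e.
  have ts : tc (p.1 + s *: ed i) = 0.
    by rewrite -[RHS]tp /tc !mxE eqxx eq_sym (negbTE ii') mulr0 addr0.
  rewrite /Z /fbe /q2 /= ts e /m /fal /q1 /=; congr (al _ (_, _)).
  - by rewrite /sc !mxE !eqxx [s *: 1]mulr1 mulr1 addrAC.
  - by rewrite scaler0 addr0.
rewrite -(near_eq_derive _ E).
rewrite (derive_lineE (fun s => al s (x0, p.2)) (sc p.1) 1 0) scale0r addr0.
by rewrite Zp; case: d1 => _ ->.
Qed.

(* Along the direction i' both (Z, D_i Z) and (Z, A o Z) solve the linearised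
   system (z, e)' = (B z, D_e B z): the latter because A and B commute. *)
Lemma frob_A : \forall p \near s0, 'D_(ed i, 0) Z p = A (Z p).
Proof.
pose X (q : S * S) : S * S := (B q.1, 'D_(q.2) B q.1).
have sX : sm X (s0, A s0) by exact: sm_tangent.
have [e e0 Hu] := ode_unique_near (fdim_prod fS fS) sX.
pose F1 p := (Z p, 'D_(ed i, 0) Z p).
pose F2 p := (Z p, A (Z p)).
have sF1 : sm F1 s0 by apply: sm_pair; [exact: sZ|exact: sm_derive].
have sAZ : sm (fun p => A (Z p)) s0.
  by apply: (@sm_comp _ _ _ _ _ _ Z A); [exact: sZ|rewrite Z0].
have sF2 : sm F2 s0 by apply: sm_pair; [exact: sZ|exact: sAZ].
have t0 : tc s0.1 = 0 by rewrite /tc subrr.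
have F10 : F1 s0 = (s0, A s0).
  by rewrite /F1 (near_at frob_A0 t0) Z0.
have F20 : F2 s0 = (s0, A s0) by rewrite /F2 Z0.
have ball : \forall q \near (s0, A s0), `|q - (s0, A s0)| < e.
  by apply/near_ball1; exists e.
have k1 : \forall p \near s0, `|F1 p - (s0, A s0)| < e.
  by apply: (near_sm sF1 (A := fun q => `|q - (s0, A s0)| < e)); rewrite F10.
have k2 : \forall p \near s0, `|F2 p - (s0, A s0)| < e.
  by apply: (near_sm sF2 (A := fun q => `|q - (s0, A s0)| < e)); rewrite F20.
have k3 : \forall p \near s0, [/\ sm A (Z p), sm B (Z p) & 'D_(A (Z p)) B (Z p) = 'D_(B (Z p)) A (Z p)].
  apply: (near_sm sZ (A := fun s => [/\ sm A s, sm B s & 'D_(A s) B s = 'D_(B s) A s])).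
  rewrite Z0; have := near_and AB (near_and (sm_near sA) (sm_near sB)).
  by apply: filter1 => s [? [? ?]].
have := near_and (near_and k1 k2) (near_and k3 (near_and (near_near frob_B) (near_and frob_A0 (sm_near sZ)))).
move=> /near_box2[d d0 Hd].
have d20 : 0 < d / 2 by rewrite divr_gt0.
apply/near_box2; exists (d / 2) => // x c xd cd.
have cd' : `|c - w0| < d by rewrite (lt_trans cd)// ltr_pdivrMr// ltr_pMr// ltr1n.
have scd : `|sc x| < d / 2.
  by have := mx_norm_coord (x - x0) 0 i; rewrite !mxE => /le_lt_trans; apply.
have tcd : `|tc x| < d / 2.
  by have := mx_norm_coord (x - x0) 0 i'; rewrite !mxE => /le_lt_trans; apply.
(* The foot of (x, c) on the line where [tc] is 0, on which [frob_A0] makes [F1] and [F2] agree; the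
   line [P] reaches (x, c) at time [tc x]. Halving [d] keeps the whole path in the box. *)
pose p0 : S := (x0 + sc x *: ed i, c).
pose P (t : R) : S := p0 + t *: (ed i', 0).
have PE t : P t = (x0 + sc x *: ed i + t *: ed i', c).
  by apply: injective_projections => //=; rewrite scaler0 addr0.
have Pd t : `|t| < d / 2 -> `|(P t).1 - x0| < d /\ `|(P t).2 - w0| < d.
  move=> td; rewrite PE /=; split=> //.
  rewrite addrAC [x0 + _]addrC addrK (le_lt_trans (ler_normD _ _))// (splitr d).
  by apply: ltrD; [apply: le_lt_trans scd|apply: le_lt_trans td]; exact: norm_ed.
have HP t : `|t| < d / 2 -> [/\ `|F1 (P t) - (s0, A s0)| < e, `|F2 (P t) - (s0, A s0)| < e,
   is_derive t 1 (fun t => F1 (P t)) (X (F1 (P t))) & is_derive t 1 (fun t => F2 (P t)) (X (F2 (P t)))].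
  move=> td; have [x1 x2] := Pd t td.
  have := Hd _ _ x1 x2; rewrite -surjective_pairing => -[[h1 h2] [[AZs BZs comm] [Bn [_ Zs]]]].
  have B1 := near_at Bn.
  have sAZ' : sm (fun p => A (Z p)) (P t) by exact: (@sm_comp _ _ _ _ _ _ Z A).
  have s1 : sm F1 (P t) by apply: sm_pair => //; exact: sm_derive.
  have s2 : sm F2 (P t) by exact: sm_pair.
  split=> //.
  - have := is_derive_line (sm_derivable (ed i', 0) s1); congr is_derive.
    rewrite derive_pair; [|exact: sm_diff|by apply: sm_diff; exact: sm_derive].
    rewrite B1; congr (_, _).
    (* Interchanging derivatives gives D_i' D_i Z = D_i (B o Z), the derivative of B at Z in
       direction D_i Z. *)
    rewrite (schwarzv fS fS)// (near_eq_derive _ Bn).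
    by rewrite (@derive_comp _ _ _ _ Z B)//; exact: sm_diff.
  - have := is_derive_line (sm_derivable (ed i', 0) s2); congr is_derive.
    rewrite derive_pair; [|exact: sm_diff|exact: sm_diff].
    rewrite B1; congr (_, _).
    rewrite (@derive_comp _ _ _ _ Z A); [|exact: sm_diff|exact: sm_diff].
    by rewrite B1 -comm.
have E0 : F1 (P 0) = F2 (P 0).
  have n0 : `|0 : R| < d / 2 by rewrite normr0.
  have [x1 x2] := Pd 0 n0.
  have := Hd _ _ x1 x2; rewrite -surjective_pairing => -[_ [_ [_ [A0 _]]]].
  have tP : tc (P 0).1 = 0.
    rewrite PE /= scale0r addr0 /tc !mxE eqxx eq_sym (negbTE ii') mulr0 addr0.
    by rewrite subrr.
  by rewrite /F1 (A0 tP).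
have := Hu _ _ _ HP E0 (tc x) tcd.
by rewrite PE -plane_decomp => -[].
Qed.

(** [Z] lies over the identity of the plane, so it has the form (x, Phi(x, c)); [Psi] is the
    vertical part of the inverse map [Y]. *)
Theorem frobenius_flows : exists Phi Psi : S -> W,
  [/\ sm Phi s0 /\ Phi s0 = w0, sm Psi s0 /\ Psi s0 = w0,
    \forall p \near s0, Psi (p.1, Phi p) = p.2 /\ Phi (p.1, Psi p) = p.2,
    \forall p \near s0, 'D_(ed i, 0) Phi p = a (p.1, Phi p) &
    \forall p \near s0, 'D_(ed i', 0) Phi p = b (p.1, Phi p)].
Proof.
exists (fun p => (Z p).2), (fun p => (Y p).2).
have D2 (v : S) : \forall p \near s0, 'D_v (fun p => (Z p).2) p = ('D_v Z p).2.
  apply: filter1 (sm_near sZ) => p sp.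
  rewrite (@derive_comp _ _ _ _ Z snd); [|exact: sm_diff|by apply: sm_diff; exact: sm_snd].
  have lf : linear (@snd 'rV[R]_2 W) by [].
  pose lM := GRing.isLinear.Build _ _ _ _ _ lf.
  pose Lf : {linear S -> W} := HB.pack (@snd 'rV[R]_2 W) lM.
  apply: (etrans (@derive_lin _ _ _ Lf _ _ _)) => // y.
  by apply: sm_cont; exact: sm_snd.
have ZE : \forall p \near s0, Z p = (p.1, (Z p).2).
  by apply: filter1 frob_fst => p <-; rewrite -surjective_pairing.
split.
- by split; [exact: sm_snd_comp|rewrite Z0].
- by split; [exact: sm_snd_comp|rewrite Y0].
- have := near_and ZE (near_and frob_inv1 frob_inv2).
  by apply: filter1 => p [z1 [e1 [_ e2]]]; rewrite -z1 e1 e2.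
- have := near_and (D2 (ed i, 0)) (near_and frob_A ZE).
  by apply: filter1 => p [-> [-> z1]]; rewrite -z1.
- have := near_and (D2 (ed i', 0)) (near_and frob_B ZE).
  by apply: filter1 => p [-> [-> z1]]; rewrite -z1.
Qed.

End Flows.

Theorem frobenius : exists Phi Psi : S -> W,
  [/\ sm Phi s0 /\ Phi s0 = w0, sm Psi s0 /\ Psi s0 = w0,
    \forall p \near s0, Psi (p.1, Phi p) = p.2 /\ Phi (p.1, Psi p) = p.2,
    \forall p \near s0, 'D_(ed i, 0) Phi p = a (p.1, Phi p) &
    \forall p \near s0, 'D_(ed i', 0) Phi p = b (p.1, Phi p)].
Proof.
have [al Hal] := flow fS sA; have [be Hbe] := flow fS sB.
exact: frobenius_flows Hal Hbe.
Qed.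

End Frobenius.

Lemma near_finite (R : realType) (V : normedModType R) (I : finType) (x : V) (A : I -> set V) :
  (forall a, \forall y \near x, A a y) -> \forall y \near x, forall a, A a y.
Proof. exact: filter_forall. Qed.

Lemma sum_ord2 (V : nmodType) (f : 'I_2 -> V) (i i' : 'I_2) : i != i' -> \sum_(l < 2) f l = f i + f i'.
Proof.
move=> ii'; rewrite (bigD1 i)//= (bigD1 i')/=; last by rewrite eq_sym.
rewrite big1 ?addr0// => l /andP[li li'].
by have [E|E] := neq_ord2 l ii'; rewrite E eqxx in li li'.
Qed.

(** * Pure derivatives as coordinates on the jet space *)

Section PureCoordinates.
Context {R : realType} {r k : nat}.
Variable i : 'I_2.
Local Notation J := (jet_space R r).

Definition wj (j : J) : 'rV[R]_k := \row_(a < k) ju j (mshift i a (0, 0)%N).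
Definition tj (j : J) : R := ju j (mshift i k (0, 0)%N).

Lemma mshift0_le a n : (a <= n)%N -> ((mshift i a (0, 0)).1 + (mshift i a (0, 0)).2 <= n)%N.
Proof. by rewrite /mshift; case: ifP => _ /=; rewrite ?addn0 ?add0n. Qed.

Lemma pure_jet_wj (j : J) : pure_jet i k j = (j.1, snoc (wj j) (tj j)).
Proof.
rewrite /pure_jet; congr (_, _); apply/esym.
by apply: (snocP (c := fun a => ju j (mshift i a (0, 0)%N))) => // a; rewrite mxE.
Qed.

Hypothesis kr : (k <= r)%N.

Lemma wj_jet u y : wj (jet r u y) = wjet k i u y.
Proof.
apply/rowP => a; rewrite !mxE -pure_iderive ju_jet//; apply: mshift0_le.
by apply: leq_trans kr; exact: ltnW.
Qed.

Lemma tj_jet u y : tj (jet r u y) = iderive (nseq k (ed i)) u y.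
Proof. by rewrite -pure_iderive /tj ju_jet//; exact: mshift0_le. Qed.

Lemma sm_wj j : sm wj j.
Proof. by apply: sm_row => a; exact: sm_ju. Qed.

Lemma sm_tj j : sm tj j.
Proof. exact: sm_ju. Qed.

Lemma sm_pure_jet j : sm (@pure_jet R i k r) j.
Proof.
apply: sm_pair; first exact: sm_fst.
by apply: sm_row => a; exact: sm_ju.
Qed.

End PureCoordinates.

(** * Compatibility of the two fields from the reduction condition *)

Section Reduction.
Context {R : realType}.
Variables (r k : nat) (Om : set (jet_space R r)) (L : jet_space R r -> R)
  (xi : 'I_2 -> jet_space R 0 -> R) (eta : jet_space R 0 -> R)
  (i i' : 'I_2) (G : 'rV[R]_2 * 'rV[R]_k.+1 -> R) (lam : jet_space R r -> R)
  (p : 'rV[R]_2 -> R) (x0 : 'rV[R]_2).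
Local Notation S := ('rV[R]_2 * 'rV[R]_k)%type.
Variable gt : S * R -> R.

Let j0 := jet r p x0.
Let w0 := wjet k i p x0.
Let s0 : S := (x0, w0).
Let v0 := iderive (nseq k (ed i)) p x0.
Let g (s : S) := gt (s, 0).
Let h := hta xi eta i'.
Let z := zta xi i i'.
Local Notation P0 := (ucoord g).
Local Notation Af := (Afield i g).
Local Notation b0 := (bcoord i h z g).
Local Notation Bf := (Bfield i i' h z g).

Hypotheses (kr : (k <= r)%N) (ii' : i != i').
Hypotheses (gs : sm gt (s0, 0)) (g0 : gt (s0, 0) = v0)
  (gF : \forall q \near (s0, 0 : R), G (q.1.1, snoc q.1.2 (gt q)) = q.2)
  (gU : \forall q \near ((s0, 0 : R), v0), G (q.1.1.1, snoc q.1.1.2 q.2) = q.1.2 -> q.2 = gt q.1).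
Hypotheses (pg : good_jet r xi eta i G p x0)
  (Gn : 'D_(0, delta_mx 0 ord_max) G (pure_jet i k (jet k p x0)) != 0)
  (Gs : sm G (pure_jet i k (jet k p x0)))
  (xs : forall l, sm (xi l) (jet 0 p x0)) (es : sm eta (jet 0 p x0)) (xn : xi i' (jet 0 p x0) != 0).
Hypotheses (Omn : \forall j \near j0, Om j) (Ls : sm L j0) (lams : sm lam j0)
  (lam0 : forall j, Om j -> Qmanifold xi eta r j -> lam j != 0)
  (LG : forall j, Om j -> Qmanifold xi eta r j -> L j = lam j * G (pure_jet i k j))
  (red : reduction_operator xi eta Om L).

Let gs0 : sm g s0.
Proof.
have s : sm (fun s : S => (s, 0 : R)) s0 by apply: sm_pair; [exact: sm_id|exact: sm_cst].
exact: (@sm_comp _ _ _ _ _ _ (fun s : S => (s, 0 : R)) gt).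
Qed.

Let P00 : P0 s0 = p x0.
Proof.
rewrite /ucoord /g g0.
by rewrite (snocP (c := fun a => iderive (nseq a (ed i)) p x0))// => [|a]; rewrite mxE.
Qed.

Let xs' l : sm (xi l) (emb (x0, p x0)). Proof. by have := xs l; rewrite jet0E. Qed.
Let es' : sm eta (emb (x0, p x0)). Proof. by have := es; rewrite jet0E. Qed.
Let xn' : xi i' (emb (x0, p x0)) != 0. Proof. by have := xn; rewrite jet0E. Qed.
Let hs : sm h (x0, p x0). Proof. exact: sm_hta. Qed.
Let zs : sm z (x0, p x0). Proof. exact: sm_zta. Qed.
Let bs0 : sm b0 s0. Proof. by apply: sm_bcoord => //; rewrite P00. Qed.

(** The last clause holds for every jet close to j0, whether or not G vanishes there; this is what
    allows it to be differentiated transversally. *)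
Definition jet_ok (j : jet_space R r) := [/\ Om j, sm L j, sm lam j, sm G (pure_jet i k j) &
  (tj (k := k) i j = gt ((j.1, wj i j), G (pure_jet i k j)))].

Lemma near_jet_ok : \forall j \near j0, jet_ok j.
Proof.
have wj0 : wj i j0 = wjet k i p x0 by rewrite /j0 wj_jet.
have tj0 : tj (k := k) i j0 = v0 by rewrite /j0 tj_jet.
have pj : pure_jet i k j0 = pure_jet i k (jet k p x0) by rewrite /j0 !pure_jet_snoc.
have Gj : G (pure_jet i k j0) = 0 by rewrite pj; have [_ _ /vanish0] := pg.
have n1 : \forall j \near j0, sm G (pure_jet i k j).
  by apply: (near_sm (sm_pure_jet i j0) (A := fun q => sm G q)); rewrite pj; exact: sm_near.
have GPs : sm (fun j : jet_space R r => G (pure_jet i k j)) j0.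
  apply: (@sm_comp _ _ _ _ _ _ (@pure_jet R i k r) G); first exact: sm_pure_jet.
  by rewrite pj.
pose q (j : jet_space R r) := (((j.1, wj i j) : S, G (pure_jet i k j)), tj (k := k) i j).
have qs : sm q j0.
  apply: sm_pair; last exact: sm_tj.
  by apply: sm_pair => //; apply: sm_pair; [exact: sm_fst|exact: sm_wj].
have q0 : q j0 = ((s0, 0), v0) by rewrite /q wj0 tj0 Gj.
have n2 : \forall j \near j0, tj (k := k) i j = gt ((j.1, wj i j), G (pure_jet i k j)).
  have := near_sm qs (A := fun q => G (q.1.1.1, snoc q.1.1.2 q.2) = q.1.2 -> q.2 = gt q.1).
  rewrite q0 => /(_ gU); apply: filter1 => j /=; apply.
  by rewrite pure_jet_wj.
have := near_and (near_and Omn n1) (near_and n2 (near_and (sm_near Ls) (sm_near lams))).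
by apply: filter1 => j [[? ?] [? [? ?]]].
Qed.

(* Along the curve Z the function u has the data prescribed by the field Af. *)
Definition member (u : 'rV[R]_2 -> R) (t : S) :=
  [/\ invariant_near xi eta u t.1, xi i' (emb (t.1, u t.1)) != 0,
   sm g t /\ sm b0 t,
   exists Z : R -> S, [/\ sm Z 0, Z 0 = t, \forall s \near (0 : R), 'D_1 Z s = Af (Z s),
     \forall s \near (0 : R), (Z s).1 = t.1 + s *: ed i &
     \forall s \near (0 : R), u (t.1 + s *: ed i) = P0 (Z s)] &
   \forall s \near t, G (s.1, snoc s.2 (g s)) = 0].

(** On the line the pure derivatives of [u] are Lie derivatives of the coordinate u along [Af], that
    is, the coordinates of [Z] followed by g; hence G vanishes on the line. There Q[u] = 0 turns the
    transversal derivative of [u] into [b0] along [Z], so its pure derivatives are Lie derivatives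
    of [b0]. *)
Lemma member_line u t : member u t ->
  [/\ wjet k i u t.1 = t.2, iderive (nseq k (ed i)) u t.1 = g t,
    \forall s \near (0 : R), G (pure_jet i k (jet k u (t.1 + s *: ed i))) = 0 &
    forall n, iderive (nseq n (ed i)) (fun y => 'D_(ed i') u y) t.1 = lieD Af n b0 t].
Proof.
move=> [Hu nx [gt_s bt] [Z [Zs Z0 ZA Z1 uZ]] GZ].
have As : sm Af (Z 0) by rewrite Z0; exact: sm_Afield.
have Ps : sm P0 (Z 0) by rewrite Z0; exact: sm_ucoord.
have U n := lie_line (fdim_rV R 2) (fdim_prod (fdim_rV R 2) (fdim_rV R k)) n Zs As Ps ZA uZ.
have t1 : t.1 = t.1 + (0 : R) *: ed i by rewrite scale0r addr0.
have W s : (forall a : 'I_k, iderive (nseq a (ed i)) u (t.1 + s *: ed i) = lieD Af a P0 (Z s)) ->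
    wjet k i u (t.1 + s *: ed i) = (Z s).2.
  by move=> H; apply/rowP => a; rewrite mxE H lieD_ucoord_lt.
have UA : \forall s \near (0 : R), forall a : 'I_k.+1,
    iderive (nseq a (ed i)) u (t.1 + s *: ed i) = lieD Af a P0 (Z s).
  by apply: near_finite => a; exact: U.
split.
- rewrite t1 W; first by rewrite Z0.
  by move=> a; have := near_at UA (widen_ord (leqnSn k) a).
- by rewrite t1; have := near_at UA ord_max => /= ->; rewrite lieD_ucoord_max Z0.
- have GZ' := near_sm Zs (A := fun s => G (s.1, snoc s.2 (g s)) = 0).
  rewrite Z0 in GZ'; have := near_and (near_and UA Z1) (GZ' GZ).
  apply: filter1 => s [[UAs Z1s] Gs'].
  rewrite pure_jet_snoc// W => [|a]; last by have := UAs (widen_ord (leqnSn k) a).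
  by have := UAs ord_max => /= ->; rewrite lieD_ucoord_max -Z1s.
- move=> n; suff H : \forall s \near (0 : R),
      iderive (nseq n (ed i)) (fun y => 'D_(ed i') u y) (t.1 + s *: ed i) = lieD Af n b0 (Z s).
    by have := near_at H; rewrite Z0 scale0r addr0.
  apply: (lie_line (fdim_rV R 2) (fdim_prod (fdim_rV R 2) (fdim_rV R k)) n Zs As _ ZA); first by rewrite Z0.
  have near0 : \forall y \near t.1, [/\ sm u y, characteristic xi eta (jet 1 u y) = 0 & xi i' (emb (y, u y)) != 0].
    have [us xsu esu Qu] := Hu.
    have su : sm (fun y => xi i' (emb (y, u y))) t.1.
      have := xsu i'; rewrite jet0E => xsu'.
      apply: (@sm_comp _ _ _ _ _ _ (fun y => emb (y, u y)) (xi i')) => //.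
      apply: (@sm_comp _ _ _ _ _ _ (fun y => (y, u y)) emb); last exact: sm_emb.
      by apply: sm_pair => //; exact: sm_id.
    have := near_and (near_and (sm_near us) Qu) (near_neq0 su nx).
    by apply: filter1 => y [[? ?] ?].
  have sl : sm (fun s : R => t.1 + s *: ed i) 0.
    apply: smD; first exact: sm_cst.
    apply: sm_rowP => a; under eq_fun do rewrite mxE.
    by apply: smM; [exact: sm_id|exact: sm_cst].
  have near0' := near_sm sl (A := fun y => [/\ sm u y, characteristic xi eta (jet 1 u y) = 0 & xi i' (emb (y, u y)) != 0]).
  rewrite /= scale0r addr0 in near0'.
  have := near_and (near_and (near0' near0) Z1) (near_and uZ (U 1%N)).
  apply: filter1 => s [[[us Qu nz] Z1s] [uZs U1s]].
  have := char_hz eta ii' us nz; rewrite Qu => /esym/eqP.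
  rewrite mulf_eq0 (negbTE nz) /= subr_eq0 => /eqP <-.
  rewrite /bcoord -/z -/h Z1s -uZs; congr (_ - _ * _); exact: U1s.
Qed.

Lemma pure_jet_kr (u : 'rV[R]_2 -> R) y : pure_jet i k (jet r u y) = pure_jet i k (jet k u y).
Proof. by rewrite !pure_jet_snoc. Qed.

(* The reduction condition differentiates L = lam * G along xi; on the line
   G vanishes, so only its transversal derivative survives and must be 0. *)
Lemma member_transversal u t : member u t -> (\forall y \near t.1, jet_ok (jet r u y)) ->
  let Ga y := G (pure_jet i k (jet r u y)) in
  [/\ sm Ga t.1, Ga t.1 = 0 & 'D_(ed i') Ga t.1 = 0].
Proof.
move=> mu ok; have [Hu nx _ _ _] := mu; have [_ _ Gline _] := member_line mu.
have [us _ _ _] := Hu.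
have [Omt Lt lt Gt _] := near_at ok.
move=> Ga; have Gas : sm Ga t.1.
  apply: (@sm_comp _ _ _ _ _ _ (fun y => pure_jet i k (jet r u y)) G) => //.
  apply: (@sm_comp _ _ _ _ _ _ (jet r u)); [exact: sm_jet|exact: sm_pure_jet].
have Gline' : \forall s \near (0 : R), Ga (t.1 + s *: ed i) = 0.
  by apply: filter1 Gline => s; rewrite /Ga pure_jet_kr.
have Ga0 : Ga t.1 = 0 by have := near_at Gline'; rewrite scale0r addr0.
have Gai : 'D_(ed i) Ga t.1 = 0 by exact: (iderive_line0 1 Gline').
have Mt : Qmanifold xi eta r (jet r u t.1) by exact: Qmanifold_jet.
have L0 : L (jet r u t.1) = 0 by rewrite LG// -/(Ga t.1) Ga0 mulr0.
have lams' : sm (fun y => lam (jet r u y)) t.1.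
  by apply: (@sm_comp _ _ _ _ _ _ (jet r u) lam) => //; exact: sm_jet.
have LE : \forall y \near t.1, L (jet r u y) = Ga y * lam (jet r u y).
  have := near_and ok (invariant_near_near Hu).
  by apply: filter1 => y [[Oy _ _ _ _] Hy]; rewrite LG 1?mulrC//; exact: Qmanifold_jet.
have DL l : 'D_(ed l) (fun y => L (jet r u y)) t.1 = lam (jet r u t.1) * 'D_(ed l) Ga t.1.
  rewrite (near_eq_derive _ LE).
  have := @deriveM _ _ Ga (fun y => lam (jet r u y)) t.1 (ed l)
    (sm_derivable _ Gas) (sm_derivable _ lams').
  by move=> ->; rewrite Ga0 scale0r add0r.
have S0 : \sum_(l < 2) xi l (jet 0 u t.1) * (lam (jet r u t.1) * 'D_(ed l) Ga t.1) = 0.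
  transitivity (prolong xi eta L (jet r u t.1)); last exact: red.
  by rewrite (prolong_jet Hu Lt); apply: eq_bigr => l _; rewrite DL.
rewrite (sum_ord2 _ ii') in S0.
have nx' : xi i' (jet 0 u t.1) != 0 by rewrite jet0E.
move: S0 Gai (lam0 Omt Mt) nx'.
move: ('D_(ed i) Ga t.1) ('D_(ed i') Ga t.1) (lam _) (xi i _) (xi i' _) => a b c d e S0 a0 c0 e0.
move: S0; rewrite a0 !mulr0 add0r => /eqP; rewrite !mulf_eq0 (negbTE e0) (negbTE c0) /= => /eqP b0'.
by [].
Qed.

(** Differentiate u_i^(k) = gt(x, w, G) at t in direction i'. The left side is the kth Lie
    derivative of [b0]; on the right G contributes nothing, by [member_transversal], and the rest is
    the derivative of g along [Bf]. *)
Lemma member_compat u t : member u t -> (\forall y \near t.1, jet_ok (jet r u y)) ->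
  sm gt (t, 0) -> 'D_(Bf t) g t = lieD Af k b0 t.
Proof.
move=> mu ok gtt; have [Gas Ga0 Gai'] := member_transversal mu ok.
have [Hu _ _ _ _] := mu; have [us _ _ _] := Hu.
have [wt ut _ Di'] := member_line mu.
pose Ga y := G (pure_jet i k (jet r u y)).
have comm n : 'D_(ed i') (iderive (nseq n (ed i)) u) t.1 = lieD Af n b0 t.
  by rewrite derive_iderive_comm// Di'.
rewrite -(comm k).
have E : \forall y \near t.1, iderive (nseq k (ed i)) u y = gt ((y, wjet k i u y), Ga y).
  by apply: filter1 ok => y [_ _ _ _]; rewrite tj_jet// wj_jet.
rewrite (near_eq_derive _ E).
have s1 : sm (fun y => (y, wjet k i u y)) t.1 by apply: sm_pair; [exact: sm_id|exact: sm_wjet].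
have s2 : sm (fun y => ((y, wjet k i u y), Ga y)) t.1 by exact: sm_pair.
have q0 : ((t.1, wjet k i u t.1), Ga t.1) = (t, 0).
  by rewrite wt [Ga _]Ga0 -surjective_pairing.
rewrite (@derive_comp _ _ _ _ (fun y => ((y, wjet k i u y), Ga y)) gt); last 2 first.
- exact: sm_diff.
- by rewrite q0; exact: sm_diff.
suff -> : 'D_(ed i') (fun y => ((y, wjet k i u y), Ga y)) t.1 = (Bf t, 0) by rewrite q0 derive_fstE.
rewrite derive_pair; [|exact: sm_diff|exact: sm_diff]; apply: (f_equal2 pair); last exact: Gai'.
rewrite derive_pair; [|by apply: sm_diff; exact: sm_id|by apply: sm_diff; exact: sm_wjet].
rewrite derive_id_dir; congr (_, _); apply/rowP => a.
rewrite derive_rowE; last by apply: sm_derivable; exact: sm_wjet.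
rewrite [RHS]mxE -comm.
have -> : (fun y => wjet k i u y 0 a) = iderive (nseq a (ed i)) u by apply/funext => y; rewrite mxE.
by [].
Qed.

(** Supplies the hypotheses of [rigid_jet] for comparing [u] with the reference polynomial [p] at
    x0. *)
Lemma member_good u : member u s0 -> good_jet r xi eta i G u x0 /\
  forall a, (a <= k)%N -> iderive (nseq a (ed i)) u x0 = iderive (nseq a (ed i)) p x0.
Proof.
move=> mu; have [Hu _ _ _ _] := mu; have [us _ _ Qu] := Hu.
have [wt ut Gl _] := member_line mu; rewrite /= in us Qu wt ut Gl; split.
  split=> //.
    apply: (vanish_near_eq (f := fun=> 0)); last exact: vanish_cst0.
    by apply: filter1 Qu => y ->.
  by apply/vanish_pure => a _; exact: iderive_line0.
move=> a; rewrite leq_eqVlt => /orP[/eqP->|ak]; first by rewrite ut /g g0.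
by move/rowP : wt => /(_ (Ordinal ak)); rewrite !mxE.
Qed.

Let fS : fdim S := fdim_prod (fdim_rV R 2) (fdim_rV R k).

(* Through every t near s0 passes a solution of Q[u] = 0 with the data of Af. *)
Lemma member_family : exists uf : 'rV[R]_2 * S -> R, [/\ sm uf (x0, s0),
  \forall t \near s0, member (fun y => uf (y, t)) t & uf (x0, s0) = p x0].
Proof.
have [phi Hphi] := flow fS (sm_Afield i gs0).
pose fl (q : R * S) := phi q.1 q.2.
have sfl : sm fl (0, s0) by have [] := near_at Hphi.
have fl0 : fl (0, s0) = s0 by have [] := near_at Hphi.
pose gam (q : R * S) := P0 (fl q).
have gams : sm gam (0, s0) by apply: (@sm_comp _ _ _ _ _ _ fl) => //; rewrite fl0; exact: sm_ucoord.
have gam0 : gam (0, s0) = p x0 by rewrite /gam fl0 P00.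
(* The parameter of the Cauchy problem is the point t: the initial line passes through [t.1], and
   the data are the coordinate u along the integral curve of [Af] from t. *)
have [uf [ufs uf0 ufE ufL]] := cauchy_family fS ii' hs zs (sm_fst (x0, wjet k i p x0)) erefl gams gam0.
exists uf; split=> //.
pose em (q : 'rV[R]_2 * S) := emb (q.1, uf q).
have sem : sm em (x0, s0).
  apply: (@sm_comp _ _ _ _ _ _ (fun q : 'rV[R]_2 * S => (q.1, uf q)) emb); last exact: sm_emb.
  by apply: sm_pair => //; exact: sm_fst.
have em0 : em (x0, s0) = emb (x0, p x0) by rewrite /em uf0.
pose NQ (q : 'rV[R]_2 * S) := [/\ sm uf q,
  'D_(ed i', 0) uf q + z (q.1, uf q) * 'D_(ed i, 0) uf q = h (q.1, uf q),
   forall l, sm (xi l) (em q), sm eta (em q) & xi i' (em q) != 0].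
have nNQ : \forall q \near (x0, s0), NQ q.
  have n1 : \forall q \near (x0, s0), forall l, sm (xi l) (em q).
    apply: near_finite => l; apply: (near_sm sem (A := fun e => sm (xi l) e)).
    by rewrite em0; exact: sm_near.
  have n2 : \forall q \near (x0, s0), sm eta (em q).
    by apply: (near_sm sem (A := fun e => sm eta e)); rewrite em0; exact: sm_near.
  have n3 : \forall q \near (x0, s0), xi i' (em q) != 0.
    apply: near_neq0; last by rewrite em0.
    by apply: (@sm_comp _ _ _ _ _ _ em (xi i')) => //; rewrite em0.
  have := near_and (near_and (sm_near ufs) ufE) (near_and n1 (near_and n2 n3)).
  by apply: filter1 => q [[? ?] [? [? ?]]].
have sd : sm (fun t : S => (t.1, t)) s0 by apply: sm_pair; [exact: sm_fst|exact: sm_id].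
have nd : \forall t \near s0, \forall q \near (t.1, t), NQ q.
  exact: (near_sm sd (A := fun q => \forall w \near q, NQ w)) (near_near nNQ).
pose NA (q : R * S) := [/\ sm fl q, is_derive q.1 1 (fun s => phi s q.2) (Af (phi q.1 q.2)),
  phi 0 q.2 = q.2 & uf (q.2.1 + q.1 *: ed i, q.2) = gam q].
have nNA : \forall q \near (0 : R, s0), NA q.
  by have := near_and Hphi ufL; apply: filter1 => q [[? ? ? _] ?].
have na : \forall t \near s0, \forall q \near (0 : R, t), NA q.
  exact: (near_snd _ _ (A := fun q => \forall w \near q, NA w)) (near_near nNA).
have nG : \forall t \near s0, \forall s \near t, G (s.1, snoc s.2 (g s)) = 0.
  by apply: near_near; exact: (near_fst fS (fdim_R R) gF).
have := near_and (near_and nd na) (near_and nG (near_and (sm_near gs0) (sm_near bs0))).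
apply: filter1 => t [[ndt nat_] [nGt [gst bst]]].
have [uft _ xst est xnt] := near_at ndt.
have sy : sm (fun y : 'rV[R]_2 => (y, t)) t.1 by apply: sm_pair; [exact: sm_id|exact: sm_cst].
have us : sm (fun y => uf (y, t)) t.1 by exact: (@sm_comp _ _ _ _ _ _ (fun y => (y, t)) uf).
split=> //.
- split=> //; [by move=> l; rewrite jet0E; exact: xst|by rewrite jet0E|].
  have := near_and (near_fst (fdim_rV R 2) fS ndt) (sm_near us).
  apply: filter1 => y [[_ E _ _ nz] uy].
  rewrite (char_hz eta ii' uy nz).
  rewrite !derive_fstE in E; rewrite -/h -/z; move: E.
  move: ('D_(ed i') _ y) ('D_(ed i) _ y) (h _) (z _) (xi i' _) => a b c d e <-.
  by rewrite addrK subrr mulr0.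
- have [_ _ p0t _] := near_at nat_.
  have line := near_fst (fdim_R R) fS nat_.
  exists (fun s => phi s t); split.
  + apply: (@sm_comp _ _ _ _ _ _ (fun s : R => (s, t)) fl); last by have [] := near_at nat_.
    by apply: sm_pair; [exact: sm_id|exact: sm_cst].
  + exact: p0t.
  + by apply: filter1 line => s [_ [_ <-] _ _].
  + have [e e0 He] := (near_ball1 _ _).1 line.
    apply/near_ball1; exists e => // s; rewrite subr0 => se.
    have d1 (w : R) : `|w| < e -> is_derive w 1 (fun s => (phi s t).1) (ed i).
      move=> we; have [|_ dw _ _] := He w; first by rewrite subr0.
      have := is_derive_curve dw (sm_diff (sm_fst _)); congr is_derive.
      have lf : linear (@fst 'rV[R]_2 'rV[R]_k) by [].
      pose lM := GRing.isLinear.Build _ _ _ _ _ lf.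
      pose Lf : {linear S -> 'rV[R]_2} := HB.pack (@fst 'rV[R]_2 'rV[R]_k) lM.
      apply: (etrans (@derive_lin _ _ _ Lf _ _ _)) => // y.
      by apply: sm_cont; exact: sm_fst.
    by rewrite (curve_affine (fdim_rV R 2) d1 se) p0t.
  + by apply: filter1 line => s [_ _ _].
Qed.

(** [member_compat] requires the jets of the auxiliary functions to be close to j0. At s0 the jet is
    j0 itself by rigidity, and continuity extends this to nearby parameters and points. *)
Theorem compat : \forall t \near s0, 'D_(Bf t) g t = lieD Af k b0 t.
Proof.
have [uf [ufs mf uf0]] := member_family.
pose K (q : 'rV[R]_2 * S) := jet r (fun y => uf (y, q.2)) q.1.
have sK : sm K (x0, s0).
  apply: sm_pair; first exact: sm_fst.
  apply: sm_row => l.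
  have := sm_iderive [seq (v, 0) | v <- nseq (mi l).1 (delta_mx 0 0) ++ nseq (mi l).2 (delta_mx 0 1)] ufs.
  apply: sm_ext; apply: near_all => -[y t]; exact: iderive_fstE.
have K0 : K (x0, s0) = j0.
  have [ug up] := member_good (near_at mf).
  have E := rigid_jet ii' ug pg up Gs Gn xs es xn.
  exact: E.
have nK : \forall q \near (x0, s0), jet_ok (K q).
  by apply: (near_sm sK (A := jet_ok)); rewrite K0; exact: near_jet_ok.
have sd : sm (fun t : S => (t.1, t)) s0 by apply: sm_pair; [exact: sm_fst|exact: sm_id].
have nd : \forall t \near s0, \forall q \near (t.1, t), jet_ok (K q).
  exact: (near_sm sd (A := fun q => \forall w \near q, jet_ok (K w))) (near_near nK).
have ngt : \forall t \near s0, sm gt (t, 0) by have := near_fst fS (fdim_R R) (sm_near gs).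
have := near_and mf (near_and nd ngt); apply: filter1 => t [mt [dt gtt]].
by apply: member_compat mt _ gtt; have := near_fst (fdim_rV R 2) fS dt.
Qed.


(** * The integral surfaces as the family of invariant solutions *)

Section Leaves.
Variables Phi Psi : S -> 'rV[R]_k.
Hypotheses (Phis : sm Phi s0) (Phi0 : Phi s0 = w0) (Psis : sm Psi s0) (Psi0 : Psi s0 = w0)
  (PP : \forall q \near s0, Psi (q.1, Phi q) = q.2 /\ Phi (q.1, Psi q) = q.2)
  (PhiA : \forall q \near s0, 'D_(ed i, 0) Phi q = (Af (q.1, Phi q)).2)
  (PhiB : \forall q \near s0, 'D_(ed i', 0) Phi q = (Bf (q.1, Phi q)).2).

Let Zp (q : S) : S := (q.1, Phi q).
Let Yp (q : S) : S := (q.1, Psi q).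
Definition solution_family (q : S) : R := P0 (q.1, Phi q).
Local Notation f := solution_family.

Let sZp : sm Zp s0. Proof. by apply: sm_pair => //; exact: sm_fst. Qed.
Let Zp0 : Zp s0 = s0. Proof. by rewrite /Zp Phi0. Qed.
Let sYp : sm Yp s0. Proof. by apply: sm_pair => //; exact: sm_fst. Qed.
Let Yp0 : Yp s0 = s0. Proof. by rewrite /Yp Psi0. Qed.

Let DZ : \forall q \near s0, 'D_(ed i, 0) Zp q = Af (Zp q) /\ 'D_(ed i', 0) Zp q = Bf (Zp q).
Proof.
have := near_and (sm_near Phis) (near_and PhiA PhiB); apply: filter1 => q [sq [A1 B1]].
have E v : 'D_v Zp q = (v.1, 'D_v Phi q).
  rewrite derive_pair; [|by apply: sm_diff; exact: sm_fst|exact: sm_diff].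
  by rewrite derive_fst_id.
by rewrite !E A1 B1.
Qed.

Let nZ (A : set S) : (\forall s \near s0, A s) -> \forall q \near s0, A (Zp q).
Proof. by move=> H; apply: (near_sm sZp); rewrite Zp0. Qed.

Lemma family_smooth0 : \forall q \near s0, sm f q.
Proof.
apply: sm_near; apply: (@sm_comp _ _ _ _ _ _ Zp P0); first exact: sZp.
by rewrite Zp0; exact: sm_ucoord.
Qed.

Lemma family_pure : \forall q \near s0, forall a : 'I_k.+1,
  iderive (nseq a (ed i)) (fun y => f (y, q.2)) q.1 = lieD Af a P0 (Zp q).
Proof.
apply: near_finite => a.
have H := @lie_comp R S S fS fS Zp (ed i, 0) s0 Af a P0 sZp.
rewrite Zp0 in H.
have D1 : \forall q \near s0, 'D_(ed i, 0) Zp q = Af (Zp q) by apply: filter1 DZ => q [].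
have {H D1} := H (sm_Afield i gs0) (sm_ucoord gs0) D1.
apply: filter1 => -[x c] <-; rewrite -iderive_fstE; congr (iderive _ _ _).
by rewrite map_nseq.
Qed.

Lemma family_jet : \forall q \near s0, let u y := f (y, q.2) in
  [/\ wjet k i u q.1 = Phi q, iderive (nseq k (ed i)) u q.1 = g (Zp q) &
      G (pure_jet i k (jet r u q.1)) = 0].
Proof.
have nG := nZ (near_fst fS (fdim_R R) gF).
have := near_and family_pure nG; apply: filter1 => q [Hq Gq] u.
have wE : wjet k i u q.1 = Phi q.
  apply/rowP => a; rewrite mxE.
  by have := Hq (widen_ord (leqnSn k) a) => /= ->; rewrite lieD_ucoord_lt.
have uE : iderive (nseq k (ed i)) u q.1 = g (Zp q).
  by have := Hq ord_max => /= ->; rewrite lieD_ucoord_max.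
by split=> //; rewrite pure_jet_snoc// wE uE.
Qed.

(** Derivatives of [f] in directions i and i' are those of the coordinate u along [Af] and [Bf]. By
    [compat] the latter is [bcoord], which was defined so that Q[u] = 0 holds. *)
Lemma family_invariant : \forall q \near s0, invariant_near xi eta (fun y => f (y, q.2)) q.1.
Proof.
pose ef (q : S) := emb (q.1, f q).
have f0 : f s0 = p x0 by rewrite /solution_family Phi0.
have sef : sm ef s0.
  apply: (@sm_comp _ _ _ _ _ _ (fun q : S => (q.1, f q)) emb); last exact: sm_emb.
  by apply: sm_pair; [exact: sm_fst|exact: near_at family_smooth0].
have ef0 : ef s0 = jet 0 p x0 by rewrite /ef f0 jet0E.
have n1 : \forall q \near s0, forall l, sm (xi l) (ef q).
  apply: near_finite => l; apply: (near_sm sef (A := fun e => sm (xi l) e)).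
  by rewrite ef0; exact: sm_near.
have n2 : \forall q \near s0, sm eta (ef q).
  by apply: (near_sm sef (A := fun e => sm eta e)); rewrite ef0; exact: sm_near.
have n3 : \forall q \near s0, xi i' (ef q) != 0.
  apply: near_neq0; last by rewrite ef0.
  by apply: (@sm_comp _ _ _ _ _ _ ef (xi i')) => //; rewrite ef0.
have n4 : \forall q \near s0, characteristic xi eta (jet 1 (fun y => f (y, q.2)) q.1) = 0.
  have := near_and (near_and family_smooth0 n3) (near_and (near_and (sm_near sZp) (nZ (sm_near gs0))) (near_and DZ (nZ compat))).
  apply: filter1 => -[x c] [[fq nq] [[zq gq] [[ZA ZB] cq]]].
  have us : sm (fun y => f (y, c)) x.
    by apply: (@sm_comp _ _ _ _ _ _ (fun y => (y, c)) f) => //; apply: sm_pair; [exact: sm_id|exact: sm_cst].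
  rewrite /= (char_hz eta ii' us nq) -!derive_fstE.
  have Pd : sm P0 (Zp (x, c)) by exact: sm_ucoord.
  have Df v : 'D_v f (x, c) = 'D_('D_v Zp (x, c)) P0 (Zp (x, c)).
    by rewrite -(@derive_comp _ _ _ _ Zp P0)//; exact: sm_diff.
  rewrite !Df ZA ZB (derive_Bfield_ucoord cq) /bcoord -/h -/z.
  by rewrite [X in _ * X]subrr mulr0.
have := near_and (near_and family_smooth0 n1) (near_and n2 (near_near n4)).
apply: filter1 => -[x c] [[fq xq] [eq n4q]]; split=> /=.
- by apply: (@sm_comp _ _ _ _ _ _ (fun y => (y, c)) f) => //; apply: sm_pair; [exact: sm_id|exact: sm_cst].
- by move=> l; rewrite jet0E; exact: xq.
- by rewrite jet0E.
- exact: (near_fst (fdim_rV R 2) (fdim_rV R k) n4q).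
Qed.

Let K (q : S) := jet r (fun y => f (y, q.2)) q.1.

Lemma family_jet_smooth : sm K s0.
Proof.
apply: sm_pair; first exact: sm_fst.
apply: sm_row => l.
have := sm_iderive [seq (v, 0) | v <- nseq (mi l).1 (delta_mx 0 0) ++ nseq (mi l).2 (delta_mx 0 1)] (near_at family_smooth0).
apply: sm_ext; apply: near_all => -[y t]; exact: iderive_fstE.
Qed.

(** Rigidity once more: the family is built from pure derivatives up to order k, yet its full r-jet
    at the base point is j0, so jets of nearby members stay near j0. *)
Lemma family_jet0 : K s0 = j0.
Proof.
have Hu := near_at family_invariant; have [us _ _ Qu] := Hu.
have [wE uE _] := near_at family_jet; rewrite /= in us Qu wE uE.
have ug : good_jet r xi eta i G (fun y => f (y, w0)) x0.
  split=> //.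
    apply: (vanish_near_eq (f := fun=> 0)); last exact: vanish_cst0.
    by apply: filter1 Qu => y ->.
  apply: (vanish_near_eq (f := fun=> 0)); last exact: vanish_cst0.
  have := near_fst (fdim_rV R 2) (fdim_rV R k) family_jet.
  by apply: filter1 => y [_ _] /= <-; rewrite !pure_jet_snoc.
have up a : (a <= k)%N -> iderive (nseq a (ed i)) (fun y => f (y, w0)) x0 = iderive (nseq a (ed i)) p x0.
  rewrite leq_eqVlt => /orP[/eqP->|ak]; first by rewrite uE Zp0 /g g0.
  move: wE; rewrite -/s0 Phi0 => /rowP /(_ (Ordinal ak)); rewrite !mxE.
  by [].
have E := rigid_jet ii' ug pg up Gs Gn xs es xn; exact: E.
Qed.

(* Psi labels the leaves of the integrable distribution spanned by Af and Bf. *)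
Lemma Psi_constant : \forall s \near s0, 'D_(Af s) Psi s = 0 /\ 'D_(Bf s) Psi s = 0.
Proof.
have H : \forall q \near s0, 'D_(Af (Zp q)) Psi (Zp q) = 0 /\ 'D_(Bf (Zp q)) Psi (Zp q) = 0.
  have n1 : \forall q \near s0, Psi (Zp q) = q.2 by apply: filter1 PP => q [].
  have := near_and (near_and (near_near n1) DZ) (near_and (sm_near sZp) (nZ (sm_near Psis))).
  apply: filter1 => q [[n1q [ZA ZB]] [zq pq]].
  have E v : 'D_('D_v Zp q) Psi (Zp q) = v.2.
    rewrite -(@derive_comp _ _ _ _ Zp Psi); [|exact: sm_diff|exact: sm_diff].
    by rewrite (near_eq_derive _ n1q) derive_snd_id.
  by have := E (ed i, 0); have := E (ed i', 0); rewrite ZA ZB => -> ->.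
have H2 : \forall s \near s0, 'D_(Af (Zp (Yp s))) Psi (Zp (Yp s)) = 0 /\ 'D_(Bf (Zp (Yp s))) Psi (Zp (Yp s)) = 0.
  apply: (near_sm sYp (A := fun q => 'D_(Af (Zp q)) Psi (Zp q) = 0 /\ 'D_(Bf (Zp q)) Psi (Zp q) = 0)).
  by rewrite Yp0.
have := near_and H2 PP; apply: filter1 => s [Hs [_ ps]].
by move: Hs; rewrite (_ : Zp (Yp s) = s)// /Zp /Yp /= ps -surjective_pairing.
Qed.

(** The properties of all jets near j0 used to place an arbitrary solution in the family. The last
    ones say that [Psi] is a first integral of both fields and that [Phi] inverts it at the point
    (x, w) below the jet. *)
Definition nice_jet (j : jet_space R r) := [/\ jet_ok j,
  (forall l, sm (xi l) (jproj 0 j)) /\ sm eta (jproj 0 j), xi i' (jproj 0 j) != 0,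
  [/\ sm g (j.1, wj i j), sm b0 (j.1, wj i j) & sm Psi (j.1, wj i j)] &
  ('D_(Af (j.1, wj i j)) Psi (j.1, wj i j) = 0 /\ 'D_(Bf (j.1, wj i j)) Psi (j.1, wj i j) = 0) /\
  Phi (j.1, Psi (j.1, wj i j)) = wj i j].

Let sj (j : jet_space R r) : S := (j.1, wj i j).

Let sm_sj j : sm sj j.
Proof. by apply: sm_pair; [exact: sm_fst|exact: sm_wj]. Qed.

Let sj0 : sj j0 = s0.
Proof. by rewrite /sj /j0 wj_jet. Qed.

Lemma near_nice : \forall j \near j0, nice_jet j.
Proof.
have pj : jproj 0 j0 = jet 0 p x0 by rewrite /j0 jproj_jet.
have n1 : \forall j \near j0, forall l, sm (xi l) (jproj 0 j).
  apply: near_finite => l; apply: (near_sm (sm_jproj 0 j0) (A := fun e => sm (xi l) e)).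
  by rewrite pj; exact: sm_near.
have n2 : \forall j \near j0, sm eta (jproj 0 j).
  by apply: (near_sm (sm_jproj 0 j0) (A := fun e => sm eta e)); rewrite pj; exact: sm_near.
have n3 : \forall j \near j0, xi i' (jproj 0 j) != 0.
  apply: near_neq0; last by rewrite pj.
  by apply: (@sm_comp _ _ _ _ _ _ (@jproj R r 0) (xi i')); [exact: sm_jproj|rewrite pj].
pose C s := [/\ sm g s, sm b0 s & sm Psi s] /\
  ('D_(Af s) Psi s = 0 /\ 'D_(Bf s) Psi s = 0) /\ Phi (s.1, Psi s) = s.2.
have n4 : \forall j \near j0, C (sj j).
  apply: (near_sm (sm_sj j0) (A := C)); rewrite sj0.
  have := near_and (near_and (sm_near gs0) (near_and (sm_near bs0) (sm_near Psis))) (near_and Psi_constant PP).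
  by apply: filter1 => s [[? [? ?]] [? [_ ?]]].
have := near_and (near_and near_jet_ok n1) (near_and n2 (near_and n3 n4)).
by apply: filter1 => j [[? ?] [? [? [? ?]]]].
Qed.

Definition nice_solution (u : 'rV[R]_2 -> R) y := [/\ sm u y, nice_jet (jet r u y),
  characteristic xi eta (jet 1 u y) = 0 & L (jet r u y) = 0].

Let pt (u : 'rV[R]_2 -> R) y : S := (y, wjet k i u y).

Let sj_jet u y : (y, wj i (jet r u y)) = pt u y.
Proof. by rewrite wj_jet. Qed.

(** The jet of a Q-invariant function lies on Q_(r), where L = lam G with lam nonzero. So L = 0
    forces G = 0, and the highest derivative is [gt] at the value 0. *)
Lemma nice_top u y : (\forall y' \near y, nice_solution u y') ->
  iderive (nseq k (ed i)) u y = g (pt u y).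
Proof.
move=> H; have [us [[Omj _ _ _ tjE] [xl el] xj _ _] _ L0] := near_at H.
have Hu : invariant_near xi eta u y.
  split=> //; first by move=> l; have := xl l; rewrite jproj_jet.
    by have := el; rewrite jproj_jet.
  by apply: filter1 H => y' [].
have Mj : Qmanifold xi eta r (jet r u y) by exact: Qmanifold_jet.
have G0 : G (pure_jet i k (jet r u y)) = 0.
  have := LG Omj Mj; rewrite L0 => /esym/eqP.
  by rewrite mulf_eq0 (negbTE (lam0 Omj Mj)) => /eqP.
by move: tjE; rewrite tj_jet// wj_jet// G0.
Qed.

(** The surface y |-> (y, w-jet of u) is tangent to both fields: in direction i derivatives shift by
    one and [nice_top] closes the chain, in direction i' one differentiates Q[u] = 0 along direction
    i. *)
Lemma nice_fields u y : (\forall y' \near y, nice_solution u y') ->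
  [/\ u y = P0 (pt u y), sm (pt u) y, 'D_(ed i) (pt u) y = Af (pt u y) &
      'D_(ed i') (pt u) y = Bf (pt u y)].
Proof.
move=> H; have [us [_ [xl el] xj [gy by_ _] _] Q0 _] := near_at H.
rewrite sj_jet in gy by_.
have top y' : (\forall y'' \near y', nice_solution u y'') ->
    snoc (wjet k i u y') (g (pt u y')) = \row_(a < k.+1) iderive (nseq a (ed i)) u y'.
  move=> H'; apply: (snocP (c := fun a => iderive (nseq a (ed i)) u y')).
    by move=> a; rewrite mxE.
  by rewrite -nice_top.
have uP y' : (\forall y'' \near y', nice_solution u y'') -> u y' = P0 (pt u y').
  by move=> H'; rewrite /ucoord top// mxE.
have ptD y' v : sm u y' -> 'D_v (pt u) y' = (v, 'D_v (wjet k i u) y').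
  move=> us'; rewrite derive_pair; [|by apply: sm_diff; exact: sm_id|by apply: sm_diff; exact: sm_wjet].
  by rewrite derive_id_dir.
have wD y' v (a : 'I_k) : sm u y' -> ('D_v (wjet k i u) y') 0 a = 'D_v (iderive (nseq a (ed i)) u) y'.
  move=> us'; rewrite derive_rowE; last by apply: sm_derivable; exact: sm_wjet.
  have -> : (fun y => wjet k i u y 0 a) = iderive (nseq a (ed i)) u by apply/funext => y1; rewrite mxE.
  by [].
have ptA y' : (\forall y'' \near y', nice_solution u y'') -> 'D_(ed i) (pt u) y' = Af (pt u y').
  move=> H'; have [us' _ _ _] := near_at H'.
  rewrite ptD// /Afield; apply: (f_equal2 pair) => //; apply/rowP => a.
  by rewrite wD// [RHS]mxE top// [RHS]mxE lift0.
have spt : sm (pt u) y by apply: sm_pair; [exact: sm_id|exact: sm_wjet].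
split=> //; [exact: uP|exact: ptA|].
have nA : \forall y' \near y, 'D_(ed i) (pt u) y' = Af (pt u y').
  by apply: filter1 (near_near H) => y'; exact: ptA.
have nB : \forall y' \near y, 'D_(ed i') u y' = b0 (pt u y').
  have n1 : \forall y' \near y, u y' = P0 (pt u y').
    by apply: filter1 (near_near H) => y'; exact: uP.
  have := near_and (near_and H nA) (near_and (near_near n1) (sm_near spt)).
  apply: filter1 => y' [[[us' [_ _ nz [gy' _ _] _] Q' _] A'] [n1' sp']].
  rewrite sj_jet in gy'; rewrite jproj_jet// jet0E in nz.
  have := char_hz eta ii' us' nz; rewrite Q' => /esym/eqP.
  rewrite mulf_eq0 (negbTE nz) /= subr_eq0 => /eqP <-.
  have -> : 'D_(ed i) u y' = 'D_(Af (pt u y')) P0 (pt u y').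
    rewrite (near_eq_derive _ n1') (@derive_comp _ _ _ _ (pt u) P0); [|exact: sm_diff|].
      by rewrite A'.
    by apply: sm_diff; exact: sm_ucoord.
  by rewrite /bcoord -/h -/z -(near_at n1').
rewrite ptD// /Bfield; apply: (f_equal2 pair) => //; apply/rowP => a.
rewrite wD// [RHS]mxE derive_iderive_comm// (iderive_near_eq _ nB).
exact: near_at (lie_comp (fdim_rV R 2) fS a spt (sm_Afield i gy) by_ nA).
Qed.

Lemma nice_leaf u y : (\forall y' \near y, nice_solution u y') ->
  [/\ u y = f (y, Psi (pt u y)), sm (fun y => Psi (pt u y)) y &
    forall v, 'D_v (fun y => Psi (pt u y)) y = 0].
Proof.
move=> H; have [_ [_ _ _ [_ _ py] [[A0 B0] PP']] _ _] := near_at H.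
have [uP spt DA DB] := nice_fields H.
rewrite /= !sj_jet in py A0 B0 PP'; rewrite wj_jet// in PP'.
have sps : sm (fun y => Psi (pt u y)) y by exact: (@sm_comp _ _ _ _ _ _ (pt u) Psi).
split; [by rewrite /solution_family PP'|exact: sps|].
have D l : 'D_(ed l) (fun y => Psi (pt u y)) y = 0.
  rewrite (@derive_comp _ _ _ _ (pt u) Psi); [|exact: sm_diff|exact: sm_diff].
  have [E|E] := neq_ord2 l ii'; rewrite E; [rewrite DA; exact: A0|rewrite DB; exact: B0].
move=> v; rewrite (row_sum_delta v) derive_sumv; last exact: sm_diff.
apply: big1 => l _; rewrite deriveZv; last exact: sm_diff.
have := D l; rewrite /ed => ->; exact: scaler0.
Qed.

(** The first integral [Psi] has zero derivative along the surface of a solution, so on a connected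
    domain it is constant; this constant is the parameter. *)
Lemma nice_unique (W : set 'rV[R]_2) u : open W -> connected W ->
  (forall y, W y -> nice_solution u y) -> forall y y', W y -> W y' ->
  u y' = f (y', Psi (pt u y)).
Proof.
move=> Wo Wc H y y' Wy Wy'.
have nW t : W t -> \forall s \near t, nice_solution u s.
  by move=> Wt; apply: filter1 H _; exact: near_open.
have [-> _ _] := nice_leaf (nW _ Wy'); congr (f (_, _)).
apply/rowP => a.
apply: (zero_derive_connected (f := fun y => (Psi (pt u y)) 0 a) Wo Wc) => // t v Wt.
have [_ sp D0] := nice_leaf (nW _ Wt).
have spa : derivable (fun y => (Psi (pt u y)) 0 a) t v.
  by apply: sm_derivable; exact: sm_coordF.
apply: DeriveDef => //; rewrite -derive_rowE; last exact: sm_derivable.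
by rewrite D0 mxE.
Qed.

(** The Jacobian matrix has more rows than columns, hence a nonzero left kernel vector. *)
Lemma derive_kernel (m : nat) (A : 'rV[R]_k -> 'rV[R]_m) c : (m < k)%N -> sm A c ->
  exists2 v : 'rV[R]_k, v != 0 & 'D_v A c = 0.
Proof.
move=> mk As; pose M : 'M[R]_(k, m) := \matrix_(a, b) ('D_(delta_mx 0 a) A c) 0 b.
have : kermx M != 0.
  by rewrite -mxrank_eq0 mxrank_ker subn_eq0 -ltnNge (leq_ltn_trans (rank_leq_col M)).
case/rowV0Pn => v /sub_kermxP vM vn; exists v => //.
rewrite (row_sum_delta v) derive_sumv; last exact: sm_diff.
apply/rowP => b; rewrite summxE [RHS]mxE.
transitivity ((v *m M) 0 b); last by rewrite vM mxE.
rewrite mxE; apply: eq_bigr => a _; rewrite deriveZv; last exact: sm_diff.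
by rewrite !mxE.
Qed.

Definition nice_point (q : S) := [/\ sm f q, sm Phi q, sm Psi (Zp q),
  \forall t \near q, Psi (Zp t) = t.2 & \forall t \near q, forall a : 'I_k,
    iderive (nseq a (ed i)) (fun y => f (y, t.2)) t.1 = Phi t 0 a].

Lemma near_nice_point : \forall q \near s0, nice_point q.
Proof.
have n1 : \forall q \near s0, Psi (Zp q) = q.2 by apply: filter1 PP => q [].
have n2 : \forall q \near s0, forall a : 'I_k,
    iderive (nseq a (ed i)) (fun y => f (y, q.2)) q.1 = Phi q 0 a.
  apply: filter1 family_pure => q H a.
  by have := H (widen_ord (leqnSn k) a) => /= ->; rewrite lieD_ucoord_lt.
have := near_and (near_and family_smooth0 (sm_near Phis))
  (near_and (nZ (sm_near Psis)) (near_and (near_near n1) (near_near n2))).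
by apply: filter1 => q [[? ?] [? [? ?]]].
Qed.

(* With fewer parameters some direction v would be invisible to f, hence to its
   x_i-derivatives, which are the components of Phi; but Phi is invertible. *)
Lemma essential_family (U : set 'rV[R]_2) (C : set 'rV[R]_k) :
  (forall x c, U x -> C c -> nice_point (x, c)) -> essential U C f.
Proof.
move=> H m U' C' A g' mk U'o [x1 U'x1] U'U C'o [c1 C'c1] C'C sA sg' E.
have [fq Pq Yq inv1 pure] := H _ _ (U'U _ U'x1) (C'C _ C'c1).
have As : sm A c1 by move: c1 C'c1 {fq Pq Yq inv1 pure}; exact/smooth_onP.
have g's : sm g' (x1, A c1).
  by move/smooth_onP : sg'; apply; split=> //=; exists c1.
have [v vn Av] := derive_kernel mk As.
have sA1 : sm (fun c => (x1, A c)) c1 by apply: sm_pair => //; exact: sm_cst.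
have s1 : sm (fun c : 'rV[R]_k => (x1, c)) c1 by apply: sm_pair; [exact: sm_cst|exact: sm_id].
have sP1 : sm (fun c => Phi (x1, c)) c1 by exact: (@sm_comp _ _ _ _ _ _ (fun c => (x1, c)) Phi).
have Pv : 'D_v (fun c => Phi (x1, c)) c1 = 0.
  apply/rowP => a; rewrite derive_rowE; last exact: sm_derivable.
  pose ga := iderive (nseq a (ed i, 0)) g'.
  have gas : sm ga (x1, A c1) by exact: sm_iderive.
  have Ea : \forall c \near c1, Phi (x1, c) 0 a = ga (x1, A c).
    have := near_and (near_snd (fdim_rV R 2) (fdim_rV R k) pure) (near_open C'o C'c1).
    apply: filter1 => c [/= pc C'c]; rewrite -pc.
    have n1 : \forall y \near x1, f (y, c) = g' (y, A c).
      by apply: filter1 (near_open U'o U'x1) => y U'y; exact: E.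
    rewrite (iderive_near_eq _ n1) -iderive_fstE /ga; congr (iderive _ _ _).
    by rewrite map_nseq.
  rewrite (near_eq_derive _ Ea) (@derive_comp _ _ _ _ (fun c => (x1, A c)) ga); [|exact: sm_diff|exact: sm_diff].
  rewrite derive_pair; [|by apply: sm_diff; exact: sm_cst|exact: sm_diff].
  by rewrite derive_cst Av mxE derive0v//; exact: sm_diff.
have n2 : \forall c \near c1, Psi (x1, Phi (x1, c)) = c.
  exact: (near_snd (fdim_rV R 2) (fdim_rV R k) inv1).
have sZ1 : sm (fun c => (x1, Phi (x1, c))) c1 by apply: sm_pair => //; exact: sm_cst.
have : 'D_v (fun c => Psi (x1, Phi (x1, c))) c1 = v.
  by rewrite (near_eq_derive _ n2) derive_id_dir.
rewrite (@derive_comp _ _ _ _ (fun c => (x1, Phi (x1, c))) Psi); [|exact: sm_diff|exact: sm_diff].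
rewrite derive_pair; [|by apply: sm_diff; exact: sm_cst|exact: sm_diff].
rewrite derive_cst Pv derive0v; last exact: sm_diff.
by move=> /esym /eqP; rewrite (negbTE vn).
Qed.

(** All required properties hold near s0, hence on a product of two balls, which become the domain
    [U] and the parameter set [C]. *)
Theorem leaf_solutions : exists (U : set 'rV[R]_2) (V : set (jet_space R r)) (C : set 'rV[R]_k)
         (f : 'rV[R]_2 * 'rV[R]_k -> R),
    [/\ open U, U j0.1, open V, V j0 & V `<=` Om] /\
    parametric_family U C f /\
    (forall c, C c ->
       Qinvariant_solution xi eta V L U (fun x => f (x, c))) /\
    (forall (W : set 'rV[R]_2) (u : 'rV[R]_2 -> R),
       open W -> connected W -> W `<=` U ->
       Qinvariant_solution xi eta V L W u ->
       exists2 c, C c & forall x, W x -> u x = f (x, c)).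
Proof.
have nK : \forall q \near s0, \forall j \near K q, nice_jet j.
  apply: (near_sm family_jet_smooth (A := fun j => \forall j' \near j, nice_jet j')).
  by rewrite family_jet0; exact: near_near near_nice.
have := near_and (near_and near_nice_point nK) (near_and family_jet family_invariant).
move=> /near_box2[e e0 He].
pose U := ball_ Num.norm x0 e; pose C := ball_ Num.norm w0 e.
have Ux0 : U x0 by rewrite /U /ball_ /= subrr normr0.
have Cw0 : C w0 by rewrite /C /ball_ /= subrr normr0.
have Uo : open U by exact: open_ball_norm.
have Co : open C by exact: open_ball_norm.
have box x c : U x -> C c -> [/\ nice_point (x, c), \forall j \near K (x, c), nice_jet j,
    wjet k i (fun y => f (y, c)) x = Phi (x, c), G (pure_jet i k (K (x, c))) = 0 &
    invariant_near xi eta (fun y => f (y, c)) x].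
  rewrite /U /C /ball_ /= => Ux Cc.
  have [||[h1 h2] [[h3 _ h4] h5]] := He x c; by rewrite // distrC.
(* Requiring the value of [Psi] to lie in [C] makes the parameter of any solution with jets in [V]
   admissible; taking the interior makes [V] open. *)
pose V : set (jet_space R r) := interior [set j | nice_jet j /\ C (Psi (sj j))].
have nV j : sm (fun j => Psi (sj j)) j -> C (Psi (sj j)) -> (\forall j' \near j, nice_jet j') -> V j.
  by move=> sp Cj nj; apply: near_and nj _; apply: (near_sm sp); exact: near_open.
have sPsj j : sm Psi (sj j) -> sm (fun j => Psi (sj j)) j.
  by move=> ?; apply: (@sm_comp _ _ _ _ _ _ sj Psi) => //; exact: sm_sj.
have Vn j : V j -> nice_jet j /\ C (Psi (sj j)) by move=> /interior_subset.
exists U, V, C, f; split; [split=> //|split; [split=> //|split]].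
- exact: open_interior.
- by apply: nV near_nice; [apply: sPsj|]; rewrite sj0// Psi0.
- by move=> j /Vn[[[]]].
- by exists w0.
- by apply/smooth_onP => -[x c] [/= Ux Cc]; have [[]] := box x c Ux Cc.
- by apply: essential_family => x c Ux Cc; have [] := box x c Ux Cc.
- move=> c Cc; split.
    by apply/smooth_onP => x Ux; have [_ _ _ _ []] := box x c Ux Cc.
  move=> x Ux; have [[_ _ Yq /near_at Yc _] nj wE G0 Hu] := box x c Ux Cc.
  have [_ _ _ Qu] := Hu.
  have sjE : sj (K (x, c)) = Zp (x, c) by rewrite /sj /K /= wj_jet// wE.
  split; [|exact: near_at Qu|].
    by apply: nV nj; [apply: sPsj|]; rewrite sjE// Yc.
  have [[Oj _ _ _ _] _ _ _ _] := near_at nj.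
  by rewrite LG// ?[G _]G0 ?mulr0//; exact: Qmanifold_jet.
- move=> W u Wo Wc WU [us Hu].
  (* On an empty domain every parameter will do, and w0 is one. *)
  have [[y Wy]|W0] := pselect (W !=set0); last first.
    by exists w0 => // x Wx; case: W0; exists x.
  have nsol t : W t -> nice_solution u t.
    move=> Wt; have [/Vn[nj _] Q0 L0] := Hu t Wt; split=> //.
    by move: t Wt {nj Q0 L0}; exact/smooth_onP.
  exists (Psi (pt u y)); last by move=> x Wx; exact: (nice_unique Wo Wc nsol Wy Wx).
  by have [/Vn[_ Cy] _ _] := Hu y Wy; rewrite -sj_jet.
Qed.

End Leaves.

Theorem local_solutions : exists (U : set 'rV[R]_2) (V : set (jet_space R r)) (C : set 'rV[R]_k)
         (f : 'rV[R]_2 * 'rV[R]_k -> R),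
    [/\ open U, U j0.1, open V, V j0 & V `<=` Om] /\
    parametric_family U C f /\
    (forall c, C c ->
       Qinvariant_solution xi eta V L U (fun x => f (x, c))) /\
    (forall (W : set 'rV[R]_2) (u : 'rV[R]_2 -> R),
       open W -> connected W -> W `<=` U ->
       Qinvariant_solution xi eta V L W u ->
       exists2 c, C c & forall x, W x -> u x = f (x, c)).
Proof.
have AB : \forall s \near s0, 'D_(Af s) Bf s = 'D_(Bf s) Af s.
  have := near_and (near_near compat) (near_and (sm_near gs0) (sm_near bs0)).
  by apply: filter1 => s [? [? ?]]; exact: commute_fields.
have sa : sm (fun s => (Af s).2) s0 by apply: sm_snd_comp; exact: sm_Afield.
have sb : sm (fun s => (Bf s).2) s0 by apply: sm_snd_comp; exact: sm_Bfield.
have [Phi [Psi [[? ?] [? ?] ? ? ?]]] := frobenius (fdim_rV R k) ii' sa sb AB.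
exact: (@leaf_solutions Phi Psi).
Qed.

End Reduction.

Unset Implicit Arguments.

(** The local setting is fixed by a jet [j0] on Q_(r) at which G and its differential consequences
    vanish; the solutions concerned are those whose r-jets stay in the neighbourhood [V] of [j0].
    The proof translates the hypotheses into the germ form of [local_solutions]. *)
Theorem corollary11 (R : realType) (r k : nat)
  (Om : set (jet_space R r)) (L : jet_space R r -> R)
  (xi : 'I_2 -> jet_space R 0 -> R) (eta : jet_space R 0 -> R)
  (i i' : 'I_2) (G : 'rV[R]_2 * 'rV[R]_k.+1 -> R) (j0 : jet_space R r)
  (Om_open : open Om)
  (L_order : has_order Om L)
  (Q_field : vector_field xi eta Om)
  (Q_reduction : reduction_operator xi eta Om L)
  (Q_singular : weakly_singular xi eta Om L k)
  (neq_ii' : i != i')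
  (xi_neq0 : forall j, Om j -> xi i' (jproj 0 j) != 0)
  (G_assoc : associated (Om `&` Qmanifold xi eta r) L (@pure_jet R i k r) G)
  (G_rank : maximal_rank i (Om `&` Qmanifold xi eta r) G)
  (Om_j0 : Om j0)
  (Q_j0 : Qmanifold xi eta r j0)
  (G_j0 : consequences (fun j : jet_space R k => G (pure_jet i k j)) r j0) :
  exists (U : set 'rV[R]_2) (V : set (jet_space R r)) (C : set 'rV[R]_k)
         (f : 'rV[R]_2 * 'rV[R]_k -> R),
    [/\ open U, U j0.1, open V, V j0 & V `<=` Om] /\
    parametric_family U C f /\
    (forall c, C c ->
       Qinvariant_solution xi eta V L U (fun x => f (x, c))) /\
    (forall (W : set 'rV[R]_2) (u : 'rV[R]_2 -> R),
       open W -> connected W -> W `<=` U ->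
       Qinvariant_solution xi eta V L W u ->
       exists2 c, C c & forall x, W x -> u x = f (x, c)).
Proof.
have [kr _ _ _] := Q_singular.
have [Ls _] := L_order; have [xis etas _] := Q_field.
have [sG [lam [lams lam0 LG]]] := G_assoc.
(* The reference polynomial [p] has r-jet [j0]. It need not solve anything away from the base point;
   there, the manifold conditions on [j0] become the orders of vanishing collected in [good_jet]. *)
have [p [ps pj]] := taylor j0.
pose x0 := j0.1; pose s0 := (x0, wjet k i p x0); pose v0 := iderive (nseq k (ed i)) p x0.
have Mj0 : (Om `&` Qmanifold xi eta r) j0 by [].
have pj0 : jproj 0 j0 = jet 0 p x0 by rewrite -[in LHS]pj jproj_jet.
have xs l : sm (xi l) (jet 0 p x0).
  by rewrite -pj0; move/smooth_onP: (xis l); apply; exists j0.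
have es : sm eta (jet 0 p x0) by rewrite -pj0; move/smooth_onP : etas; apply; exists j0.
have xn : xi i' (jet 0 p x0) != 0 by rewrite -pj0; exact: xi_neq0.
have pk : pure_jet i k j0 = pure_jet i k (jet k p x0).
  by rewrite -[in LHS]pj !pure_jet_snoc//; exact: ltnW.
have Gs : sm G (pure_jet i k (jet k p x0)).
  by rewrite -pk; move/smooth_onP : sG; apply; exists j0.
have sch : sm (characteristic xi eta) (jet 1 p x0).
  by apply: sm_char => [l|]; rewrite jproj_jet.
have sGk : sm (fun j : jet_space R k => G (pure_jet i k j)) (jet k p x0).
  by apply: (@sm_comp _ _ _ _ _ _ (@pure_jet R i k k) G) => //; exact: sm_pure_jet.
have Qv : vanish dirs r.-1 (fun y => characteristic xi eta (jet 1 p y)) x0.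
  apply/vanish_pder.
    by apply: (@sm_comp _ _ _ _ _ _ (jet 1 p)) => //; exact: sm_jet.
  move=> a b ab; have := Q_j0; rewrite -pj => /(consequences_jet r (ps _) sch); apply.
  by rewrite addn1; apply: leq_ltn_trans ab _; rewrite prednK// (leq_ltn_trans _ kr).
have Gv : vanish dirs (r - k) (fun y => G (pure_jet i k (jet k p y))) x0.
  apply/vanish_pder.
    by apply: (@sm_comp _ _ _ _ _ _ (jet k p) (fun j : jet_space R k => G (pure_jet i k j))) => //; exact: sm_jet.
  move=> a b ab; have := G_j0; rewrite -pj => /(consequences_jet r (ps _) sGk); apply.
  by rewrite -(subnK (ltnW kr)) leq_add2r.
have pg : good_jet r xi eta i G p x0 by split=> //; exact: vanish_dirs_pure Gv.
have G0 := vanish0 Gv.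
have Gn : 'D_(0, delta_mx 0 ord_max) G (pure_jet i k (jet k p x0)) != 0.
  by have := G_rank _ Mj0; rewrite pk; exact.
have psn : pure_jet i k (jet k p x0) = (s0.1, snoc s0.2 v0) by rewrite pure_jet_snoc.
have [gt [gs g0 gF gU]] : exists gt : ('rV[R]_2 * 'rV[R]_k) * R -> R,
   [/\ sm gt (s0, 0), gt (s0, 0) = v0,
   \forall p \near (s0, 0 : R), G (p.1.1, snoc p.1.2 (gt p)) = p.2 &
   \forall p \near ((s0, 0 : R), v0), G (p.1.1.1, snoc p.1.1.2 p.2) = p.1.2 -> p.2 = gt p.1].
  by apply: solve_top; rewrite -psn.
have Omn : \forall j \near jet r p x0, Om j by rewrite pj; exact: near_open.
have Ls0 : sm L (jet r p x0) by rewrite pj; move/smooth_onP : Ls; exact.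
have lams0 : sm lam (jet r p x0) by rewrite pj; move/smooth_onP : lams; exact.
have lam0' j : Om j -> Qmanifold xi eta r j -> lam j != 0 by move=> Oj Qj; exact: lam0.
have LG' j : Om j -> Qmanifold xi eta r j -> L j = lam j * G (pure_jet i k j).
  by move=> Oj Qj; exact: LG.
have kr' := ltnW kr.
rewrite -pj.
exact: (local_solutions kr' neq_ii' gs g0 gF gU pg Gn Gs xs es xn Omn Ls0 lams0 lam0' LG' Q_reduction).
Qed.
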